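(* Let $d\ge 1$ and let $X\in\mathbb{R}^d$ and $Y\in\mathbb{R}^d$ be mean-zero Gaussian random vectors with covariance matrices $\Sigma_X$ and $\Sigma_Y$ satisfying $\Sigma_Y-\Sigma_X\succeq 0$. Let $f:\mathbb{R}^d\to\mathbb{R}$ be lower semicontinuous and quasiconvex, and define $$m_Y^-=\inf\{t\in\mathbb{R}:\Pr\{f(Y)\le t\}\ge 1/2\}.$$ Then: (i) for every $a>m_Y^-$, $\Pr\{f(X)\ge a\}\le\Pr\{f(Y)\ge a\}$; (ii) $\Pr\{f(X)>m_Y^-\}\le\Pr\{f(Y)>m_Y^-\}$; (iii) if additionally $\Pr\{f(X)=m_Y^-\}=0$, then $\Pr\{f(X)\ge m_Y^-\}\le\Pr\{f(Y)\ge m_Y^-\}$.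
   Context: For symmetric matrices, $A\succeq 0$ means that $A$ is positive semidefinite. The covariance matrices are allowed to be singular. A function $f:\mathbb{R}^d\to\mathbb{R}$ is quasiconvex if every sublevel set $\{w: f(w)\le a\}$, $a\in\mathbb{R}$, is convex. No assumption is made on the joint distribution of $X$ and $Y$. *)

(* Defs.v *)
From HB Require Import structures.
From mathcomp Require Import all_boot all_order all_algebra.
From mathcomp Require Import all_classical all_reals all_analysis.
Set Implicit Arguments.
Unset Strict Implicit.
Unset Printing Implicit Defensive.
Import Order.TTheory GRing.Theory Num.Theory.
Import numFieldNormedType.Exports.
Local Open Scope classical_set_scope.
Local Open Scope ring_scope.

Definition psdmx (R : realType) (d : nat) (A : 'M[R]_d) : Prop :=
  A^T = A /\ forall u : 'rV[R]_d, 0 <= (u *m A *m u^T) 0 0.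

Definition quasiconvex (R : realType) (d : nat) (f : 'rV[R]_d -> R) : Prop :=
  forall a : R,
    convex_set ([set w | f w <= a] : set (convex_lmodType 'rV[R]_d)).

(* [normal_prob m s] is the uniform law on [0, 1] when the standard deviation
   [s] is 0, so N(m, 0) is given separately, as the Dirac mass at [m]. *)
Definition gaussian_var (R : realType) (dT : measure_display)
    (T : measurableType dT) (P : probability T R) (Z : T -> R) : Prop :=
  measurable_fun [set: T] Z /\
  exists m s : R, forall A : set (measurableTypeR R), measurable A ->
    P (Z @^-1` A) =
      if s == 0 then dirac (m : measurableTypeR R) A else normal_prob m s A.

(* The coordinates are the case where [u] is a basis vector, so in particular
   [X] is Borel measurable. *)
Definition gaussian_vector (R : realType) (dT : measure_display)
    (T : measurableType dT) (P : probability T R) (d : nat)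
    (X : T -> 'rV[R]_d) : Prop :=
  forall u : 'rV[R]_d, gaussian_var P (fun w => \sum_(i < d) u 0 i * X w 0 i).

Definition mean_zero (R : realType) (dT : measure_display)
    (T : measurableType dT) (P : probability T R) (d : nat)
    (X : T -> 'rV[R]_d) : Prop :=
  forall i : 'I_d, 'E_P[fun w => X w 0%R i]%E = 0%E.

Definition has_covariance_matrix (R : realType) (dT : measure_display)
    (T : measurableType dT) (P : probability T R) (d : nat)
    (X : T -> 'rV[R]_d) (Sigma : 'M[R]_d) : Prop :=
  forall i j : 'I_d,
    covariance P (fun w => X w 0 i) (fun w => X w 0 j) = (Sigma i j)%:E.

Definition lower_median (R : realType) (dT : measure_display)
    (T : measurableType dT) (P : probability T R) (Z : T -> R) : R :=
  inf [set t : R | ((2^-1)%:E <= P [set w | (Z w <= t)%R])%E].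

(* Main.v *)
Require Import Defs.
From HB Require Import structures.
From mathcomp Require Import all_boot all_order all_algebra.
From mathcomp Require Import all_classical all_reals all_analysis.
From mathcomp Require Import measurable_realfun.
From mathcomp Require Import ring lra.
Import Order.TTheory GRing.Theory Num.Theory.
Import numFieldNormedType.Exports.
Local Open Scope classical_set_scope.
Local Open Scope ring_scope.
Set Implicit Arguments.
Unset Strict Implicit.
Unset Printing Implicit Defensive.

(** Fix a level [a] at least the lower median [m] of [f(Y)] and let [K] be the
sublevel set of [f] at [a]: it is closed, convex, and has probability at
least 1/2 under [Y].  All three claims follow from the set inequality
[P(Y in K) <= P(X in K)] ([set_comparison]) by passing to complements, with
a monotone limit for the sets where [f < a].

Only the laws matter, so [Y] may be thought of as [X + Z] with [Z] a centred
Gaussian vector independent of [X] and of covariance [SigmaY - SigmaX].  Put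
[F(w) = P(w + X in K)].  Ehrhard's inequality says that [v], the composite of
the inverse of [Phi] with [F], is midpoint concave.  Hence
[v(z) + v(-z) <= 2 v(0)], and this forces [E F(Z) <= F(0)] as soon as
[E F(Z) >= 1/2]: if [v(0) >= 0], then [F(z) + F(-z) <= 2 F(0)], because [Phi]
is concave on the positive half-line and antisymmetric about [(0, 1/2)]; if
[v(0) < 0], then [F(z) + F(-z) < 1] for all [z], contradicting
[E F(Z) >= 1/2].  This is [smear_contract].

Averages against Gaussian vectors are written without a probability space:
[smear z F w] is the average of [F (w + x *: z)] over a standard normal [x],
and [smears zs F] iterates this along a list.  A positive semidefinite matrix
is a sum of [z^T *m z] ([psd_factor]), and the expectation of a bounded
Lipschitz function of a centred Gaussian vector with that covariance is
[smears zs F 0] ([gaussian_smears]).  The latter is a Cramer-Wold statement: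
both sides agree on cosines by [gcosE], and one coordinate at a time a
Lipschitz function is replaced by Bernstein polynomials in the sine of that
coordinate, which are trigonometric polynomials in it.

Since everything is averaged along lines, Ehrhard's inequality is needed only
in dimension one, in the functional form of [functional_ehrhard].  The proof
is a maximum principle for the heat flow, after Borell.  If the flow started
at [f0], [f1] and [h] breaks the inequality at time 1, then the
difference of its two sides ([gap]), penalized by a multiple of the time variable squared, attains a
negative minimum at a positive time.  Instead of differentiating, one compares
that minimum with nearby points along the curve
[r |-> (s / sqrt (1 + r^2), x + s r / (1 + r^2))].  On this curve the density
of the Gaussian law relative to the one at [r = 0] is [1 + r z + O(r^3)]
([gauss_ratio_shift_taylor]): the missing quadratic term is the heat equation.
After composing with the inverse of [Phi] the second-order terms have the
sign that contradicts minimality ([gap_min_ge0]).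

Indicators of sets are not Lipschitz, so [F] is taken to be
[Phi (N - (2 N / delta) dist(., K))], whose composite with the inverse of
[Phi] is concave.  Letting [N] grow needs a neighbourhood of [K] to have
probability strictly above 1/2 under [Y]; this is [near_half]. *)

(** * Bounded functions and Gaussian densities *)

Section expectation.
Context (R : realType) (dT : measure_display) (T : measurableType dT)
  (P : probability T R).

Lemma bounded_integrable (f : T -> R) (c : R) :
  measurable_fun setT f -> (forall x, `|f x| <= c) ->
  P.-integrable setT (EFin \o f).
Proof.
move=> mf fc; apply: (@le_integrable _ _ _ _ _ measurableT _ (EFin \o cst c)).
- exact/measurable_EFinP.
- by move=> x _ /=; rewrite lee_fin (le_trans (fc x))// ler_norm.
- by apply: finite_measure_integrable_cst.
Qed.

Lemma Rintegral_cst1 (c : R) : \int[P]_x c = c.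
Proof.
by rewrite Rintegral_cst//; have /= -> := @probability_setT _ _ _ P; rewrite mulr1.
Qed.

End expectation.

Section gauss.
Context (R : realType).
Implicit Types (f g : R -> R) (m s x : R).
Local Notation mu := (@lebesgue_measure R).

(** The Gaussian law is defined by integrating its density, which therefore agrees
almost everywhere with its Radon-Nikodym derivative. *)
Lemma ge0_integral_normal_prob m s (f : R -> R) :
  measurable_fun setT f -> (forall x, 0 <= f x) ->
  (\int[normal_prob m s]_x (f x)%:E =
   \int[mu]_x (f x * normal_pdf m s x)%:E)%E.
Proof.
move=> mf f0.
have dom := normal_prob_dominates m s.
have mf' : measurable_fun setT (EFin \o f) by exact/measurable_EFinP.
rewrite -(Radon_Nikodym_SigmaFinite.change_of_variables dom)//=.
under [RHS]eq_integral do rewrite EFinM.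
have mp : measurable_fun setT (fun x => (normal_pdf m s x)%:E).
  by apply/measurable_EFinP; exact: measurable_normal_pdf.
have iRN := Radon_Nikodym_SigmaFinite.f_integrable dom.
apply: ae_eq_integral => //.
- by apply: emeasurable_funM => //; exact: (measurable_int mu).
- exact: emeasurable_funM.
- apply: ae_eqe_mul2l => /=.
  apply: integral_ae_eq => //.
  by move=> E _ mE; rewrite -Radon_Nikodym_SigmaFinite.f_integral.
Qed.

Definition gauss : probability _ R := normal_prob (0 : R) 1.

Definition gexp f : R := \int[gauss]_x f x.

Lemma integral_affine m s (g : R -> R) : 0 < s -> continuous g ->
  (forall x, 0 <= g x) ->
  (\int[mu]_x (g x)%:E = \int[mu]_x (g (m + s * x) * s)%:E)%E.
Proof.
move=> s0 cg g0.
have dF : (fun x => m + s * x)^`()%classic = cst s.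
  apply/funext => x; rewrite derive1E deriveD// derive_cst add0r.
  by rewrite deriveM// derive_cst derive_id scaler0 addr0 /GRing.scale/= mulr1.
rewrite (increasing_ge0_integration_by_substitutionT (F := fun x => m + s * x))//.
- by under [LHS]eq_integral do rewrite dF.
- by move=> x y xy; rewrite ltrD2l ltr_pM2l.
- by rewrite dF; exact: cst_continuous.
- by rewrite dF; exact: is_cvg_cst.
- by rewrite dF; exact: is_cvg_cst.
- rewrite (_ : (fun x => m + s * x) = (fun x => x + m) \o (fun x => x * s)).
    apply: cvg_comp; last exact: cvg_addrr_Ny.
    by apply/gt0_cvgMlNy.
  by apply/funext => x /=; rewrite addrC mulrC.
- rewrite (_ : (fun x => m + s * x) = (fun x => x + m) \o (fun x => x * s)).
    apply: cvg_comp; last exact: cvg_addrr.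
    by apply/gt0_cvgMly.
  by apply/funext => x /=; rewrite addrC mulrC.
Qed.

Lemma normal_pdf_affine m s x : 0 < s ->
  normal_pdf m s (m + s * x) * s = normal_pdf 0 1 x.
Proof.
move=> s0; rewrite !normal_pdfE ?oner_eq0 ?gt_eqF//.
rewrite /normal_fun/= /normal_peak addrAC subrr add0r subr0 expr1n mul1r.
rewrite -mulrnAr sqrtrM ?sqr_ge0// sqrtr_sqr gtr0_norm// invfM.
rewrite mulrAC [s^-1 / _]mulrC mulfVK ?gt_eqF//.
suff -> : - (s * x) ^+ 2 / (s ^+ 2 *+ 2) = - x ^+ 2 / 2.
  by move: (Num.sqrt _) (expR _) => c e; ring.
rewrite -(mulr_natr (s ^+ 2)).
have s_neq0 : s != 0 by rewrite gt_eqF.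
by field.
Qed.

(** Density of N(m, s^2) with respect to N(0, 1). *)
Definition gauss_ratio m s x := s^-1 * expR (x ^+ 2 / 2 - (x - m) ^+ 2 / (s ^+ 2 *+ 2)).

Lemma gauss_ratioE m s x : 0 < s ->
  normal_pdf m s x = gauss_ratio m s x * normal_pdf 0 1 x.
Proof.
move=> s0; rewrite !normal_pdfE ?oner_eq0 ?gt_eqF// /normal_fun/= /gauss_ratio.
rewrite /normal_peak subr0 expr1n mul1r -mulrnAr sqrtrM ?sqr_ge0//.
rewrite sqrtr_sqr gtr0_norm// invfM mulrACA -expRD.
suff -> : - (x - m) ^+ 2 / (s ^+ 2 *+ 2) =
    x ^+ 2 / 2 - (x - m) ^+ 2 / (s ^+ 2 *+ 2) + - x ^+ 2 / 2.
  by move: (Num.sqrt _) (expR _) => c e; ring.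
rewrite -(mulr_natr (s ^+ 2)).
have s_neq0 : s != 0 by rewrite gt_eqF.
by field.
Qed.

Lemma gauss_ratio_ge0 m s x : 0 < s -> 0 <= gauss_ratio m s x.
Proof. by move=> s0; rewrite mulr_ge0 ?expR_ge0// invr_ge0 ltW. Qed.

Lemma continuous_gauss_ratio m s : continuous (gauss_ratio m s).
Proof.
move=> x; apply: cvgM; first exact: cvg_cst.
apply: continuous_cvg; first exact: continuous_expR.
apply: cvgB; apply: cvgM; (try exact: cvg_cst).
  exact: sqr_continuous.
apply: (cvg_comp (fun x => x - m) (fun x => x ^+ 2)).
  by apply: cvgB => //; [exact: cvg_id|exact: cvg_cst].
exact: sqr_continuous.
Qed.

Lemma ge0_integral_gauss_affine m s (g : R -> R) : 0 < s -> continuous g ->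
  (forall x, 0 <= g x) ->
  (\int[gauss]_x (g (m + s * x))%:E = \int[normal_prob m s]_x (g x)%:E)%E.
Proof.
move=> s0 cg g0.
have caff : continuous (fun x => m + s * x).
  by move=> x; apply: cvgD; [exact: cvg_cst|apply: cvgM; [exact: cvg_cst|exact: cvg_id]].
rewrite !ge0_integral_normal_prob//.
- rewrite (@integral_affine m s (fun x => g x * normal_pdf m s x))//.
  + apply: eq_integral => x _; congr EFin.
    by rewrite -mulrA normal_pdf_affine.
  + move=> x; apply: cvgM; first exact: cg.
    by apply: continuous_normal_pdf; rewrite gt_eqF.
  + by move=> x; rewrite mulr_ge0// normal_pdf_ge0.
- apply: continuous_measurable_fun => x.
  exact: (continuous_comp (caff x) (cg _)).
- exact: continuous_measurable_fun.
Qed.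

Lemma ge0_integral_gauss_ratio m s (g : R -> R) : 0 < s -> continuous g ->
  (forall x, 0 <= g x) ->
  (\int[normal_prob m s]_x (g x)%:E = \int[gauss]_x (g x * gauss_ratio m s x)%:E)%E.
Proof.
move=> s0 cg g0; rewrite !ge0_integral_normal_prob//.
- by apply: eq_integral => x _; rewrite gauss_ratioE// mulrA.
- apply: continuous_measurable_fun => x.
  by apply: cvgM; [exact: cg|exact: continuous_gauss_ratio].
- by move=> x; rewrite mulr_ge0// gauss_ratio_ge0.
- exact: continuous_measurable_fun.
Qed.

End gauss.

(** * One-variable calculus *)

Section calculus.
Context (R : realType).
Implicit Types (f g : R -> R) (x y a b : R).

(** Fixing the direction of differentiation to 1 lets the rules below be chained by
unification. *)
Definition has_deriv f x a : Prop := is_derive x (1 : R) f a.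

Lemma has_deriv_eq f x a b : has_deriv f x a -> a = b -> has_deriv f x b.
Proof. by move=> + <-. Qed.

Lemma has_derivD f g x a b : has_deriv f x a -> has_deriv g x b ->
  has_deriv (fun y => f y + g y) x (a + b).
Proof. by move=> ? ?; exact: is_deriveD. Qed.

Lemma has_derivM f g x a b : has_deriv f x a -> has_deriv g x b ->
  has_deriv (fun y => f y * g y) x (f x * b + g x * a).
Proof. by move=> ? ?; exact: is_deriveM. Qed.

Lemma has_derivN f x a : has_deriv f x a -> has_deriv (fun y => - f y) x (- a).
Proof. by move=> ?; exact: is_deriveN. Qed.

Lemma has_deriv_cst x b : has_deriv (fun=> b) x 0.
Proof. exact: is_derive_cst. Qed.

Lemma has_deriv_id x : has_deriv (fun y => y) x 1.
Proof. exact: is_derive_id. Qed.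

Lemma has_deriv_comp f g x a b : has_deriv f (g x) a -> has_deriv g x b ->
  has_deriv (fun y => f (g y)) x (a * b).
Proof. by move=> ? ?; exact: is_derive1_comp. Qed.

Lemma has_deriv_exp f x a : has_deriv f x a ->
  has_deriv (fun y => expR (f y)) x (expR (f x) * a).
Proof. by move=> ?; apply: has_deriv_comp => //; exact: is_derive_expR. Qed.

Lemma has_deriv_continuous f (df : R -> R) :
  (forall x, has_deriv f x (df x)) -> continuous f.
Proof.
move=> h x; apply/differentiable_continuous/derivable1_diffP.
by case: (h x).
Qed.

Lemma mvt f (df : R -> R) a b : (forall x, has_deriv f x (df x)) -> a <= b ->
  exists2 c, a <= c <= b & f b - f a = df c * (b - a).
Proof.
move=> h ab.
have [c + e] := MVT_segment ab (fun x _ => h x)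
  (continuous_subspaceT (has_deriv_continuous h)).
by rewrite in_itv/= => cab; exists c.
Qed.

Lemma deriv_bound f (df : R -> R) (M s : R) :
  (forall y, has_deriv f y (df y)) -> f 0 = 0 ->
  (forall y, `|y| <= `|s| -> `|df y| <= M) -> `|f s| <= M * `|s|.
Proof.
move=> h f0 hM; have [s0|/ltW s0] := leP 0 s.
  have [c c01 e] := mvt h s0; rewrite f0 !subr0 in e.
  rewrite e normrM ler_wpM2r//; apply: hM.
  by rewrite !ger0_norm//; case/andP: c01.
have [c c01 e] := mvt h s0; rewrite f0 !sub0r in e.
rewrite -normrN e normrM normrN ler_wpM2r//; apply: hM.
by rewrite !ler0_norm// ?lerN2; case/andP: c01.
Qed.

End calculus.

(** * Expansion of ratios of Gaussian densities *)

Section ratio_taylor.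
Context (R : realType).
Implicit Types (x y : R).

Let q y : R := expR (y - y ^+ 2 / 2).

Let dq y : has_deriv q y ((1 - y) * q y).
Proof.
rewrite /q; apply: has_deriv_eq.
  apply: has_deriv_exp; apply: has_derivD; first exact: has_deriv_id.
  by apply: has_derivN; apply: has_derivM; [apply: has_derivM; exact: has_deriv_id|exact: has_deriv_cst].
by rewrite /=; field.
Qed.

Let q_le2 y : q y <= 2.
Proof.
apply: (@le_trans _ _ (expR (2^-1 : R))).
  by rewrite ler_expR; have := sqr_ge0 (y - 1); lra.
have := expR_ge1Dx (- 2^-1 : R); have := expRxMexpNx_1 (2^-1 : R).
by have := expR_gt0 (2^-1 : R); nra.
Qed.

Let q_ge0 y : 0 <= q y. Proof. exact: expR_ge0. Qed.

Let q_lin y : `|y - 2| * q y <= 4.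
Proof.
apply: (@le_trans _ _ (`|y - 1| * q y + q y)).
  rewrite -{3}[q y]mul1r -mulrDl ler_wpM2r//.
  rewrite (_ : y - 2 = (y - 1) - 1); last by lra.
  by rewrite (le_trans (ler_normB _ _))// normr1.
suff : `|y - 1| * q y <= 2 by have := q_le2 y; lra.
have -> : q y = expR 2^-1 * expR (- ((y - 1) ^+ 2 / 2)).
  by rewrite -expRD; congr expR; field.
have h : expR (2^-1 : R) <= 2.
  by have := q_le2 1; rewrite /q expr1n (_ : 1 - 1 / 2 = 2^-1)//; lra.
have e1 := expRxMexpNx_1 ((y - 1) ^+ 2 / 2).
have e2 := expR_ge1Dx ((y - 1) ^+ 2 / 2).
have e3 := expR_gt0 (- ((y - 1) ^+ 2 / 2)).
have e4 : `|y - 1| <= 1 + (y - 1) ^+ 2 / 2.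
  by rewrite -[(y - 1) ^+ 2]real_normK ?num_real//; have := sqr_ge0 (`|y - 1| - 1); nra.
have e5 : `|y - 1| * expR (- ((y - 1) ^+ 2 / 2)) <= 1.
  rewrite -[leRHS]e1 ler_pM2r//; lra.
have := normr_ge0 (y - 1); have := expR_gt0 (2^-1 : R).
rewrite mulrCA; set a := _ * expR (- _) in e5 *; move: e5 h => e5 h ? ?.
by apply: (le_trans _ h); rewrite -[leRHS]mulr1 ler_wpM2l ?expR_ge0.
Qed.

(** The expansion has no quadratic term: the second derivative is [y^2 - 2 y] times
the exponential, which vanishes at 0 and is at most [4 |y|]. *)
Lemma expR_quad_taylor y :
  `|expR (y - y ^+ 2 / 2) - (1 + y)| <= 4 * `|y| ^+ 3.
Proof.
pose k1 y := (1 - y) * q y - 1.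
have dk1 x : has_deriv k1 x ((x ^+ 2 - 2 * x) * q x).
  rewrite /k1; apply: has_deriv_eq.
    apply: has_derivD; last exact: has_deriv_cst.
    apply: has_derivM; last exact: dq.
    apply: has_derivD; first exact: has_deriv_cst.
    by apply: has_derivN; exact: has_deriv_id.
  by rewrite /=; ring.
have dk x : has_deriv (fun y => q y - (1 + y)) x (k1 x).
  rewrite /k1; apply: has_deriv_eq.
    apply: has_derivD; first exact: dq.
    apply: has_derivN; apply: has_derivD; first exact: has_deriv_cst.
    exact: has_deriv_id.
  by rewrite /=; ring.
have q0 : q 0 = 1 by rewrite /q expr0n/= mul0r subr0 expR0.
have bk1 s : `|k1 s| <= 4 * `|s| ^+ 2.
  rewrite expr2 mulrA; apply: (deriv_bound dk1).
    by rewrite /k1 q0; ring.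
  move=> x xs; rewrite (_ : _ * _ = (x - 2) * q x * x); last by ring.
  rewrite normrM ler_pM//; rewrite normrM (ger0_norm (q_ge0 _)).
  exact: q_lin.
rewrite [`|y| ^+ 3]exprSr mulrA; apply: (deriv_bound dk); first by rewrite q0; ring.
move=> x xs; apply: (le_trans (bk1 _)); rewrite ler_wpM2l//.
by rewrite ler_sqr ?nnegrE.
Qed.

(** The logarithm of this product is [ln (1 + r^2) / 2 - r^2 / (2 (1 + r^2))], whose
terms of order [r^2] cancel. *)
Lemma ratio_prefactor (r : R) (t := 1 + r ^+ 2) :
  1 <= Num.sqrt t * expR (- (r ^+ 2 / (2 * t))) <= 1 + r ^+ 4.
Proof.
have r0 : 0 <= r ^+ 2 by exact: sqr_ge0.
have t0 : 0 < t by rewrite /t; lra.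
set N := _ * _.
have N0 : 0 <= N by rewrite mulr_ge0 ?sqrtr_ge0 ?expR_ge0.
have N2 : N ^+ 2 = t * expR (- (r ^+ 2 / t)).
  rewrite /N exprMn sqr_sqrtr ?ltW// expr2 -expRD; congr (_ * expR _).
  by have ? : t != 0; [rewrite gt_eqF|field].
have e1 := expR_ge1Dx (- (r ^+ 2 / t)).
have e2 := expR_ge1Dx (r ^+ 2 / t).
have e3 := expRxMexpNx_1 (r ^+ 2 / t).
have e0 := expR_gt0 (- (r ^+ 2 / t)).
have tt : t * (r ^+ 2 / t) = r ^+ 2 by rewrite mulrC mulfVK// gt_eqF.
have x0 : 0 <= r ^+ 2 / t by rewrite divr_ge0// ltW.
have L : 1 <= N ^+ 2.
  by rewrite N2; have := ler_wpM2l (ltW t0) e1; rewrite /t in tt *; nra.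
have U : N ^+ 2 <= 1 + r ^+ 4.
  rewrite N2 (_ : r ^+ 4 = (r ^+ 2) ^+ 2); last by ring.
  move: tt e2 e3 e0 x0; set a := expR (- _); set b := r ^+ 2 / t; set c := expR b.
  move=> tt e2 e3 e0 x0.
  have : (1 + b) * a <= 1 by nra.
  rewrite -(ler_pM2l t0) mulrA mulrDr tt mulr1 => h.
  have : (1 + 2 * r ^+ 2) * a <= t by rewrite /t in h *; nra.
  move=> h2; rewrite -(ler_pM2l (_ : 0 < 1 + 2 * r ^+ 2)); last by lra.
  rewrite mulrCA; apply: (le_trans (ler_wpM2l (ltW t0) h2)).
  by rewrite /t; nra.
apply/andP; split; first by nra.
by have : 0 <= r ^+ 4; [rewrite (_ : r ^+ 4 = (r ^+ 2) ^+ 2); [exact: sqr_ge0|ring]|nra].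
Qed.

Local Notation sc r := ((Num.sqrt (1 + r ^+ 2))^-1).

(** With mean [k r / (1 + r^2)] and variance [1 / (1 + r^2)] the exponent becomes a
polynomial in [z] whose coefficients [k r] and [- r^2 / 2] carry no
denominator. *)
Lemma gauss_ratio_curve (k r z : R) (t := 1 + r ^+ 2) :
  gauss_ratio (k * r / t) (sc r) z =
  Num.sqrt t * expR (- (k ^+ 2 * r ^+ 2 / (2 * t)) + (k * r * z - r ^+ 2 * z ^+ 2 / 2)).
Proof.
have t0 : 0 < t by rewrite /t; have := sqr_ge0 r; lra.
rewrite /gauss_ratio invrK; congr (_ * expR _).
rewrite exprVn sqr_sqrtr ?ltW// -/t -mulr_natr.
have -> : r ^+ 2 = t - 1 by rewrite /t; ring.
have ? : t != 0 by rewrite gt_eqF.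
have -> : (z - k * r / t) ^+ 2 = z ^+ 2 - 2 * z * (k * r / t) + k ^+ 2 * r ^+ 2 / t ^+ 2 by field.
have -> : r ^+ 2 = t - 1 by rewrite /t; ring.
by field.
Qed.

(** Shifting the mean by [r] and shrinking the variance by [r^2] have opposite
effects at order [r^2], so only the linear term survives. *)
Lemma gauss_ratio_shift_taylor (r z : R) : `|r| <= 1 ->
  `|gauss_ratio (r / (1 + r ^+ 2)) (sc r) z - (1 + r * z)|
    <= 6 * `|r| ^+ 3 * (1 + z ^+ 4).
Proof.
move=> r1; rewrite -[r in r / _]mul1r gauss_ratio_curve expr1n !mul1r expRD mulrA.
have /andP[N1 N2] := ratio_prefactor r.
set N := Num.sqrt _ * _ in N1 N2 *.
rewrite -exprMn -/(q (r * z)).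
have e1 : N * q (r * z) - (1 + r * z) = (N - 1) * q (r * z) + (q (r * z) - (1 + r * z)).
  by ring.
rewrite e1 (le_trans (ler_normD _ _))//.
have e2 : `|(N - 1) * q (r * z)| <= 2 * `|r| ^+ 3.
  rewrite normrM (ger0_norm (q_ge0 _)) mulrC ler_pM//.
  rewrite ger0_norm; last by lra.
  rewrite (_ : r ^+ 4 = `|r| ^+ 4) in N2; last first.
    by rewrite -normrX ger0_norm// (_ : r ^+ 4 = (r ^+ 2) ^+ 2); [exact: sqr_ge0|ring].
  have : `|r| ^+ 4 <= `|r| ^+ 3 by rewrite exprS ler_piMl// exprn_ge0.
  by lra.
have e3 := expR_quad_taylor (r * z); rewrite normrM [(`|r| * _) ^+ 3]exprMn in e3.
have e4 : `|z| ^+ 3 <= 1 + z ^+ 4.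
  rewrite (_ : z ^+ 4 = `|z| ^+ 4); last first.
    by rewrite -normrX ger0_norm// (_ : z ^+ 4 = (z ^+ 2) ^+ 2); [exact: sqr_ge0|ring].
  have [z1|z1] := leP `|z| 1.
    have : `|z| ^+ 3 <= 1 by rewrite exprn_ile1.
    by have z4 : 0 <= `|z| ^+ 4 := exprn_ge0 _ (normr_ge0 _); lra.
  have : `|z| ^+ 3 <= `|z| ^+ 4 by rewrite [leRHS]exprS ler_peMl ?exprn_ge0// ltW.
  by lra.
have r3 : 0 <= `|r| ^+ 3 by rewrite exprn_ge0.
have e5 := ler_wpM2l r3 e4.
rewrite /q in e2 e3 *.
have : 0 <= z ^+ 4 by rewrite (_ : z ^+ 4 = (z ^+ 2) ^+ 2); [exact: sqr_ge0|ring].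
move=> z4; have := mulr_ge0 r3 z4.
by lra.
Qed.

Lemma gauss_ratio_scale_taylor (r z : R) :
  `|gauss_ratio 0 (sc r) z - 1| <= r ^+ 2 * (1 + z ^+ 2).
Proof.
rewrite [X in gauss_ratio X](_ : 0 = 0 * r / (1 + r ^+ 2)); last by rewrite !mul0r.
rewrite gauss_ratio_curve expr0n/= !mul0r oppr0 !add0r.
have r0 := sqr_ge0 r; have z0 := sqr_ge0 z.
have s1 : 1 <= Num.sqrt (1 + r ^+ 2) by rewrite -[leLHS]sqrtr1 ler_sqrt; lra.
have s2 : Num.sqrt (1 + r ^+ 2) ^+ 2 = 1 + r ^+ 2 by rewrite sqr_sqrtr; lra.
have e1 := expR_ge1Dx (- (r ^+ 2 * z ^+ 2 / 2)).
have e2 : expR (- (r ^+ 2 * z ^+ 2 / 2)) <= 1.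
  by rewrite -[leRHS]expR0 ler_expR; have := mulr_ge0 r0 z0; lra.
have e0 := expR_gt0 (- (r ^+ 2 * z ^+ 2 / 2)).
move: e0 e1 e2 s1 s2 (mulr_ge0 r0 z0).
set e := expR _; set s := Num.sqrt _ => e0 e1 e2 s1 s2 rz.
rewrite mulrDr mulr1 ler_norml; apply/andP; split; last by nra.
by nra.
Qed.

End ratio_taylor.

(** * Gaussian expectations of functions of polynomial growth *)

Section tame.
Context (R : realType).
Implicit Types (f g : R -> R) (m s x c : R).

(** Growth of degree four is what the remainder of [gauss_ratio_shift_taylor]
requires. *)
Definition tame f :=
  continuous f /\ exists C : R, forall x, `|f x| <= C * (1 + x ^+ 4).

Lemma exprn4_ge0 (x : R) : 0 <= x ^+ 4.
Proof. by rewrite (_ : x ^+ 4 = (x ^+ 2) ^+ 2); [exact: sqr_ge0|ring]. Qed.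

Lemma continuous_exprn n : continuous (fun x : R => x ^+ n).
Proof. by move=> x; exact: exprn_continuous. Qed.

Lemma tame_bounded f c : continuous f -> (forall x, `|f x| <= c) -> tame f.
Proof.
move=> cf fc; split => //; exists c => x; apply: (le_trans (fc x)).
have c0 : 0 <= c := le_trans (normr_ge0 _) (fc 0).
by rewrite mulrDr mulr1 lerDl mulr_ge0// exprn4_ge0.
Qed.

Lemma tame_cst c : tame (fun=> c).
Proof. by apply: (@tame_bounded _ `|c|) => //; exact: cst_continuous. Qed.

Lemma tame_exprn4 : tame (fun x => x ^+ 4).
Proof.
split; first exact: continuous_exprn.
exists 1 => x; rewrite mul1r ger0_norm ?exprn4_ge0//; lra.
Qed.

Lemma tameD f g : tame f -> tame g -> tame (fun x => f x + g x).
Proof.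
move=> [cf [C fC]] [cg [D gD]]; split.
  by move=> x; apply: cvgD; [exact: cf|exact: cg].
exists (C + D) => x; rewrite mulrDl (le_trans (ler_normD _ _))// lerD//.
Qed.

Lemma tameM f g c : tame f -> continuous g -> (forall x, `|g x| <= c) ->
  tame (fun x => f x * g x).
Proof.
move=> [cf [C fC]] cg gc; split.
  by move=> x; apply: cvgM; [exact: cf|exact: cg].
exists (C * c) => x; rewrite normrM mulrAC ler_pM//.
Qed.

Lemma tameZ f c : tame f -> tame (fun x => c * f x).
Proof.
move=> tf; have := @tameM _ (fun=> c) `|c| tf (@cst_continuous _ _ c) (fun=> lexx _).
by under eq_fun do rewrite mulrC.
Qed.

Lemma tameN f : tame f -> tame (fun x => - f x).
Proof. by move=> /(tameZ (-1)); under eq_fun do rewrite mulN1r. Qed.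

Lemma tameB f g : tame f -> tame g -> tame (fun x => f x - g x).
Proof. by move=> tf tg; apply: tameD => //; exact: tameN. Qed.

Lemma tame_norm f : tame f -> tame (fun x => `|f x|).
Proof.
move=> [cf [C fC]]; split; first by move=> x; apply: cvg_norm; exact: cf.
by exists C => x; rewrite normr_id.
Qed.

Lemma tame_exprn (n : nat) : (n <= 4)%N -> tame (fun x => x ^+ n).
Proof.
move=> n4; split; first exact: continuous_exprn.
exists 1 => x; rewrite mul1r normrX.
have -> : x ^+ 4 = `|x| ^+ 4 by rewrite -normrX ger0_norm// exprn4_ge0.
have [x1|x1] := leP `|x| 1.
  by rewrite (@le_trans _ _ 1) ?exprn_ile1// lerDl exprn_ge0.
by rewrite (@le_trans _ _ (`|x| ^+ 4)) ?lerDr// ler_weXn2l// ltW.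
Qed.

Lemma tame_id : tame (fun x => x).
Proof. exact: (@tame_exprn 1). Qed.

(** The fourth power is dominated by a multiple of the ratio of the densities of
N(0, 4) and N(0, 1). *)
Lemma tame_int f : tame f -> (gauss R).-integrable setT (EFin \o f).
Proof.
move=> [cf [C fC]].
have i4 : (gauss R).-integrable setT (EFin \o (fun x => x ^+ 4)).
  apply/integrableP; split.
    by apply/measurable_EFinP; apply: continuous_measurable_fun; exact: continuous_exprn.
  under eq_integral do rewrite /= ger0_norm ?exprn4_ge0//.
  rewrite ge0_integral_normal_prob//; last by exact: exprn4_ge0.
    rewrite (@le_lt_trans _ _ (\int[lebesgue_measure]_x (60%:E * (normal_pdf 0 2 x)%:E))%E)//.
      apply: ge0_le_integral => //.
      - by move=> x _; rewrite lee_fin mulr_ge0 ?exprn4_ge0// normal_pdf_ge0.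
      - apply/measurable_EFinP; apply: measurable_funM; last exact: measurable_normal_pdf.
        by apply: continuous_measurable_fun; exact: continuous_exprn.
      - apply: measurable_funeM; apply/measurable_EFinP; exact: measurable_normal_pdf.
      move=> x _; rewrite -EFinM lee_fin (@gauss_ratioE _ 0 2 x)// mulrA.
      rewrite ler_wpM2r ?normal_pdf_ge0// /gauss_ratio subr0.
      (* The ratio is exp (3 x^2 / 8) / 2, at least (1 + 3 x^2 / 16)^2 / 2. *)
      rewrite (_ : _ - _ = 3 * x ^+ 2 / 8); last by rewrite -mulr_natr; field.
      have e1 := expR_ge1Dx (3 * x ^+ 2 / 16).
      rewrite (_ : 3 * x ^+ 2 / 8 = 3 * x ^+ 2 / 16 + 3 * x ^+ 2 / 16); last by field.
      rewrite expRD; have x20 := sqr_ge0 x.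
      rewrite (_ : x ^+ 4 = (x ^+ 2) ^+ 2); last by ring.
      by nra.
    rewrite integralZl//=; last exact: integrable_normal_pdf.
    by rewrite integral_normal_pdf mule1 ltry.
have i1 : (gauss R).-integrable setT (EFin \o cst 1).
  by apply: (@bounded_integrable _ _ _ _ _ 1) => // x; rewrite normr1.
have iS : (gauss R).-integrable setT (fun x => C%:E * (1 + x ^+ 4)%:E)%E.
  apply: integrableZl => //.
  have := integrableD measurableT i1 i4.
  by apply: eq_integrable => // x _; rewrite /= EFinD.
apply: le_integrable iS => //.
  by apply/measurable_EFinP; exact: continuous_measurable_fun.
by move=> x _ /=; rewrite lee_fin (le_trans (fC x))// ler_norm.
Qed.

Lemma gexp_cst c : gexp (fun=> c) = c.
Proof. exact: Rintegral_cst1. Qed.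

Lemma gexpD f g : tame f -> tame g ->
  gexp (fun x => f x + g x) = gexp f + gexp g.
Proof. by move=> tf tg; apply: RintegralD => //; exact: tame_int. Qed.

Lemma gexpB f g : tame f -> tame g ->
  gexp (fun x => f x - g x) = gexp f - gexp g.
Proof. by move=> tf tg; apply: RintegralB => //; exact: tame_int. Qed.

Lemma gexpZ f c : tame f -> gexp (fun x => c * f x) = c * gexp f.
Proof. by move=> tf; apply: RintegralZl => //; exact: tame_int. Qed.

Lemma gexp_le f g : tame f -> tame g -> (forall x, f x <= g x) ->
  gexp f <= gexp g.
Proof. by move=> tf tg fg; apply: le_Rintegral => //; exact: tame_int. Qed.

Lemma gexp_norm f g : tame f -> tame g -> (forall x, `|f x| <= g x) ->
  `|gexp f| <= gexp g.
Proof.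
move=> tf tg fg; apply: (le_trans (le_normr_Rintegral _ _)) => //.
  exact: tame_int.
by apply: gexp_le => //; exact: tame_norm.
Qed.

Lemma gexp_dist f g h : tame f -> tame g -> tame h ->
  (forall x, `|f x - g x| <= h x) -> `|gexp f - gexp g| <= gexp h.
Proof. by move=> tf tg th fg; rewrite -gexpB//; apply: gexp_norm => //; exact: tameB. Qed.

Lemma continuous_affine m s : continuous (fun x : R => m + s * x).
Proof. by move=> x; apply: cvgD; [exact: cvg_cst|apply: cvgM; [exact: cvg_cst|exact: cvg_id]]. Qed.

Lemma continuous_comp_affine f m s : continuous f ->
  continuous (fun x : R => f (m + s * x)).
Proof.
move=> cf x; exact: (continuous_comp (@continuous_affine m s x) (cf _)).
Qed.

(** Adding the bound [M] to [f] reduces the claim to nonnegative functions. *)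
Lemma gexp_affine f m s M : 0 < s -> continuous f -> (forall x, `|f x| <= M) ->
  tame (gauss_ratio m s) ->
  gexp (fun x => f (m + s * x)) = gexp (fun x => f x * gauss_ratio m s x).
Proof.
move=> s0 cf fM tr.
have key g : continuous g -> (forall x, 0 <= g x) ->
    gexp (fun x => g (m + s * x)) = gexp (fun x => g x * gauss_ratio m s x).
  move=> cg g0; rewrite /gexp /Rintegral; congr fine.
  exact: (etrans (ge0_integral_gauss_affine m s0 cg g0) (ge0_integral_gauss_ratio m s0 cg g0)).
have M0 : 0 <= M := le_trans (normr_ge0 _) (fM 0).
have tfr : tame (fun x => f x * gauss_ratio m s x).
  by have := tameM tr cf fM; under eq_fun do rewrite mulrC.
have := key (fun x => f x + M).
rewrite gexpD; last 2 first.
- by apply: (@tame_bounded _ M); [exact: continuous_comp_affine|move=> x; exact: fM].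
- exact: tame_cst.
under [in RHS]eq_fun do rewrite mulrDl.
rewrite gexpD//; last exact: tameZ.
rewrite -(key (fun=> M)); [| exact: cst_continuous | by []].
move/(_ _ _)/addIr; apply.
- by move=> x; apply: cvgD; [exact: cf|exact: cvg_cst].
- by move=> x; have := fM x; rewrite ler_norml => /andP[]; lra.
Qed.

End tame.

Section moments.
Context (R : realType).
Implicit Types (f g : R -> R) (m s x c r z M : R).

Lemma eqW x s : x = s -> x <= s. Proof. by move=> ->. Qed.

Lemma normal_pdf01N x : normal_pdf 0 1 (- x) = normal_pdf 0 1 x :> R.
Proof. by rewrite !normal_pdfE ?oner_eq0// /normal_fun !subr0 sqrrN. Qed.

Lemma gexpN f M : continuous f -> (forall x, `|f x| <= M) ->
  gexp (fun x => f (- x)) = gexp f.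
Proof.
move=> cf fM.
have cN : continuous (fun x : R => - x) by move=> x; exact: opp_continuous.
have cfN : continuous (fun x => f (- x)).
  by move=> x; exact: (continuous_comp (cN x) (cf _)).
have key g : continuous g -> (forall x, 0 <= g x) ->
    gexp (fun x => g (- x)) = gexp g.
  move=> cg g0; rewrite /gexp /Rintegral; congr fine.
  have cgN : continuous (fun x => g (- x)).
    by move=> x; exact: (continuous_comp (cN x) (cg _)).
  rewrite !ge0_integral_normal_prob//; [|exact: continuous_measurable_fun..].
  pose h x := (g x * normal_pdf 0 1 x)%:E.
  have mh : measurable_fun setT h.
    apply/measurable_EFinP; apply: measurable_funM.
      exact: continuous_measurable_fun.
    exact: measurable_normal_pdf.
  have h0 x : (0 <= h x)%E by rewrite lee_fin mulr_ge0// normal_pdf_ge0.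
  transitivity (\int[lebesgue_measure]_x h (- x)%R)%E.
    by apply: eq_integral => x _; rewrite /h normal_pdf01N.
  transitivity (\int[pushforward lebesgue_measure (-%R : _ -> measurableTypeR R)]_x h x)%E.
    by rewrite ge0_integral_pushforward.
  apply: eq_measure_integral => A mA _; exact: lebesgue_measureN.
have M0 : 0 <= M := le_trans (normr_ge0 _) (fM 0).
have := key (fun x => f x + M).
rewrite !gexpD; last 4 first.
- exact: tame_bounded fM.
- exact: tame_cst.
- by apply: (@tame_bounded _ _ M).
- exact: tame_cst.
move/(_ _ _)/addIr; apply.
- by move=> x; apply: cvgD; [exact: cf|exact: cvg_cst].
- by move=> x; have := fM x; rewrite ler_norml => /andP[]; lra.
Qed.

Local Notation sc r := ((Num.sqrt (1 + r ^+ 2))^-1).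

Lemma sc_gt0 r : 0 < sc r.
Proof. by rewrite invr_gt0 sqrtr_gt0; have := sqr_ge0 r; lra. Qed.

Lemma tame_ratio_shift r : `|r| <= 1 ->
  tame (gauss_ratio (r / (1 + r ^+ 2)) (sc r)).
Proof.
move=> r1; have t1 := tameD (tame_cst 1) (tameZ r (@tame_id R)).
have [_ [C hC]] := tameD (tame_norm t1)
  (tameZ (6 * `|r| ^+ 3) (tameD (tame_cst 1) (@tame_exprn4 R))).
split; first exact: continuous_gauss_ratio.
exists C => z; apply: le_trans (hC z).
rewrite [leRHS]ger0_norm; last first.
  by rewrite addr_ge0// mulr_ge0 ?mulr_ge0 ?exprn_ge0// addr_ge0// exprn4_ge0.
have := gauss_ratio_shift_taylor z r1.
have := ler_normD (gauss_ratio (r / (1 + r ^+ 2)) (sc r) z - (1 + r * z)) (1 + r * z).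
by rewrite subrK; lra.
Qed.

Lemma tame_ratio_scale r : tame (gauss_ratio 0 (sc r)).
Proof.
have [_ [C hC]] := tameD (tame_cst 1)
  (tameZ (r ^+ 2) (tameD (tame_cst 1) (@tame_exprn R 2 isT))).
split; first exact: continuous_gauss_ratio.
exists C => z; apply: le_trans (hC z).
have h0 : 0 <= 1 + r ^+ 2 * (1 + z ^+ 2).
  by rewrite addr_ge0// mulr_ge0 ?sqr_ge0// addr_ge0// sqr_ge0.
rewrite [leRHS]ger0_norm//.
have := gauss_ratio_scale_taylor r z.
have := ler_normD (gauss_ratio 0 (sc r) z - 1) 1.
by rewrite subrK normr1; lra.
Qed.

(** To second order, moving the mean and the variance together along the curve
changes the average linearly in [r]. *)
Lemma gexp_curve f r M : `|r| <= 1 -> continuous f -> (forall x, `|f x| <= M) ->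
  `|gexp (fun z => f (r / (1 + r ^+ 2) + sc r * z)) - (gexp f + r * gexp (fun z => z * f z))|
    <= (M * (6 * gexp (fun z : R => 1 + z ^+ 4))) * `|r| ^+ 3.
Proof.
move=> r1 cf fM; have tr := tame_ratio_shift r1.
rewrite (gexp_affine (sc_gt0 r) cf fM tr).
have tf : tame f by exact: tame_bounded fM.
have tzf : tame (fun z => z * f z) := tameM (@tame_id R) cf fM.
have t4 : tame (fun z : R => 1 + z ^+ 4) := tameD (tame_cst 1) (@tame_exprn4 R).
rewrite -gexpZ// -gexpD//; last exact: tameZ.
rewrite [leRHS]mulrAC mulrCA mulrA -gexpZ//.
apply: gexp_dist => //.
- by have := tameM tr cf fM; under eq_fun do rewrite mulrC.
- by apply: tameD => //; exact: tameZ.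
- exact: tameZ.
move=> z; rewrite (_ : _ - _ = f z * (gauss_ratio (r / (1 + r ^+ 2)) (sc r) z - (1 + r * z))); last by ring.
have := gauss_ratio_shift_taylor z r1.
set a := gauss_ratio _ _ _ - _ => h; rewrite normrM.
apply: (@le_trans _ _ (M * (6 * `|r| ^+ 3 * (1 + z ^+ 4)))); first by rewrite ler_pM.
by apply: eqW; ring.
Qed.

(** If only the variance moves, the change is of second order. *)
Lemma gexp_curve0 f r M : continuous f -> (forall x, `|f x| <= M) ->
  `|gexp (fun z => f (sc r * z)) - gexp f|
    <= (M * gexp (fun z : R => 1 + z ^+ 2)) * r ^+ 2.
Proof.
move=> cf fM; have tr := tame_ratio_scale r.
have -> : (fun z => f (sc r * z)) = (fun z => f (0 + sc r * z)).
  by apply/funext => z; rewrite add0r.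
rewrite (gexp_affine (sc_gt0 r) cf fM tr).
have tf : tame f by exact: tame_bounded fM.
have t2 : tame (fun z : R => 1 + z ^+ 2) := tameD (tame_cst 1) (@tame_exprn R 2 isT).
rewrite [leRHS]mulrAC -gexpZ//.
apply: gexp_dist => //.
- by have := tameM tr cf fM; under eq_fun do rewrite mulrC.
- exact: tameZ.
move=> z; rewrite (_ : _ - _ = f z * (gauss_ratio 0 (sc r) z - 1)); last by ring.
have := gauss_ratio_scale_taylor r z.
set a := gauss_ratio _ _ _ - _ => h; rewrite normrM.
apply: (@le_trans _ _ (M * (r ^+ 2 * (1 + z ^+ 2)))); first by rewrite ler_pM.
by apply: eqW; ring.
Qed.

Lemma small_eq0 (a C : R) : (forall r, 0 < r <= 1 -> `|a| * r <= C * r ^+ 2) -> a = 0.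
Proof.
move=> h; apply/eqP; rewrite -normr_le0; apply/ler_addgt0Pr => e e0; rewrite add0r.
pose r := Num.min 1 (e / (1 + `|C|)).
have C1 : 0 < 1 + `|C| by have := normr_ge0 C; lra.
have r0 : 0 < r by rewrite /r lt_min ltr01 divr_gt0.
have := h r; rewrite r0 ge_min lexx => /(_ isT).
rewrite expr2 mulrA ler_pM2r// => /le_trans; apply.
have : r <= e / (1 + `|C|) by rewrite ge_min lexx orbT.
rewrite ler_pdivlMr// => h2; have := ler_norm C.
by move: (ltW r0) => ? ?; nra.
Qed.

(** [gexp_curve] for the constant function 1: its linear coefficient is this
expectation, while the average does not change. *)
Lemma gexp_odd1 : gexp (fun z : R => z) = 0.
Proof.
apply: (@small_eq0 _ (6 * gexp (fun z : R => 1 + z ^+ 4))) => r /andP[r0 r1].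
have r1' : `|r| <= 1 by rewrite gtr0_norm.
have := gexp_curve r1' (@cst_continuous _ _ (1:R)) (fun _ => eqW (normr1 _)).
rewrite gexp_cst mul1r; under eq_fun do rewrite mulr1.
rewrite opprD addrA subrr add0r normrN normrM gtr0_norm// => /le_trans H.
rewrite mulrC; apply: H.
have K0 : 0 <= gexp (fun z : R => 1 + z ^+ 4).
  by rewrite -(gexp_cst 0); apply: gexp_le => [||x]; [exact: tame_cst|apply: tameD; [exact: tame_cst|exact: tame_exprn4]|have := exprn4_ge0 x; lra].
rewrite ler_wpM2l ?mulr_ge0// exprS ler_piMl// ?sqr_ge0//.
Qed.

(** The total mass of the law with variance [1 / (1 + t)] gives
[E (exp (- t z^2 / 2)) = (1 + t)^(-1/2)]; the claim compares the terms of
order [t]. *)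
Lemma gexp_sqr1 : gexp (fun z : R => z ^+ 2) = 1.
Proof.
have h r : gexp (fun z => expR (- (r ^+ 2 * z ^+ 2 / 2))) = sc r.
  have tr := tame_ratio_scale r.
  have := gexp_affine (sc_gt0 r) (@cst_continuous _ _ (1:R)) (fun _ => eqW (normr1 _)) tr.
  have grE z : 1 * gauss_ratio 0 (sc r) z =
      Num.sqrt (1 + r ^+ 2) * expR (- (r ^+ 2 * z ^+ 2 / 2)).
    rewrite mul1r [X in gauss_ratio X](_ : 0 = 0 * r / (1 + r ^+ 2)); last by rewrite !mul0r.
    by rewrite gauss_ratio_curve expr0n/= !mul0r oppr0 !add0r.
  rewrite gexp_cst; under eq_fun do rewrite grE.
  rewrite gexpZ => [e|].
    have s0 : Num.sqrt (1 + r ^+ 2) != 0 by rewrite -invr_eq0 gt_eqF// sc_gt0.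
    by apply: (mulfI s0); rewrite -e divff.
  apply: (@tame_bounded _ _ 1).
    move=> x; apply: continuous_cvg; first exact: continuous_expR.
    apply: cvgN; apply: cvgM; last exact: cvg_cst.
    by apply: cvgM; [exact: cvg_cst|exact: continuous_exprn].
  move=> x; rewrite ger0_norm ?expR_ge0// -[leRHS]expR0 ler_expR.
  by have := sqr_ge0 r; have := sqr_ge0 x; nra.
have t2 := @tame_exprn R 2 isT.
have t4 := @tame_exprn4 R.
apply/eqP; rewrite -subr_eq0; apply/eqP.
pose K := gexp (fun z : R => z ^+ 4).
apply: (@small_eq0 _ (2 * (K + 1))) => r /andP[r0 r1].
pose t := r.
have e := h (Num.sqrt t); rewrite (sqr_sqrtr (ltW r0)) in e.
have b1 : `|gexp (fun z => expR (- (t * z ^+ 2 / 2))) - gexp (fun z => 1 - t / 2 * z ^+ 2)| <= t ^+ 2 * K.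
  rewrite /K -gexpZ//; apply: gexp_dist.
  - apply: (@tame_bounded _ _ 1).
      move=> x; apply: continuous_cvg; first exact: continuous_expR.
      apply: cvgN; apply: cvgM; last exact: cvg_cst.
      by apply: cvgM; [exact: cvg_cst|exact: continuous_exprn].
    move=> x; rewrite ger0_norm ?expR_ge0// -[leRHS]expR0 ler_expR.
    by have := sqr_ge0 x; rewrite /t; nra.
  - by apply: tameB; [exact: tame_cst|exact: tameZ].
  - exact: tameZ.
  move=> z.
  have -> : t / 2 * z ^+ 2 = t * z ^+ 2 / 2 by ring.
  have -> : t ^+ 2 * z ^+ 4 = (t * z ^+ 2) ^+ 2 by ring.
  have : 0 <= t * z ^+ 2 by rewrite mulr_ge0 ?sqr_ge0// /t ltW.
  move: (t * z ^+ 2) => u u0.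
  have e1 := expR_ge1Dx (- (u / 2)); have e2 := expR_ge1Dx (u / 2).
  have e3 := expRxMexpNx_1 (u / 2); have e0 := expR_gt0 (- (u / 2)).
  rewrite ger0_norm; last by lra.
  have e4 : (1 + u / 2) * expR (- (u / 2)) <= 1 by nra.
  by nra.
rewrite gexpB ?gexpZ ?gexp_cst// in b1; last exact: tameZ; last exact: tame_cst.
rewrite -/t in e; rewrite e in b1.
have s1 : 0 <= Num.sqrt (1 + t) := sqrtr_ge0 _.
have t0 : 0 < t by [].
have s2 : Num.sqrt (1 + t) ^+ 2 = 1 + t by rewrite sqr_sqrtr// addr_ge0// ltW.
have s3 := @sc_gt0 (Num.sqrt t); rewrite (sqr_sqrtr (ltW r0)) in s3.
have s4 : (Num.sqrt (1 + t))^-1 * Num.sqrt (1 + t) = 1.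
  by rewrite mulVf// -invr_eq0 gt_eqF.
have b2 : `|(Num.sqrt (1 + t))^-1 - (1 - t / 2)| <= t ^+ 2.
  move: s3 s4 s1 s2; set a := _^-1; set b := Num.sqrt _ => s3 s4 s1 s2.
  have b1' : 1 <= b by nra.
  have b2' : b <= 1 + t / 2 by nra.
  rewrite ler_norml; apply/andP; split.
    suff : 1 - t / 2 <= a by nra.
    rewrite -(ler_pM2r (_ : 0 < b)); last by lra.
    rewrite s4; have ? : t <= 1 by []. 
    by nra.
  suff : a <= 1 - t / 2 + t ^+ 2 by lra.
  rewrite -(ler_pM2r (_ : 0 < b)); last by lra.
  rewrite s4; have ? : t <= 1 by [].
  have : 1 + t / 2 - t ^+ 2 / 2 <= b.
    have : 0 <= 1 + t / 2 - t ^+ 2 / 2 by nra.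
    have : (1 + t / 2 - t ^+ 2 / 2) ^+ 2 <= b ^+ 2 by rewrite s2; nra.
    by move=> ? ?; nra.
  by nra.
have b3 := ler_distD (Num.sqrt (1 + t))^-1 (1 - t / 2) (1 - t / 2 * gexp (fun z : R => z ^+ 2)).
rewrite (distrC (1 - t / 2) (Num.sqrt (1 + t))^-1) in b3.
have b4 : `|1 - t / 2 - (1 - t / 2 * gexp (fun z : R => z ^+ 2))| = t / 2 * `|gexp (fun z : R => z ^+ 2) - 1|.
  rewrite (_ : _ - _ = t / 2 * (gexp (fun z : R => z ^+ 2) - 1)); last by ring.
  by rewrite normrM gtr0_norm// divr_gt0.
rewrite b4 in b3; move: b1 b2 b3; rewrite -/t; lra.
Qed.

End moments.

(** * The Gaussian distribution function and its inverse *)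

Section Phi.
Context (R : realType).
Implicit Types (a b c p q r s x y : R).
Local Notation mu := (@lebesgue_measure R).

Definition phi x : R := normal_pdf 0 1 x.

Definition Phi x : R := \int[mu]_(t in `]-oo, x]) normal_pdf 0 1 t.

Lemma phiE x : phi x = normal_peak (1 : R) * expR (- (x ^+ 2 / 2)).
Proof. by rewrite /phi normal_pdfE ?oner_eq0// /normal_fun subr0 expr1n mulNr. Qed.

Lemma phi_gt0 x : 0 < phi x.
Proof. by rewrite phiE mulr_gt0 ?expR_gt0// normal_peak_gt0// oner_eq0. Qed.

Lemma phi_le1 x : phi x <= 1.
Proof.
have h := @normal_pdf_ub R 0 1 x (oner_neq0 _).
apply: (le_trans h); rewrite /normal_peak invf_le1.
  rewrite -[leLHS]sqrtr1 ler_sqrt// expr1n mul1r mulr2n.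
    by have := @pi_ge2 R; lra.
  by have := @pi_ge2 R; lra.
by rewrite sqrtr_gt0 expr1n mul1r mulr2n; have := @pi_ge2 R; lra.
Qed.

Lemma has_deriv_phi x : has_deriv phi x (- x * phi x).
Proof.
rewrite (_ : phi = fun x => normal_peak (1 : R) * expR (- (x * x * 2^-1))); last first.
  by apply/funext => y; rewrite phiE expr2.
apply: has_deriv_eq.
  apply: has_derivM; first exact: has_deriv_cst.
  apply: has_deriv_exp; apply: has_derivN; apply: has_derivM; last exact: has_deriv_cst.
  by apply: has_derivM; exact: has_deriv_id.
by rewrite /=; move: (normal_peak _) (expR _) => A B; field.
Qed.

Lemma has_deriv_Phi x : has_deriv Phi x (phi x).
Proof.
have [] := @continuous_FTC1 R (normal_pdf 0 1) -oo%O x (x + 1).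
- by rewrite ltrDl.
- apply: (integrableS _ _ (@subsetT _ _)) => //; exact: integrable_normal_pdf.
- by rewrite ltNyr.
- by apply: continuous_normal_pdf; rewrite oner_eq0.
move=> h1 h2; split; first exact: h1.
by rewrite -derive1E h2.
Qed.

Lemma Phi_mono x y : x < y -> Phi x < Phi y.
Proof.
move=> xy; have [c _] := mvt has_deriv_Phi (ltW xy).
move=> e; rewrite -subr_gt0 e mulr_gt0 ?phi_gt0// subr_gt0//.
Qed.

Lemma Phi_lt x y : (Phi x < Phi y) = (x < y).
Proof.
apply/idP/idP; last exact: Phi_mono.
by rewrite ltNge => h; rewrite ltNge; apply: contra h; rewrite le_eqVlt => /predU1P[->//|/Phi_mono/ltW].
Qed.

Lemma Phi_le x y : (Phi x <= Phi y) = (x <= y).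
Proof. by rewrite leNgt Phi_lt -leNgt. Qed.

Lemma Phi_inj : injective Phi.
Proof. by move=> x y e; apply/eqP; rewrite eq_le -[x <= y]Phi_le -[y <= x]Phi_le e lexx. Qed.

Lemma continuous_Phi : continuous Phi.
Proof. exact: has_deriv_continuous has_deriv_Phi. Qed.

Lemma Phi_cdf x : Phi x = fine (gauss R [set` `]-oo, x]]).
Proof. by []. Qed.

Let idTR : measurableTypeR R -> R := idfun.

#[local] HB.instance Definition _ :=
  @isMeasurableFun.Build _ _ _ _ idTR (@measurable_id _ _ setT).

Lemma cvg_Phi_y : Phi x @[x --> +oo] --> (1 : R).
Proof.
have := @cvg_cdfy1 _ _ R (gauss R) (idTR : {RV (gauss R) >-> R}).
by move=> /fine_cvg.
Qed.

Lemma cvg_Phi_Ny : Phi x @[x --> -oo] --> (0 : R).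
Proof.
have := @cvg_cdfNy0 _ _ R (gauss R) (idTR : {RV (gauss R) >-> R}).
by move=> /fine_cvg.
Qed.

Lemma Phi_large p : p < 1 -> exists2 x, 0 < x & p < Phi x.
Proof.
move=> p1; near (pinfty_nbhs R) => x; exists x; near: x.
  exact: nbhs_pinfty_gt.
exact: (cvgr_gt _ cvg_Phi_y).
Unshelve. all: by end_near. Qed.

Lemma Phi_small p : 0 < p -> exists2 x, x < 0 & Phi x < p.
Proof.
move=> p1; near (ninfty_nbhs R) => x; exists x; near: x.
  exact: nbhs_ninfty_lt.
exact: (cvgr_lt _ cvg_Phi_Ny).
Unshelve. all: by end_near. Qed.

Lemma Phi_gt0 x : 0 < Phi x.
Proof.
have h : 0 <= Phi (x - 1) by rewrite Phi_cdf fine_ge0.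
by apply: (le_lt_trans h); rewrite Phi_lt; lra.
Qed.

Lemma Phi_lt1 x : Phi x < 1.
Proof.
have h : Phi (x + 1) <= 1.
  rewrite leNgt; apply/negP => h.
  have : \forall y \near +oo, Phi y < Phi (x + 1) by exact: (cvgr_lt _ cvg_Phi_y).
  move=> H; near (pinfty_nbhs R) => y.
  have : Phi y < Phi (x + 1) by near: y.
  rewrite Phi_lt ltNge => /negP; apply; near: y; apply: nbhs_pinfty_ge; exact: num_real.
by apply: lt_le_trans h; rewrite Phi_lt; lra.
Unshelve. all: by end_near. Qed.

Lemma Phi_surj p : 0 < p < 1 -> exists x, Phi x = p.
Proof.
move=> /andP[p0 p1]; have [a a0 ap] := Phi_small p0; have [b b0 bp] := Phi_large p1.
have ab : a <= b by lra.
have mM : Num.min (Phi a) (Phi b) <= p <= Num.max (Phi a) (Phi b).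
  by rewrite ge_min le_max (ltW ap) (ltW bp) orbT.
by have [c _ e] := IVT ab (continuous_subspaceT continuous_Phi) mM; exists c.
Qed.

Definition Phinv p : R := xget 0 [set x | Phi x = p].

Lemma PhinvK p : 0 < p < 1 -> Phi (Phinv p) = p.
Proof. by move=> /Phi_surj[x xp]; exact: (xgetI 0 (xp : [set x | Phi x = p] x)). Qed.

Lemma PhiK x : Phinv (Phi x) = x.
Proof. by apply: Phi_inj; rewrite PhinvK// Phi_gt0 Phi_lt1. Qed.

Lemma Phinv_le p q : 0 < p < 1 -> 0 < q < 1 -> (Phinv p <= Phinv q) = (p <= q).
Proof. by move=> hp hq; rewrite -Phi_le !PhinvK. Qed.

Lemma Phinv_leP p x : 0 < p < 1 -> (Phinv p <= x) = (p <= Phi x).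
Proof. by move=> hp; rewrite -Phi_le PhinvK. Qed.

Lemma Phinv_geP p x : 0 < p < 1 -> (x <= Phinv p) = (Phi x <= p).
Proof. by move=> hp; rewrite -Phi_le PhinvK. Qed.

Lemma continuous_Phinv p : 0 < p < 1 -> {for p, continuous Phinv}.
Proof.
move=> hp; have /andP[p0 p1] := hp.
apply/cvgrPdist_le => e e0.
have h1 : Phi (Phinv p - e) < p by rewrite -[X in _ < X](PhinvK hp) Phi_lt; lra.
have h2 : p < Phi (Phinv p + e) by rewrite -[X in X < _](PhinvK hp) Phi_lt; lra.
near=> q.
have hq : 0 < q < 1.
  by apply/andP; split; near: q; [exact: lt_nbhsr|exact: lt_nbhsl].
have q1 : Phi (Phinv p - e) < q by near: q; exact: lt_nbhsr.
have q2 : q < Phi (Phinv p + e) by near: q; exact: lt_nbhsl.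
by rewrite ler_distlC Phinv_geP// Phinv_leP// (ltW q1) (ltW q2).
Unshelve. all: by end_near. Qed.

Lemma PhiN x : Phi (- x) = 1 - Phi x.
Proof.
pose g x := Phi x + Phi (- x).
have dg y : is_derive y (1:R) g 0.
  apply: (@has_deriv_eq _ _ _ (phi y + phi (- y) * -1)).
    apply: has_derivD; first exact: has_deriv_Phi.
    apply: has_deriv_comp; first exact: has_deriv_Phi.
    by apply: has_derivN; exact: has_deriv_id.
  by rewrite /phi normal_pdf01N; ring.
have gc y : g y = g x by exact: is_derive_0_is_cst.
have c1 : g y @[y --> +oo] --> (1 + 0 : R).
  apply: cvgD; first exact: cvg_Phi_y.
  apply: (cvg_comp (fun y : R => - y) Phi); last exact: cvg_Phi_Ny.
  by rewrite ninfty.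
have c2 : g y @[y --> +oo] --> g x.
  by under eq_fun do rewrite gc; exact: cvg_cst.
have e : 1 + 0 = g x := cvg_unique (@Rhausdorff R) c1 c2.
by apply/eqP; rewrite eq_sym subr_eq addrC -/(g x) -e addr0.
Qed.

Lemma Phi_lip x y : `|Phi x - Phi y| <= `|x - y|.
Proof.
wlog xy : x y / x <= y.
  by move=> H; have [/H//|/ltW/H] := leP x y; rewrite distrC (distrC y).
have [c _ e] := mvt has_deriv_Phi xy.
rewrite distrC e (distrC x) normrM ler_piMl// ger0_norm ?phi_le1//.
exact/ltW/phi_gt0.
Qed.

Lemma phi_abs x y : x ^+ 2 <= y ^+ 2 -> phi y <= phi x.
Proof.
move=> h; rewrite !phiE ler_wpM2l ?normal_peak_ge0// ler_expR; lra.
Qed.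

Lemma Phi_add_lt1 a b : a + b < 0 -> Phi a + Phi b < 1.
Proof.
move=> ab; have : Phi b < Phi (- a) by rewrite Phi_lt; lra.
by rewrite PhiN; lra.
Qed.

(** Moving [a] and [b] away from their midpoint [c >= 0] decreases the sum, because
the larger of the two is farther from the mode of [phi]. *)
Lemma Phi_add_le a b c : a + b <= 2 * c -> 0 <= c -> Phi a + Phi b <= 2 * Phi c.
Proof.
move=> abc c0; wlog ac : a b abc / c <= a.
  move=> H; have [/(H _ _ abc)//|ac] := leP c a.
  have [cb|bc] := leP c b; first by rewrite addrC; apply: H => //; lra.
  have : Phi a <= Phi c by rewrite Phi_le ltW.
  have : Phi b <= Phi c by rewrite Phi_le ltW.
  by lra.
have : Phi b <= Phi (c - (a - c)) by rewrite Phi_le; lra.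
suff : Phi a + Phi (c - (a - c)) <= 2 * Phi c by lra.
have -> : Phi a = Phi (c + (a - c)) by congr Phi; lra.
have : 0 <= a - c by lra.
move: (a - c) => s s0 {abc ac}.
pose g t := Phi (c + t) + Phi (c - t).
have dg t : has_deriv g t (phi (c + t) - phi (c - t)).
  apply: has_deriv_eq.
    apply: has_derivD.
      apply: has_deriv_comp; first exact: has_deriv_Phi.
      by apply: has_derivD; [exact: has_deriv_cst|exact: has_deriv_id].
    apply: has_deriv_comp; first exact: has_deriv_Phi.
    by apply: has_derivD; [exact: has_deriv_cst|apply: has_derivN; exact: has_deriv_id].
  by rewrite add0r; ring.
have [t /andP[t0 _] e] := mvt dg s0.
have : phi (c + t) <= phi (c - t) by apply: phi_abs; nra.
move: e; rewrite /g addr0 !subr0 => e h.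
have : (phi (c + t) - phi (c - t)) * s <= 0 by rewrite mulr_le0_ge0//; lra.
by lra.
Qed.

(** The third derivative of [Phi] at [u] is [(u^2 - 1) phi u], bounded by 1. *)
Lemma Phi_taylor a s :
  `|Phi (a + s) - (Phi a + phi a * s - a * phi a / 2 * s ^+ 2)| <= `|s| ^+ 3.
Proof.
pose k1 t := phi (a + t) - phi a + a * phi a * t.
pose k2 t := - (a + t) * phi (a + t) + a * phi a.
have dP t : has_deriv (fun t => Phi (a + t)) t (phi (a + t)).
  apply: has_deriv_eq.
    apply: has_deriv_comp; first exact: has_deriv_Phi.
    by apply: has_derivD; [exact: has_deriv_cst|exact: has_deriv_id].
  by rewrite add0r mulr1.
have dp t : has_deriv (fun t => phi (a + t)) t (- (a + t) * phi (a + t)).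
  apply: has_deriv_eq.
    apply: has_deriv_comp; first exact: has_deriv_phi.
    by apply: has_derivD; [exact: has_deriv_cst|exact: has_deriv_id].
  by rewrite add0r mulr1.
have d2 t : has_deriv k2 t (((a + t) ^+ 2 - 1) * phi (a + t)).
  apply: has_deriv_eq.
    apply: has_derivD; last exact: has_deriv_cst.
    apply: has_derivM; last exact: dp.
    by apply: has_derivN; apply: has_derivD; [exact: has_deriv_cst|exact: has_deriv_id].
  by rewrite /=; ring.
have d1 t : has_deriv k1 t (k2 t).
  apply: has_deriv_eq.
    apply: has_derivD.
      by apply: has_derivD; [exact: dp|exact: has_deriv_cst].
    by apply: has_derivM; [exact: has_deriv_cst|exact: has_deriv_id].
  by rewrite /k2 /=; ring.
have d0 t : has_deriv (fun t => Phi (a + t) - (Phi a + phi a * t - a * phi a / 2 * t ^+ 2)) t (k1 t).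
  apply: has_deriv_eq.
    apply: has_derivD; first exact: dP.
    apply: has_derivN; apply: has_derivD.
      apply: has_derivD; first exact: has_deriv_cst.
      by apply: has_derivM; [exact: has_deriv_cst|exact: has_deriv_id].
    apply: has_derivN; apply: has_derivM; first exact: has_deriv_cst.
    by apply: has_derivM; exact: has_deriv_id.
  by rewrite /k1 /=; field.
have b3 t : `|((a + t) ^+ 2 - 1) * phi (a + t)| <= 1.
  move: (a + t) => u; rewrite normrM (ger0_norm (ltW (phi_gt0 _))) phiE.
  have P1 : normal_peak (1 : R) <= 1.
    by have := phi_le1 0; rewrite phiE expr0n/= mul0r oppr0 expR0 mulr1.
  have P0 : 0 <= normal_peak (1 : R) := normal_peak_ge0 _.
  have v0 : 0 <= u ^+ 2 / 2 by rewrite divr_ge0// sqr_ge0.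
  have -> : u ^+ 2 = 2 * (u ^+ 2 / 2) by field.
  move: (u ^+ 2 / 2) v0 => v v0.
  rewrite (_ : 2 * v / 2 = v); last by field.
  have e1 := expR_ge1Dx v; have e3 := expRxMexpNx_1 v.
  have e0 := expR_gt0 (- v); have e2 := expR_gt0 v.
  have w : `|2 * v - 1| <= expR v.
    rewrite ler_norml; apply/andP; split; first by lra.
    have e4 := expR_ge1Dx (v / 2).
    have -> : expR v = expR (v / 2) ^+ 2.
      by rewrite expr2 -expRD; congr expR; field.
    have := sqr_ge0 (v / 2 - 1); nra.
  have : `|2 * v - 1| * expR (- v) <= 1 by rewrite -[leRHS]e3 ler_wpM2r// ltW.
  have := normr_ge0 (2 * v - 1).
  by rewrite mulrCA => ? ?; nra.
have b2 t : `|k2 t| <= `|t|.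
  rewrite -[leRHS]mul1r; apply: (deriv_bound d2) => [|y _]; last exact: b3.
  by rewrite /k2 addr0; ring.
have b1 t : `|k1 t| <= `|t| ^+ 2.
  rewrite expr2; apply: (deriv_bound d1) => [|y yt].
    by rewrite /k1 addr0; ring.
  exact: le_trans (b2 _) yt.
rewrite [`|s| ^+ 3]exprSr; apply: (deriv_bound d0) => [|y yt].
  by rewrite addr0; ring.
by apply: (le_trans (b1 _)); rewrite lerXn2r ?nnegrE.
Qed.

End Phi.

(** * Expansion of the heat flow along a curve *)

Section heat.
Context (R : realType).
Implicit Types (a b c p q r s x y K d : R) (f : R -> R).

Local Notation sc r := ((Num.sqrt (1 + r ^+ 2))^-1).

Lemma small_eq0_near (a C d : R) : 0 < d ->
  (forall r, 0 < r <= d -> `|a| * r <= C * r ^+ 2) -> a = 0.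
Proof.
move=> d0 h; apply: (@small_eq0 R _ (C * d)) => r /andP[r0 r1].
have rd : 0 < r * d <= d by rewrite mulr_gt0// ler_piMl// ltW.
rewrite -(ler_pM2r d0); apply: le_trans (le_trans (h _ rd) _); apply: eqW; ring.
Qed.

(** Since [Phi'' = - x Phi'], inverting [Phi] turns a curve that is linear to
second order at height [Phi a] into one with quadratic term [a p^2 / 2], where
[p] is its slope.  The value of [Phinv] is enclosed by evaluating [Phi] at the
claimed expansion plus and minus [K |r|^3], so [Phinv] is never
differentiated. *)
Lemma Phinv_expand a A C (Psi : R -> R) : 0 <= C ->
  (forall r, `|r| <= 1 -> 0 < Psi r < 1) ->
  (forall r, `|r| <= 1 -> `|Psi r - (Phi a + r * A)| <= C * `|r| ^+ 3) ->
  exists K d, [/\ 0 <= K, 0 < d <= 1 & forall r, `|r| <= d ->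
    `|Phinv (Psi r) - (a + r * (A / phi a) + a * (A / phi a) ^+ 2 / 2 * r ^+ 2)|
      <= K * `|r| ^+ 3].
Proof.
move=> C0 hP hPsi; set p := A / phi a.
have f0 : 0 < phi a := phi_gt0 a.
have f1 : phi a <= 1 := phi_le1 a.
have Ap : A = phi a * p by rewrite /p mulrC divfK// gt_eqF.
pose Q := `|p| + `|a| * p ^+ 2 / 2 + 1.
have p20 : 0 <= `|a| * p ^+ 2 / 2 by rewrite divr_ge0// mulr_ge0// sqr_ge0.
have Q1 : 1 <= Q by rewrite /Q; have := normr_ge0 p; lra.
(* [Q] bounds the increment divided by [|r|], and [E] collects the errors of
   [Phi_taylor] at that increment. *)
pose E := `|a| * Q ^+ 2 + Q ^+ 3.
have Q0 : 0 <= Q by lra.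
have E0 : 0 <= E by rewrite /E addr_ge0 ?mulr_ge0 ?exprn_ge0.
pose K := (E + C) / phi a.
have K0 : 0 <= K := divr_ge0 (addr_ge0 E0 C0) (ltW f0).
have KE : phi a * K = E + C by rewrite /K mulrC divfK// gt_eqF.
exists K, (1 + K)^-1; split => //.
  by rewrite invr_gt0 invf_le1; lra.
move=> r rd.
have r1 : `|r| <= 1 by apply: (le_trans rd); rewrite invf_le1; lra.
have Kr : K * `|r| <= 1.
  have : (1 + K) * `|r| <= 1 by rewrite -ler_pdivlMl ?mulr1//; lra.
  by have := normr_ge0 r; lra.
have key e : `|e| = 1 ->
    `|Phi (a + (r * p + a * p ^+ 2 / 2 * r ^+ 2 + e * (K * `|r| ^+ 3)))
      - (Phi a + r * A + e * (phi a * K * `|r| ^+ 3))| <= E * `|r| ^+ 3.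
  move=> e1; set s := r * p + _ + _.
  have rr : r ^+ 2 = `|r| * `|r| by rewrite -expr2 real_normK// num_real.
  have n0 := normr_ge0 r.
  have nA : `|a * p ^+ 2 / 2 * r ^+ 2| = `|a| * p ^+ 2 / 2 * `|r| ^+ 2.
    rewrite (_ : a * p ^+ 2 / 2 * r ^+ 2 = a * (p ^+ 2 / 2 * r ^+ 2)); last by ring.
    rewrite normrM [X in _ * X]ger0_norm; last by rewrite mulr_ge0 ?divr_ge0 ?sqr_ge0.
    by rewrite (real_normK (num_real r)); ring.
  have nB : `|e * (K * `|r| ^+ 3)| = K * `|r| ^+ 3.
    by rewrite normrM e1 mul1r ger0_norm// mulr_ge0 ?exprn_ge0.
  have d1 : `|s - r * p| <= `|r| ^+ 2 * Q.
    rewrite (_ : s - r * p = a * p ^+ 2 / 2 * r ^+ 2 + e * (K * `|r| ^+ 3)); last by rewrite /s; ring.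
    rewrite (le_trans (ler_normD _ _))// nA nB.
    rewrite (_ : K * `|r| ^+ 3 = `|r| ^+ 2 * (K * `|r|)); last by ring.
    rewrite [_ * `|r| ^+ 2]mulrC -mulrDr ler_wpM2l ?exprn_ge0// /Q.
    by have := normr_ge0 p; lra.
  have rpn : `|r * p| = `|r| * `|p| by rewrite normrM.
  have d2 : `|s| <= `|r| * Q.
    rewrite (_ : s = r * p + (a * p ^+ 2 / 2 * r ^+ 2 + e * (K * `|r| ^+ 3))); last by rewrite /s; ring.
    rewrite (le_trans (ler_normD _ _))// rpn /Q.
    have : `|a * p ^+ 2 / 2 * r ^+ 2 + e * (K * `|r| ^+ 3)| <= `|r| * (`|a| * p ^+ 2 / 2 + 1).
      rewrite (le_trans (ler_normD _ _))// nA nB.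
      rewrite (_ : K * `|r| ^+ 3 = `|r| * (`|r| * (K * `|r|))); last by ring.
      rewrite (_ : `|a| * p ^+ 2 / 2 * `|r| ^+ 2 = `|r| * (`|r| * (`|a| * p ^+ 2 / 2))); last by ring.
      rewrite -mulrDr ler_wpM2l// lerD//.
        by rewrite ler_piMl.
      by rewrite mulr_ile1// mulr_ge0.
    by lra.
  have d3 : `|s ^+ 2 - (r * p) ^+ 2| <= 2 * Q ^+ 2 * `|r| ^+ 3.
    rewrite (_ : s ^+ 2 - _ = (s - r * p) * (s + r * p)); last by ring.
    rewrite normrM (_ : 2 * Q ^+ 2 * `|r| ^+ 3 = (`|r| ^+ 2 * Q) * (2 * (`|r| * Q))); last by ring.
    rewrite ler_pM// (le_trans (ler_normD _ _))// rpn.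
    have : `|r| * `|p| <= `|r| * Q by rewrite ler_wpM2l// /Q; lra.
    by lra.
  have d4 := Phi_taylor a s.
  have d5 : `|s| ^+ 3 <= Q ^+ 3 * `|r| ^+ 3.
    by rewrite -exprMn [Q * _]mulrC lerXn2r ?nnegrE// mulr_ge0//; lra.
  have d6 : `|a * phi a / 2 * (s ^+ 2 - (r * p) ^+ 2)| <= `|a| * Q ^+ 2 * `|r| ^+ 3.
    rewrite 3!normrM normfV (ger0_norm (ler0n _ 2)) (gtr0_norm f0).
    apply: (@le_trans _ _ (`|a| * 1 / 2 * (2 * Q ^+ 2 * `|r| ^+ 3))).
      apply: ler_pM => //; first by rewrite divr_ge0// mulr_ge0// ltW.
      by rewrite ler_pM2r ?invr_gt0// ler_wpM2l.
    by apply: eqW; field.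
  rewrite Ap (_ : _ - _ = (Phi (a + s) - (Phi a + phi a * s - a * phi a / 2 * s ^+ 2))
     - a * phi a / 2 * (s ^+ 2 - (r * p) ^+ 2)); last by rewrite /s; field.
  rewrite (le_trans (ler_normB _ _))// /E mulrDl; lra.
have h := hPsi r r1; rewrite ler_norml in h; case/andP: h => h1 h2.
have hr := hP r r1.
have k1 := key 1 (normr1 _).
have k2 := key (-1) (etrans (normrN1 _) erefl).
rewrite KE in k1 k2; rewrite !ler_norml in k1 k2.
case/andP: k1 => k1 _; case/andP: k2 => _ k2.
rewrite ler_distl; apply/andP; split.
  rewrite Phinv_geP//; apply: (@le_trans _ _ (Phi a + r * A - C * `|r| ^+ 3)); last by lra.
  by rewrite (_ : _ + _ + _ - _ = a + (r * p + a * p ^+ 2 / 2 * r ^+ 2 + -1 * (K * `|r| ^+ 3))); [lra|ring].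
rewrite Phinv_leP//; apply: (@le_trans _ _ (Phi a + r * A + C * `|r| ^+ 3)); first by lra.
by rewrite (_ : _ + _ + _ + _ = a + (r * p + a * p ^+ 2 / 2 * r ^+ 2 + 1 * (K * `|r| ^+ 3))); [lra|ring].
Qed.

(** Same enclosure as in [Phinv_expand], one order lower. *)
Lemma Phinv_expand0 a C (Psi : R -> R) : 0 <= C ->
  (forall r, 0 < Psi r < 1) ->
  (forall r, `|Psi r - Phi a| <= C * r ^+ 2) ->
  exists K d, [/\ 0 <= K, 0 < d <= 1 & forall r, `|r| <= d ->
    `|Phinv (Psi r) - a| <= K * r ^+ 2].
Proof.
move=> C0 hP hPsi.
have f0 : 0 < phi a := phi_gt0 a.
have f1 : phi a <= 1 := phi_le1 a.
pose K := 2 * C / phi a.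
have K0 : 0 <= K := divr_ge0 (mulr_ge0 (ler0n _ 2) C0) (ltW f0).
have KE : phi a * K = 2 * C by rewrite /K mulrC divfK// gt_eqF.
pose N := 2 * K * (`|a| + 1) / phi a + K + 1.
have B0 : 0 <= 2 * K * (`|a| + 1) / phi a.
  apply: divr_ge0; last exact: ltW.
  apply: mulr_ge0; first exact: mulr_ge0.
  by have := normr_ge0 a; lra.
have N1 : 1 <= N.
  by rewrite /N; lra.
exists K, N^-1; split => //.
  by rewrite invr_gt0 invf_le1; lra.
move=> r rd; have n0 := normr_ge0 r.
have r1 : `|r| <= 1 by apply: (le_trans rd); rewrite invf_le1; lra.
have Nr : N * `|r| <= 1 by rewrite -ler_pdivlMl ?mulr1//; lra.
have rr : r ^+ 2 = `|r| * `|r| by rewrite -expr2 real_normK// num_real.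
have Nr2 : N * r ^+ 2 <= 1 by rewrite rr mulrA mulr_ile1// mulr_ge0//; lra.
have r20 : 0 <= r ^+ 2 := sqr_ge0 r.
have Kr2 : K * r ^+ 2 <= 1.
  apply: (le_trans _ Nr2); rewrite ler_wpM2r// /N.
  by lra.
have b : K * r ^+ 2 * (`|a| + 1) <= phi a / 2.
  have h : 2 * K * (`|a| + 1) / phi a * r ^+ 2 <= 1.
    apply: (le_trans _ Nr2); rewrite ler_wpM2r// /N; lra.
  have h2 : phi a * (2 * K * (`|a| + 1) / phi a * r ^+ 2) <= phi a * 1 by rewrite ler_wpM2l// ltW.
  rewrite [X in X <= _](_ : _ = 2 * (K * r ^+ 2 * (`|a| + 1))) in h2; last by field; rewrite gt_eqF.
  by lra.
have key e : `|e| = 1 -> `|Phi (a + e * (K * r ^+ 2)) - (Phi a + e * (2 * C * r ^+ 2))| <= C * r ^+ 2.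
  move=> e1; have := Phi_taylor a (e * (K * r ^+ 2)).
  rewrite -KE; set s := e * (K * r ^+ 2).
  have sn : `|s| = K * r ^+ 2 by rewrite normrM e1 mul1r ger0_norm// mulr_ge0.
  have s2 : s ^+ 2 = `|s| ^+ 2 by rewrite real_normK// num_real.
  move=> h; rewrite (_ : _ - _ = (Phi (a + s) - (Phi a + phi a * s - a * phi a / 2 * s ^+ 2)) - a * phi a / 2 * s ^+ 2); last by rewrite /s; ring.
  rewrite (le_trans (ler_normB _ _))//.
  have h2 : `|a * phi a / 2 * s ^+ 2| <= `|a| * `|s| ^+ 2.
    rewrite 3!normrM normfV (ger0_norm (ler0n _ 2)) (gtr0_norm f0) normrX ler_wpM2r ?exprn_ge0//.
    rewrite -mulrA ler_piMr//; lra.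
  have h3 : `|s| ^+ 3 <= `|s| ^+ 2 by rewrite exprS ler_piMl ?exprn_ge0// sn.
  have h4 : `|s| ^+ 2 * (`|a| + 1) <= C * r ^+ 2.
    rewrite expr2 -mulrA sn.
    apply: (le_trans (ler_wpM2l (mulr_ge0 K0 r20) b)).
    have -> : K * r ^+ 2 * (phi a / 2) = phi a * K * r ^+ 2 / 2 by field.
    by rewrite KE; apply: eqW; field.
  by move: h h2 h3 h4; rewrite mulrDr; lra.
have h := hPsi r; rewrite ler_norml in h; case/andP: h => h1 h2.
have hr := hP r.
have k1 := key 1 (normr1 _).
have k2 := key (-1) (etrans (normrN1 _) erefl).
rewrite !ler_norml in k1 k2.
case/andP: k1 => k1 _; case/andP: k2 => _ k2.
rewrite ler_distl; apply/andP; split.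
  by rewrite Phinv_geP// (_ : a - _ = a + -1 * (K * r ^+ 2)); [lra|ring].
by rewrite Phinv_leP// (_ : a + _ = a + 1 * (K * r ^+ 2)); [lra|ring].
Qed.

(** The solution at time [s^2] of the heat equation with half the Laplacian,
started at [f]. *)
Definition heat f s x := gexp (fun z => f (x + s * z)).

Definition heatinv f s x := Phinv (heat f s x).

End heat.

(** * The maximum principle *)

Section maxprinciple.
Context (R : realType).
Implicit Types (a b c p q r s x y K d : R) (f h : R -> R).

Local Notation sc r := ((Num.sqrt (1 + r ^+ 2))^-1).

(** By continuity [f] exceeds half its value at [x0] on an interval, and an interval
has positive mass because [Phi] increases strictly. *)
Lemma gexp_gt0 f x0 : tame f -> (forall x, 0 <= f x) -> 0 < f x0 -> 0 < gexp f.
Proof.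
move=> tf f0 fx0; have [cf _] := tf.
have : \forall y \near x0, f x0 / 2 < f y by apply: (cvgr_gt _ (cf x0)); lra.
move=> /nbhs_ballP[e /= e0 he].
pose A : set R := [set` `]x0 - e / 2, x0 + e / 2]].
have mA : measurable (A : set (measurableTypeR R)) by exact: measurable_itv.
have gA : 0 < fine (gauss R A).
  rewrite lt_neqAle fine_ge0// andbT; apply/eqP => gA0.
  have gA : gauss R A = 0%E by rewrite -(fineK (fin_num_measure (gauss R) _ mA)) -gA0.
  have : Phi (x0 + e / 2) <= Phi (x0 - e / 2).
    rewrite !Phi_cdf fine_le ?fin_num_measure//.
    rewrite -[leRHS]adde0 -gA; apply: le_trans (measureU2 _ _ _) => //.
    rewrite le_measure ?inE//; first exact: measurableU.
    move=> z; rewrite /A /= !in_itv/= => zb.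
    have [zx|zx] := leP z (x0 - e / 2); [by left|right].
    by apply/andP; split.
  by rewrite Phi_le; lra.
pose g y := f x0 / 2 * \1_A y.
have ig : (gauss R).-integrable setT (EFin \o g).
  apply: (@bounded_integrable _ _ _ _ _ (f x0 / 2)).
    by apply: measurable_funM => //; exact: measurable_indic.
  move=> y; rewrite /g indicE; case: (_ \in _); rewrite ?mulr1 ?mulr0 ?normr0.
    by rewrite ger0_norm//; lra.
  by lra.
have : \int[gauss R]_y g y <= gexp f.
  apply: le_Rintegral => //; first exact: tame_int.
  move=> y _; rewrite /g indicE; have [/set_mem yA|] := boolP (y \in A); last by rewrite mulr0.
  rewrite mulr1 ltW//; apply: he; rewrite /ball /=.
  by move: yA; rewrite /A /= in_itv/= ltr_distlC => /andP[]; lra.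
apply: lt_le_trans; rewrite /g RintegralZl//; last first.
  apply: (@bounded_integrable _ _ _ _ _ 1); first exact: measurable_indic.
  by move=> y; rewrite indicE; case: (_ \in _); rewrite ?normr1 ?normr0.
rewrite mulr_gt0//; first by lra.
by rewrite /Rintegral integral_indic// setIT.
Qed.

Definition unitf f := continuous f /\ forall x, 0 < f x < 1.

Lemma unitf_affine f x s : unitf f -> unitf (fun z => f (x + s * z)).
Proof. by move=> [cf f01]; split => //; exact: continuous_comp_affine. Qed.

Lemma unitf_norm f x : unitf f -> `|f x| <= 1.
Proof.
move=> [_ f01]; have /andP[h1 h2] := f01 x.
by rewrite ger0_norm ltW.
Qed.

Lemma unitf_tame f : unitf f -> tame f.
Proof. by move=> uf; have [cf _] := uf; apply: (@tame_bounded _ _ 1) => // x; exact: unitf_norm. Qed.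

Lemma unitf_gexp f : unitf f -> 0 < gexp f < 1.
Proof.
move=> uf; have [_ f01] := uf; apply/andP; split.
  apply: (@gexp_gt0 _ 0); first exact: unitf_tame.
    by move=> x; have /andP[/ltW] := f01 x.
  by have /andP[] := f01 0.
rewrite -subr_gt0 -[X in X - _](gexp_cst (1 : R)) -gexpB; [|exact: tame_cst|exact: unitf_tame].
apply: (@gexp_gt0 _ 0).
- by apply: tameB; [exact: tame_cst|exact: unitf_tame].
- by move=> x; rewrite subr_ge0; have /andP[_ /ltW] := f01 x.
- by rewrite subr_gt0; have /andP[] := f01 0.
Qed.

Lemma heat01 f s x : unitf f -> 0 < heat f s x < 1.
Proof. by move=> uf; apply: unitf_gexp; exact: unitf_affine. Qed.

Lemma Phi_heatinv f s x : unitf f -> Phi (heatinv f s x) = heat f s x.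
Proof. by move=> uf; rewrite PhinvK// heat01. Qed.

(** [gexp_curve] and [gexp_curve0] transported through [Phinv].  Both bounds share
their constants so that they can be combined near a minimum. *)
Lemma heat_curve f s x : unitf f -> exists p K d,
  [/\ 0 <= K, 0 < d <= 1 & forall r, `|r| <= d ->
    `|heatinv f (s * sc r) (x + s * (r / (1 + r ^+ 2)))
       - (heatinv f s x + r * p + heatinv f s x * p ^+ 2 / 2 * r ^+ 2)| <= K * `|r| ^+ 3
    /\ `|heatinv f (s * sc r) x - heatinv f s x| <= K * r ^+ 2].
Proof.
move=> uf; have ug := unitf_affine x s uf; have [cg _] := ug.
set a := heatinv f s x.
have aE : Phi a = gexp (fun z => f (x + s * z)) by rewrite Phi_heatinv.
pose A := gexp (fun z => z * f (x + s * z)).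
have K40 : 0 <= gexp (fun z : R => 1 + z ^+ 4).
  rewrite -(gexp_cst 0); apply: gexp_le; first exact: tame_cst.
    by apply: tameD; [exact: tame_cst|exact: tame_exprn4].
  by move=> z; have := exprn4_ge0 z; lra.
have K20 : 0 <= gexp (fun z : R => 1 + z ^+ 2).
  rewrite -(gexp_cst 0); apply: gexp_le; first exact: tame_cst.
    by apply: tameD; [exact: tame_cst|exact: (@tame_exprn R 2)].
  by move=> z; have := sqr_ge0 z; lra.
have [|||K1 [d1 [K10 /andP[d10 d11] h1]]] := @Phinv_expand R a A
   (1 * (6 * gexp (fun z : R => 1 + z ^+ 4)))
   (fun r => heat f (s * sc r) (x + s * (r / (1 + r ^+ 2)))).
- by rewrite mul1r mulr_ge0.
- by move=> r _; exact: heat01.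
- move=> r r1; have := gexp_curve r1 cg (fun z => unitf_norm z ug).
  rewrite -aE -/A /heat; congr (`| _ - _ | <= _).
  by congr gexp; apply/funext => z; congr f; ring.
have [|||K2 [d2 [K20' /andP[d20 d21] h2]]] := @Phinv_expand0 R a
   (1 * gexp (fun z : R => 1 + z ^+ 2)) (fun r => heat f (s * sc r) x).
- by rewrite mul1r.
- by move=> r; exact: heat01.
- move=> r; have := @gexp_curve0 R _ r 1 cg (fun z => unitf_norm z ug).
  rewrite -aE /heat; congr (`| _ - _ | <= _).
  by congr gexp; apply/funext => z; congr f; ring.
exists (A / phi a), (K1 + K2), (Num.min d1 d2); split.
- exact: addr_ge0.
- by rewrite lt_min d10 d20 ge_min d11.
move=> r; rewrite le_min => /andP[rd1 rd2]; split.
  apply: (le_trans (h1 _ rd1)); rewrite ler_wpM2r ?exprn_ge0//; lra.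
apply: (le_trans (h2 _ rd2)); rewrite ler_wpM2r ?sqr_ge0//; lra.
Qed.

(** Nonnegativity at time 1 and at the origin is Ehrhard's inequality. *)
Definition gap f0 f1 h s x0 x1 :=
  heatinv h s ((x0 + x1) / 2) - (heatinv f0 s x0 + heatinv f1 s x1) / 2.

(** Suppose the gap is negative at a penalized minimum.  Moving [x0] and [x1] in
opposite directions keeps the midpoint, and the first-order terms force the
slopes [p0] and [p1] to agree; moving them in the same direction forces the
slope [p] at the midpoint to be their average, hence equal to both.  The terms
of order [r^2] are then the gap times [p^2 / 2], which is at most zero, while
the penalty has decreased by about [e s^2 r^2]. *)
Lemma gap_min_ge0 f0 f1 h s x0 x1 e : unitf f0 -> unitf f1 -> unitf h ->
  0 < s -> 0 < e ->
  (forall s' y0 y1, 0 <= s' <= s ->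
    gap f0 f1 h s x0 x1 + e * s ^+ 2 <= gap f0 f1 h s' y0 y1 + e * s' ^+ 2) ->
  0 <= gap f0 f1 h s x0 x1.
Proof.
move=> u0 u1 uh s0 e0 hmin; rewrite leNgt; apply/negP => D0.
have [p [K [d [K0 /andP[d0 d1] H]]]] := heat_curve s ((x0 + x1) / 2) uh.
have [p0 [K' [d' [K0' /andP[d0' d1'] H0]]]] := heat_curve s x0 u0.
have [p1 [K'' [d'' [K0'' /andP[d0'' d1''] H1]]]] := heat_curve s x1 u1.
have sc01 r : 0 < sc r <= 1.
  rewrite sc_gt0/= invf_le1 ?sqrtr_gt0; last by have := sqr_ge0 r; lra.
  by rewrite -[leLHS]sqrtr1 ler_sqrt; have := sqr_ge0 r; lra.
have ssc r : 0 <= s * sc r <= s.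
  have /andP[h1 h2] := sc01 r.
  apply/andP; split; first by apply: mulr_ge0; exact: ltW.
  by rewrite -[leRHS]mulr1 ler_wpM2l// ltW.
pose dd := Num.min d (Num.min d' d'').
have dd0 : 0 < dd by rewrite !lt_min d0 d0' d0''.
have dd1 : dd <= 1 by rewrite ge_min d1.
have e2 r : e * (s * sc r) ^+ 2 = e * s ^+ 2 / (1 + r ^+ 2).
  rewrite exprMn exprVn sqr_sqrtr ?mulrA//; have := sqr_ge0 r; lra.
have e2le r : e * s ^+ 2 / (1 + r ^+ 2) <= e * s ^+ 2.
  rewrite ler_pdivrMr; last by have := sqr_ge0 r; lra.
  rewrite mulrDr mulr1 lerDl; apply: mulr_ge0 (sqr_ge0 _).
  exact: mulr_ge0 (ltW e0) (sqr_ge0 _).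
set v := heatinv h s ((x0 + x1) / 2) in H.
set v0 := heatinv f0 s x0 in H0.
set v1 := heatinv f1 s x1 in H1.
have DE : gap f0 f1 h s x0 x1 = v - (v0 + v1) / 2 by [].
pose m r := s * (r / (1 + r ^+ 2)).
have mN r : m (- r) = - m r by rewrite /m sqrrN mulNr mulrN.
have scN r : sc (- r) = sc r by rewrite sqrrN.
pose C0 := `|v0 * p0 ^+ 2 / 2| + `|v1 * p1 ^+ 2 / 2| + K + K' + K''.
have abs3 r : `|r| <= dd -> `|r| ^+ 3 <= r ^+ 2.
  move=> rd; rewrite -[r ^+ 2]real_normK ?num_real// exprS ler_piMl ?exprn_ge0//.
  exact: le_trans dd1.
(* Opposite displacements leave the midpoint fixed, and its value changes only
   at second order. *)
have eqp : p0 - p1 = 0.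
  have key r : `|r| <= dd -> r * (p0 - p1) / 2 <= C0 * r ^+ 2.
    move=> rd; have r3 := abs3 r rd; move: (rd); rewrite !le_min => /andP[r1 /andP[r2 r2']].
    have := hmin _ (x0 + m r) (x1 + m (- r)) (ssc r).
    rewrite DE /gap mN (_ : (x0 + m r + (x1 - m r)) / 2 = (x0 + x1) / 2); last by rewrite addrACA subrr addr0.
    rewrite -mN e2 => hh.
    have [_] := H r r1; rewrite ler_norml => /andP[_ b].
    have [b0 _] := H0 r r2; rewrite ler_norml in b0; case/andP: b0 => b0 _.
    have rn : `|- r| <= d'' by rewrite normrN.
    have [b1 _] := H1 (- r) rn; rewrite ler_norml scN normrN sqrrN in b1; case/andP: b1 => b1 _.
    rewrite -/(m r) in b0; rewrite -[r ^+ 2]sqrrN -/(m (- r)) in b1.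
    have le2 := e2le r.
    have k' := ler_wpM2l K0' r3; have k'' := ler_wpM2l K0'' r3.
    have r20 := sqr_ge0 r.
    have n0 := ler_wpM2r r20 (ler_norm (- (v0 * p0 ^+ 2 / 2))).
    have n1 := ler_wpM2r r20 (ler_norm (- (v1 * p1 ^+ 2 / 2))).
    rewrite !normrN sqrrN in n0 n1 b1.
    have g0 := mulr_ge0 (normr_ge0 (v0 * p0 ^+ 2 / 2)) r20.
    have g1 := mulr_ge0 (normr_ge0 (v1 * p1 ^+ 2 / 2)) r20.
    have g2 := mulr_ge0 K0' r20; have g3 := mulr_ge0 K0'' r20; have g4 := mulr_ge0 K0 r20.
    rewrite /C0 !mulrDl; lra.
  apply: (@small_eq0_near R _ (2 * C0) dd dd0) => r /andP[r0 rd].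
  have rr : `|r| <= dd by rewrite gtr0_norm.
  have rr' : `|- r| <= dd by rewrite normrN.
  have k1 := key r rr; have k2 := key (- r) rr'; rewrite sqrrN in k2.
  by case: (ger0P (p0 - p1)) => h0; lra.
pose C1 := `|v * p ^+ 2 / 2| + `|v0 * p0 ^+ 2 / 2| + `|v1 * p1 ^+ 2 / 2| + K + K' + K''.
(* Equal displacements move the midpoint along with the end points. *)
have keyA r : `|r| <= dd -> e * s ^+ 2 - e * s ^+ 2 / (1 + r ^+ 2) <=
     r * (p - (p0 + p1) / 2) + (v * p ^+ 2 / 2 - (v0 * p0 ^+ 2 / 2 + v1 * p1 ^+ 2 / 2) / 2) * r ^+ 2
     + (K + K' + K'') * `|r| ^+ 3.
  move=> rd; move: (rd); rewrite !le_min => /andP[r1 /andP[r2 r2']].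
  have := hmin _ (x0 + m r) (x1 + m r) (ssc r).
  rewrite DE /gap (_ : (x0 + m r + (x1 + m r)) / 2 = (x0 + x1) / 2 + m r); last by field.
  rewrite e2 => hh.
  have [b _] := H r r1; rewrite ler_norml in b; case/andP: b => _ b.
  have [b0 _] := H0 r r2; rewrite ler_norml in b0; case/andP: b0 => b0 _.
  have [b1 _] := H1 r r2'; rewrite ler_norml in b1; case/andP: b1 => b1 _.
  rewrite -/(m r) in b b0 b1.
  have r30 : 0 <= `|r| ^+ 3 by rewrite exprn_ge0.
  have g2 := mulr_ge0 K0' r30; have g3 := mulr_ge0 K0'' r30.
  by rewrite !mulrDl; lra.
have eqp' : p - (p0 + p1) / 2 = 0.
  have key r : `|r| <= dd -> - r * (p - (p0 + p1) / 2) <= C1 * r ^+ 2.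
    move=> rd; have r3 := abs3 r rd; have kA := keyA r rd; have le2 := e2le r.
    have KK : 0 <= K + K' + K'' by rewrite !addr_ge0.
    have k := ler_wpM2l KK r3.
    have r20 := sqr_ge0 r.
    have n := ler_wpM2r r20 (ler_norm (v * p ^+ 2 / 2)).
    have n0 := ler_wpM2r r20 (ler_norm (- (v0 * p0 ^+ 2 / 2))).
    have n1 := ler_wpM2r r20 (ler_norm (- (v1 * p1 ^+ 2 / 2))).
    rewrite !normrN in n0 n1.
    have g0 := mulr_ge0 (normr_ge0 (v0 * p0 ^+ 2 / 2)) r20.
    have g1 := mulr_ge0 (normr_ge0 (v1 * p1 ^+ 2 / 2)) r20.
    by rewrite /C1 !mulrDl in k kA *; lra.
  apply: (@small_eq0_near R _ C1 dd dd0) => r /andP[r0 rd].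
  have rr : `|r| <= dd by rewrite gtr0_norm.
  have rr' : `|- r| <= dd by rewrite normrN.
  have k1 := key r rr; have k2 := key (- r) rr'; rewrite sqrrN in k2.
  by case: (ger0P (p - (p0 + p1) / 2)) => h0; lra.
have pe0 : p0 = p by lra.
have pe1 : p1 = p by lra.
have : e * s ^+ 2 = 0.
  apply: (@small_eq0_near R _ (2 * (K + K' + K'')) dd dd0) => r /andP[r0 rd].
  have rr : `|r| <= dd by rewrite gtr0_norm.
  have := keyA r rr; rewrite eqp' pe0 pe1 mulr0 add0r gtr0_norm//.
  rewrite (_ : v * _ / 2 - _ = (v - (v0 + v1) / 2) * (p ^+ 2 / 2)); last by field.
  rewrite -DE => kA.
  have neg : gap f0 f1 h s x0 x1 * (p ^+ 2 / 2) * r ^+ 2 <= 0.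
    by rewrite mulr_le0_ge0 ?sqr_ge0// mulr_le0_ge0 ?(ltW D0)// divr_ge0// sqr_ge0.
  have r21 : r ^+ 2 <= 1 by rewrite expr2 mulr_ile1 ?(ltW r0)//; lra.
  have es0 : 0 <= e * s ^+ 2 := mulr_ge0 (ltW e0) (sqr_ge0 _).
  have kB : e * s ^+ 2 - e * s ^+ 2 / (1 + r ^+ 2) <= (K + K' + K'') * r ^+ 3 by lra.
  have r2p : 0 < r ^+ 2 by rewrite exprn_gt0.
  have kC : e * s ^+ 2 * (r ^+ 2 / 2) <= e * s ^+ 2 - e * s ^+ 2 / (1 + r ^+ 2).
    rewrite (_ : _ - _ = e * s ^+ 2 * (r ^+ 2 / (1 + r ^+ 2))); last by field; rewrite gt_eqF//; lra.
    rewrite ler_wpM2l// ler_pM2l// lef_pV2 ?posrE//; lra.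
  rewrite ger0_norm// -(ler_pM2r r0).
  have -> : e * s ^+ 2 * r * r = 2 * (e * s ^+ 2 * (r ^+ 2 / 2)) by field.
  have -> : 2 * (K + K' + K'') * r ^+ 2 * r = 2 * ((K + K' + K'') * r ^+ 3) by ring.
  by lra.
by move/eqP; rewrite mulf_eq0 sqrf_eq0 !gt_eqF.
Qed.

End maxprinciple.

(** * Ehrhard's inequality in dimension one *)

Section core.
Context (R : realType).
Implicit Types (a b c p q r s x y K L d e : R) (f h : R -> R).

Definition lip (L : R) f := forall x y, `|f x - f y| <= L * `|x - y|.

Lemma lip_continuous_normed (V : normedModType R) (G : V -> R) K :
  (forall u v, `|G u - G v| <= K * `|u - v|) -> continuous G.
Proof.
move=> GK u; apply/cvgrPdist_le => e e0; near=> v.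
apply: (le_trans (GK _ _)).
have K1 : 0 < `|K| + 1 by have := normr_ge0 K; lra.
have : `|u - v| <= e / (`|K| + 1).
  by near: v; apply: cvgr_dist_le; [exact: cvg_id|rewrite divr_gt0].
rewrite ler_pdivlMr// => h; have := ler_norm K; have := normr_ge0 (u - v); nra.
Unshelve. all: by end_near. Qed.

Lemma lip_continuous L f : lip L f -> continuous f.
Proof. exact: (@lip_continuous_normed R^o). Qed.

Lemma lip_ge0 L f : lip L f -> 0 <= L.
Proof. by move=> /(_ 1 0); rewrite subr0 normr1 mulr1; apply: le_trans. Qed.

Lemma tame_abs : tame (fun z : R => `|z|).
Proof. by apply: tame_norm; exact: tame_id. Qed.

Definition gabs : R := gexp (fun z : R => `|z|).

Lemma gabs_ge0 : 0 <= gabs.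
Proof. by rewrite /gabs -(gexp_cst 0); apply: gexp_le => //; [exact: tame_cst|exact: tame_abs]. Qed.

Lemma heat_lip L f s s' x x' : unitf f -> lip L f ->
  `|heat f s x - heat f s' x'| <= L * (`|x - x'| + `|s - s'| * gabs).
Proof.
move=> uf lf; have L0 := lip_ge0 lf.
have -> : L * (`|x - x'| + `|s - s'| * gabs) =
    gexp (fun z => L * (`|x - x'| + `|s - s'| * `|z|)).
  rewrite gexpZ; last by apply: tameD; [exact: tame_cst|apply: tameZ; exact: tame_abs].
  rewrite gexpD ?gexp_cst ?gexpZ//; [exact: tame_abs|exact: tame_cst|apply: tameZ; exact: tame_abs].
apply: gexp_dist; [exact/unitf_tame/unitf_affine|exact/unitf_tame/unitf_affine| |].
  by apply: tameZ; apply: tameD; [exact: tame_cst|apply: tameZ; exact: tame_abs].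
move=> z; apply: (le_trans (lf _ _)); rewrite ler_wpM2l//.
rewrite (_ : _ - _ = (x - x') + (s - s') * z); last by ring.
by rewrite (le_trans (ler_normD _ _))// normrM.
Qed.

(** [1 + e x^2 <= 2 (1 + z^2) (1 + e (x + s z)^2)], and [E (1 + z^2) = 2]. *)
Lemma heat_decay K e f s x : unitf f -> 0 <= K -> 0 < e <= 1 -> 0 <= s <= 1 ->
  (forall y, f y <= K / (1 + e * y ^+ 2)) ->
  heat f s x <= 4 * K / (1 + e * x ^+ 2).
Proof.
move=> uf K0 /andP[e0 e1] /andP[s0 s1] fK.
have den y : 0 < 1 + e * y ^+ 2.
  by have := mulr_ge0 (ltW e0) (sqr_ge0 y); lra.
apply: (@le_trans _ _ (gexp (fun z => 2 * K / (1 + e * x ^+ 2) * (1 + z ^+ 2)))).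
  apply: gexp_le.
  - exact/unitf_tame/unitf_affine.
  - by apply: tameZ; apply: tameD; [exact: tame_cst|exact: (@tame_exprn R 2)].
  move=> z; apply: (le_trans (fK _)).
  rewrite ler_pdivrMr//.
  have -> : 2 * K / (1 + e * x ^+ 2) * (1 + z ^+ 2) * (1 + e * (x + s * z) ^+ 2) =
      K * (2 * ((1 + z ^+ 2) * (1 + e * (x + s * z) ^+ 2))) / (1 + e * x ^+ 2) by ring.
  rewrite ler_pdivlMr// ler_wpM2l//.
  have z0 := sqr_ge0 z; have y0 := sqr_ge0 (x + s * z); have x0 := sqr_ge0 x.
  have h1 : x ^+ 2 <= 2 * (x + s * z) ^+ 2 + 2 * z ^+ 2.
    have : (s * z) ^+ 2 <= z ^+ 2.
      by rewrite exprMn ler_piMl// expr2 mulr_ile1.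
    have := sqr_ge0 (x + 2 * (s * z)); lra.
  have h2 := mulr_ge0 (ltW e0) y0; have h3 := mulr_ge0 z0 h2.
  have h4 := ler_wpM2l (ltW e0) h1.
  have h5 : e * z ^+ 2 <= z ^+ 2 by rewrite ler_piMl.
  by lra.
rewrite gexpZ; last by apply: tameD; [exact: tame_cst|exact: (@tame_exprn R 2)].
rewrite gexpD; [|exact: tame_cst|exact: (@tame_exprn R 2)].
rewrite gexp_cst gexp_sqr1 le_eqVlt; apply/orP; left; apply/eqP.
by field; rewrite gt_eqF.
Qed.

Lemma heat0 f x : heat f 0 x = f x.
Proof.
rewrite /heat (_ : (fun z => f (x + 0 * z)) = fun=> f x) ?gexp_cst//.
by apply/funext => z; rewrite mul0r addr0.
Qed.

Lemma heat10 f : heat f 1 0 = gexp f.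
Proof. by rewrite /heat; congr gexp; apply/funext => z; rewrite add0r mul1r. Qed.

Lemma gexp_ge f c : unitf f -> (forall x, c <= f x) -> c <= gexp f.
Proof. by move=> uf fc; rewrite -[leLHS](gexp_cst c); apply: gexp_le => //; [exact: tame_cst|exact: unitf_tame]. Qed.

Lemma gexp_ub f c : unitf f -> (forall x, f x <= c) -> gexp f <= c.
Proof. by move=> uf fc; rewrite -[leRHS](gexp_cst c); apply: gexp_le => //; [exact: unitf_tame|exact: tame_cst]. Qed.

Lemma heatinv_continuous (V : normedModType R) L f (u v : V -> R) : unitf f -> lip L f ->
  (forall w w' : V, `|u w - u w'| <= `|w - w'|) ->
  (forall w w' : V, `|v w - v w'| <= `|w - w'|) ->
  continuous (fun w => heatinv f (u w) (v w)).
Proof.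
move=> uf lf hu hv w.
have L0 := lip_ge0 lf.
have cG : continuous (fun w => heat f (u w) (v w)).
  apply: (@lip_continuous_normed _ _ (L * (1 + gabs))) => a b.
  apply: (le_trans (heat_lip _ _ _ _ uf lf)).
  rewrite -mulrA ler_wpM2l// mulrDl mul1r lerD// [leRHS]mulrC.
  by rewrite ler_wpM2r// gabs_ge0.
exact: (continuous_comp (cG w) (continuous_Phinv (heat01 _ _ uf))).
Qed.

(** The decay of [f0] and [f1], with the lower bound [d] on [h], makes the gap
nonnegative when [x0] or [x1] is large, so that the penalized gap has a minimum
on a compact box; at time 0 the gap is nonnegative by hypothesis. *)
Lemma functional_ehrhard_decay L K e c d f0 f1 h :
  unitf f0 -> unitf f1 -> unitf h -> lip L f0 -> lip L f1 -> lip L h ->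
  0 < c < 1 -> (forall x, f0 x <= c) -> (forall x, f1 x <= c) ->
  0 < d < 1 -> (forall x, d <= h x) ->
  0 <= K -> 0 < e <= 1 ->
  (forall x, f0 x <= K / (1 + e * x ^+ 2)) ->
  (forall x, f1 x <= K / (1 + e * x ^+ 2)) ->
  (forall x y, (Phinv (f0 x) + Phinv (f1 y)) / 2 <= Phinv (h ((x + y) / 2))) ->
  (Phinv (gexp f0) + Phinv (gexp f1)) / 2 <= Phinv (gexp h).
Proof.
move=> u0 u1 uh l0 l1 lh hc f0c f1c hd hdx K0 he f0K f1K mid.
have /andP[e0 e1] := he.
rewrite -subr_ge0 leNgt; apply/negP => neg.
have negE : gap f0 f1 h 1 0 0 < 0.
  by rewrite /gap addr0 mul0r /heatinv !heat10.
pose k := - gap f0 f1 h 1 0 0 / 2.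
have k0 : 0 < k by rewrite /k; lra.
pose D (w : R * (R * R)) := gap f0 f1 h w.1 w.2.1 w.2.2 + k * w.1 ^+ 2.
have D1 : D (1, (0, 0)) < 0 by rewrite /D /= expr1n /k; lra.
have D0 w : 0 <= D (0, w).
  rewrite /D /= expr0n/= mulr0 addr0 /gap /heatinv !heat0 subr_ge0; exact: mid.
(* If the average of [f0] or [f1] is at most [t], the gap is nonnegative, since
   the other average is at most [c] and that of [h] at least [d]. *)
pose t := Phi (2 * Phinv d - Phinv c).
have t0 : 0 < t := Phi_gt0 _.
pose B2 := 4 * K / t / e.
pose B := B2 + 1.
have B20 : 0 <= B2 by rewrite !divr_ge0 ?(ltW t0) ?(ltW e0)// mulr_ge0.
have small f s x : unitf f -> (forall x, f x <= K / (1 + e * x ^+ 2)) ->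
    0 <= s <= 1 -> B < `|x| -> heatinv f s x <= 2 * Phinv d - Phinv c.
  move=> uf fK hs xB; rewrite /heatinv Phinv_leP ?heat01//.
  apply: (le_trans (heat_decay x uf K0 he hs fK)).
  have x2 : B2 <= x ^+ 2.
    have x1 : 1 <= `|x| by rewrite /B in xB; lra.
    have := ler_wpM2l (normr_ge0 x) x1; rewrite mulr1 -expr2 real_normK ?num_real//.
    by rewrite /B in xB; lra.
  rewrite -/t ler_pdivrMr; last by have := mulr_ge0 (ltW e0) (sqr_ge0 x); lra.
  rewrite [t * _]mulrC -ler_pdivrMr//; have : e * B2 <= e * x ^+ 2 by rewrite ler_wpM2l// ltW.
  by rewrite /B2 mulrCA divff ?gt_eqF// mulr1; lra.
have ubc f s x : unitf f -> (forall x, f x <= c) -> heatinv f s x <= Phinv c.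
  move=> uf fc; rewrite Phinv_le ?heat01//; apply: gexp_ub; first exact: unitf_affine.
  by move=> z; exact: fc.
have lbd s x : Phinv d <= heatinv h s x.
  rewrite Phinv_le ?heat01//; apply: gexp_ge; first exact: unitf_affine.
  by move=> z; exact: hdx.
have Dout s x0 x1 : 0 <= s <= 1 -> (B < `|x0|) || (B < `|x1|) -> 0 <= D (s, (x0, x1)).
  move=> hs out; rewrite /D /= /gap addr_ge0 ?(mulr_ge0 (ltW k0) (sqr_ge0 _))//.
  have h1 := lbd s ((x0 + x1) / 2).
  case/orP: out => xB.
    have := small f0 s x0 u0 f0K hs xB; have := ubc f1 s x1 u1 f1c; lra.
  have := small f1 s x1 u1 f1K hs xB; have := ubc f0 s x0 u0 f0c; lra.
pose A : set (R * (R * R)) := [set` `[0, 1]] `*` ([set` `[- B, B]] `*` [set` `[- B, B]]).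
have cA : compact A.
  by apply: compact_setX; [|apply: compact_setX]; exact: segment_compact.
have A1 : A (1, (0, 0)).
  by rewrite /A /=; split => /=; [|split => /=]; rewrite in_itv/=; rewrite /B; lra.
have n1 (a b : R * (R * R)) : `|a.1 - b.1| <= `|a - b| by rewrite prod_normE le_max lexx.
have n2 (a b : R * (R * R)) : `|a.2.1 - b.2.1| <= `|a - b|.
  by rewrite prod_normE le_max; apply/orP; right; rewrite prod_normE le_max lexx.
have n3 (a b : R * (R * R)) : `|a.2.2 - b.2.2| <= `|a - b|.
  by rewrite prod_normE le_max; apply/orP; right; rewrite prod_normE le_max lexx orbT.
have n4 (a b : R * (R * R)) : `|(a.2.1 + a.2.2) / 2 - (b.2.1 + b.2.2) / 2| <= `|a - b|.
  rewrite (_ : _ - _ = ((a.2.1 - b.2.1) + (a.2.2 - b.2.2)) / 2); last by field.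
  rewrite normrM normfV (ger0_norm (ler0n _ 2)) ler_pdivrMr//.
  apply: (le_trans (ler_normD _ _)); have := n2 a b; have := n3 a b; lra.
have cD : continuous D.
  move=> w; apply: cvgD; last first.
    apply: cvgM; first exact: cvg_cst.
    apply: (@continuous_comp _ _ _ (fun w : R * (R * R) => w.1) (fun x : R => x ^+ 2)).
      by apply: (@lip_continuous_normed _ _ 1) => a b; rewrite mul1r.
    exact: sqr_continuous.
  apply: cvgB; first exact: (heatinv_continuous uh lh n1 n4).
  apply: cvgM; last exact: cvg_cst.
  apply: cvgD; first exact: (heatinv_continuous u0 l0 n1 n2).
  exact: (heatinv_continuous u1 l1 n1 n3).
have [[s [x0 x1]] /set_mem Aw wmin] :=
  compact_EVT_min (ex_intro _ _ A1) cA (continuous_subspaceT cD).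
have Dw : D (s, (x0, x1)) < 0.
  by apply: le_lt_trans D1; apply: wmin; exact/mem_set.
have [hs _] := Aw; rewrite /= in_itv/= in hs.
have s0 : 0 < s.
  have /andP[s0 _] := hs; rewrite lt_neqAle s0 andbT; apply/eqP => s00.
  by move: Dw; rewrite -s00 ltNge D0.
have : 0 <= gap f0 f1 h s x0 x1.
  apply: (@gap_min_ge0 _ _ _ _ _ _ _ k) => // s' y0 y1 /andP[s'0 s's].
  rewrite -[leLHS]/(D (s, (x0, x1))) -[leRHS]/(D (s', (y0, y1))).
  have hs' : 0 <= s' <= 1 by rewrite s'0 (le_trans s's)//; case/andP: hs.
  have [out|] := boolP ((B < `|y0|) || (B < `|y1|)).
    by apply: (le_trans (ltW Dw)); exact: Dout.
  rewrite negb_or -!leNgt !ler_norml => /andP[hy0 hy1].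
  by apply: wmin; apply/mem_set; split => /=; [|split => /=]; rewrite in_itv.
move=> g0; move: Dw; rewrite /D /= ltNge addr_ge0//.
exact: (mulr_ge0 (ltW k0) (sqr_ge0 _)).
Qed.

End core.

Section functional_ehrhard.
Context (R : realType).
Implicit Types (a b c p q r s x y K L d e : R) (f h : R -> R).

(** A multiplier giving the decay required by [functional_ehrhard_decay]; for
functions with values in [0, 1] it costs at most [e] in expectation, because
[E z^2 = 1]. *)
Definition damp e x := (1 + e * x ^+ 2)^-1.

Lemma damp_den e x : 0 < e -> 1 <= 1 + e * x ^+ 2.
Proof. by move=> e0; rewrite lerDl (mulr_ge0 (ltW e0) (sqr_ge0 x)). Qed.

Lemma damp01 e x : 0 < e -> 0 < damp e x <= 1.
Proof.
move=> /(@damp_den _ x) h; have h0 : 0 < 1 + e * x ^+ 2 by lra.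
by rewrite /damp invr_gt0 h0 invf_le1.
Qed.

Lemma damp_lip e : 0 < e <= 1 -> lip 2 (damp e).
Proof.
move=> /andP[e0 e1] x y.
have hx := damp_den x e0; have hy := damp_den y e0.
have hx0 : 0 < 1 + e * x ^+ 2 by lra.
have hy0 : 0 < 1 + e * y ^+ 2 by lra.
rewrite /damp (_ : _ - _ = (y - x) * (e * (y + x)) / ((1 + e * x ^+ 2) * (1 + e * y ^+ 2))); last first.
  by field; rewrite !gt_eqF.
rewrite !normrM normfV (gtr0_norm (mulr_gt0 hx0 hy0)) (distrC y) (gtr0_norm e0).
rewrite ler_pdivrMr ?mulr_gt0// [2 * _]mulrC -mulrA ler_wpM2l//.
have ax z : e * `|z| <= 1 + e * z ^+ 2.
  rewrite -[z ^+ 2]real_normK ?num_real//.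
  have := sqr_ge0 (`|z| - 1); have := normr_ge0 z => z0 h.
  have : e * `|z| <= e * ((1 + `|z| ^+ 2)) by rewrite ler_wpM2l ?(ltW e0)//; lra.
  by lra.
apply: (@le_trans _ _ (e * `|y| + e * `|x|)).
  by rewrite -mulrDr ler_wpM2l ?(ltW e0)// ler_normD.
have h1 : 1 + e * x ^+ 2 <= (1 + e * x ^+ 2) * (1 + e * y ^+ 2) by rewrite ler_peMr// ltW.
have h2 : 1 + e * y ^+ 2 <= (1 + e * x ^+ 2) * (1 + e * y ^+ 2) by rewrite ler_peMl// ltW.
have := ax x; have := ax y; lra.
Qed.

(** Damp [f0] and [f1], replace [h] by its maximum with [e], and let [e] tend
to 0. *)
Lemma functional_ehrhard L c f0 f1 h :
  unitf f0 -> unitf f1 -> unitf h -> lip L f0 -> lip L f1 -> lip L h ->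
  0 < c < 1 -> (forall x, f0 x <= c) -> (forall x, f1 x <= c) ->
  (forall x y, (Phinv (f0 x) + Phinv (f1 y)) / 2 <= Phinv (h ((x + y) / 2))) ->
  (Phinv (gexp f0) + Phinv (gexp f1)) / 2 <= Phinv (gexp h).
Proof.
move=> u0 u1 uh l0 l1 lh hc f0c f1c mid.
have L0 := lip_ge0 l0.
have dl e f : 0 < e <= 1 -> unitf f -> lip L f ->
  [/\ unitf (fun x => f x * damp e x), lip (L + 2) (fun x => f x * damp e x),
   (forall x, f x * damp e x <= f x), (forall x, f x * damp e x <= 1 / (1 + e * x ^+ 2)) &
   gexp f - e <= gexp (fun x => f x * damp e x)].
  move=> he uf lf; have /andP[e0 e1] := he; have [cf f01] := uf.
  have le1 x : f x * damp e x <= f x.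
    have /andP[h1 _] := f01 x; have /andP[_ h2] := damp01 x e0.
    by rewrite ler_piMr// ltW.
  have u : unitf (fun x => f x * damp e x).
    split.
      move=> x; apply: cvgM; first exact: cf.
      exact: (lip_continuous (damp_lip he)).
    move=> x; have /andP[h1 h2] := f01 x; have /andP[h3 h4] := damp01 x e0.
    by rewrite mulr_gt0//= (le_lt_trans (le1 x)).
  split => //.
  - move=> x y; rewrite (_ : _ - _ = (f x - f y) * damp e x + f y * (damp e x - damp e y)); last by ring.
    rewrite (le_trans (ler_normD _ _))// !normrM mulrDl lerD//.
      have /andP[/ltW h3 h4] := damp01 x e0.
      by rewrite (ger0_norm h3) (le_trans _ (lf x y))// ler_piMr.
    rewrite (le_trans _ (damp_lip he x y))// ler_piMl//; exact: unitf_norm.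
  - move=> x; rewrite ler_wpM2r//; first by have /andP[/ltW] := damp01 x e0.
    by have /andP[_ /ltW] := f01 x.
  rewrite lerBlDr -lerBlDl -gexpB; [|exact: unitf_tame|exact: unitf_tame].
  rewrite -[leRHS]mulr1 -gexp_sqr1 -gexpZ; last exact: (@tame_exprn R 2).
  apply: gexp_le.
  - by apply: tameB; exact: unitf_tame.
  - by apply: tameZ; exact: (@tame_exprn R 2).
  move=> x; have hd := damp_den x e0; have hd0 : 0 < 1 + e * x ^+ 2 by lra.
  rewrite (_ : f x - _ = f x * (e * x ^+ 2 * damp e x)); last by rewrite /damp; field; rewrite gt_eqF.
  have /andP[/ltW h1 /ltW h2] := f01 x; have /andP[/ltW h3 h4] := damp01 x e0.
  have ex := mulr_ge0 (ltW e0) (sqr_ge0 x).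
  rewrite -[leRHS]mul1r; apply: ler_pM => //; first exact: mulr_ge0 ex h3.
  by rewrite ler_piMr.
have hl e : 0 < e < 1 -> [/\ unitf (fun x => Num.max (h x) e), lip (L + 2) (fun x => Num.max (h x) e),
    (forall x, e <= Num.max (h x) e), (forall x, h x <= Num.max (h x) e) &
    gexp (fun x => Num.max (h x) e) <= gexp h + e].
  move=> /andP[e0 e1]; have [ch h01] := uh.
  have lm : lip L (fun x => Num.max (h x) e).
    move=> x y; apply: le_trans (lh x y).
    rewrite ler_norml; have := ler_norm (h x - h y); have := ler_norm (h y - h x).
    rewrite distrC; have := normr_ge0 (h x - h y).
    by case: (leP (h x) e) => ?; case: (leP (h y) e) => ? ? ? ?; lra.
  have um : unitf (fun x => Num.max (h x) e).
    split; first exact: lip_continuous lm.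
    by move=> x; have /andP[h1 h2] := h01 x; rewrite lt_max h1/= gt_max h2.
  split => //.
  - by move=> x y; apply: (le_trans (lm x y)); rewrite ler_wpM2r//; lra.
  - by move=> x; rewrite le_max lexx orbT.
  - by move=> x; rewrite le_max lexx.
  rewrite -[X in _ + X](gexp_cst e) -gexpD; [|exact: unitf_tame|exact: tame_cst].
  apply: gexp_le; [exact: unitf_tame|apply: tameD; [exact: unitf_tame|exact: tame_cst]|].
  move=> x; have /andP[h1 h2] := h01 x; rewrite ge_max; apply/andP; split; lra.
have a0 := unitf_gexp u0; have a1 := unitf_gexp u1; have b0 := unitf_gexp uh.
move: (a0) (a1) (b0) => /andP[a00 a01] /andP[a10 a11] /andP[b00 b01].
have key e : 0 < e < 1 -> e < gexp f0 -> e < gexp f1 -> e < 1 - gexp h ->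
    (Phinv (gexp f0 - e) + Phinv (gexp f1 - e)) / 2 <= Phinv (gexp h + e).
  move=> he ea0 ea1 eb; have /andP[e0 e1] := he.
  have he1 : 0 < e <= 1 by rewrite e0 ltW.
  have [u0' l0' f0le f0d g0] := dl e f0 he1 u0 l0.
  have [u1' l1' f1le f1d g1] := dl e f1 he1 u1 l1.
  have [uh' lh' hd hle gh] := hl e he.
  have := @functional_ehrhard_decay R (L + 2) 1 e c e _ _ _ u0' u1' uh' l0' l1' lh' hc
    (fun x => le_trans (f0le x) (f0c x)) (fun x => le_trans (f1le x) (f1c x)) he hd ler01 he1 f0d f1d.
  have mid' x y : (Phinv (f0 x * damp e x) + Phinv (f1 y * damp e y)) / 2 <=
      Phinv (Num.max (h ((x + y) / 2)) e).
    have [_ q0] := u0; have [_ q1] := u1; have [_ qh] := uh.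
    have [_ q0'] := u0'; have [_ q1'] := u1'; have [_ qh'] := uh'.
    have m0 : Phinv (f0 x * damp e x) <= Phinv (f0 x) by rewrite Phinv_le ?q0 ?q0'.
    have m1 : Phinv (f1 y * damp e y) <= Phinv (f1 y) by rewrite Phinv_le ?q1 ?q1'.
    have mh : Phinv (h ((x + y) / 2)) <= Phinv (Num.max (h ((x + y) / 2)) e) by rewrite Phinv_le ?qh ?qh'.
    by have := mid x y; lra.
  move=> /(_ mid') H.
  have k0 : Phinv (gexp f0 - e) <= Phinv (gexp (fun x => f0 x * damp e x)).
    by rewrite Phinv_le ?g0 ?unitf_gexp//; lra.
  have k1 : Phinv (gexp f1 - e) <= Phinv (gexp (fun x => f1 x * damp e x)).
    by rewrite Phinv_le ?g1 ?unitf_gexp//; lra.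
  have kh : Phinv (gexp (fun x => Num.max (h x) e)) <= Phinv (gexp h + e).
    by rewrite Phinv_le ?gh ?unitf_gexp//; lra.
  lra.
rewrite -subr_ge0 leNgt; apply/negP => neg.
pose g e := Phinv (gexp h + e) - (Phinv (gexp f0 - e) + Phinv (gexp f1 - e)) / 2.
have cont (a s : R) : 0 < a < 1 -> {for 0, continuous (fun e : R => Phinv (a + s * e))}.
  move=> ha; have ha0 : 0 < a + s * 0 < 1 by rewrite mulr0 addr0.
  exact: (continuous_comp (@continuous_affine R a s 0) (continuous_Phinv ha0)).
have cg : g e @[e --> (0 : R)] --> g 0.
  apply: cvgB.
    by have := cont _ 1 b0; rewrite /prop_for /continuous_at; under eq_fun do rewrite mul1r; rewrite mul1r.
  apply: cvgM; last exact: cvg_cst.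
  apply: cvgD.
    by have := cont _ (-1) a0; rewrite /prop_for /continuous_at; under eq_fun do rewrite mulN1r; rewrite mulN1r.
  by have := cont _ (-1) a1; rewrite /prop_for /continuous_at; under eq_fun do rewrite mulN1r; rewrite mulN1r.
have g0 : g 0 < 0 by rewrite /g addr0 !subr0.
have gneg : \forall e \near (0 : R), g e < 0 by exact: (cvgr_lt _ cg).
have [e /= e0 he] := (nbhs_ballP _ _).1 gneg.
pose t := Num.min (e / 2) (Num.min (1 / 2) (Num.min (gexp f0 / 2) (Num.min (gexp f1 / 2) ((1 - gexp h) / 2)))).
have [t0 te t1 ta0 [ta1 tb]] : [/\ 0 < t, t <= e / 2, t <= 1 / 2, t <= gexp f0 / 2 & t <= gexp f1 / 2 /\ t <= (1 - gexp h) / 2].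
  by rewrite /t !lt_min !ge_min !lexx !orbT; split => //; rewrite !divr_gt0//; lra.
have : g t < 0.
  by apply: he; rewrite /ball /= sub0r normrN gtr0_norm//; lra.
have := key t; rewrite t0 => /(_ _ _ _ _) H.
rewrite ltNge /g subr_ge0 => /negP; apply; apply: H; lra.
Qed.

End functional_ehrhard.

(** * Gaussian averages along a list of vectors *)

Section smear.
Context (R : realType) (d : nat).
Notation E := 'rV[R]_d.
Implicit Types (F : E -> R) (w z : E) (zs : seq E) (L M c : R).

Definition vlip L F := forall w w', `|F w - F w'| <= L * `|w - w'|.

Definition bndlip F := exists L M, vlip L F /\ forall w, `|F w| <= M.

Definition smear z F w := gexp (fun x => F (w + x *: z)).

(** The expectation of [F] at [w] plus a sum of independent standard normal
multiples of the vectors in [zs]. *)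
Definition smears zs F := foldr smear F zs.

Lemma vlip_line L F w z : vlip L F -> lip (L * `|z|) (fun x => F (w + x *: z)).
Proof.
move=> lF x y; apply: (le_trans (lF _ _)).
by rewrite opprD addrACA subrr add0r -scalerBl normrZ -mulrA [`|z| * _]mulrC.
Qed.

Lemma bndlip_tame F w z : bndlip F -> tame (fun x => F (w + x *: z)).
Proof.
move=> [L [M [lF FM]]]; apply: (@tame_bounded _ _ M) => //.
exact: lip_continuous (vlip_line w z lF).
Qed.

Lemma smear_bndlip z F : bndlip F -> bndlip (smear z F).
Proof.
move=> bF; have [L [M [lF FM]]] := bF; exists L, M; split.
  move=> w w'; rewrite /smear -[leRHS]gexp_cst.
  apply: gexp_dist; [exact: bndlip_tame|exact: bndlip_tame|exact: tame_cst|].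
  move=> x; apply: (le_trans (lF _ _)).
  by rewrite opprD addrACA subrr addr0.
move=> w; rewrite -[leRHS]gexp_cst; apply: gexp_norm => //.
  exact: bndlip_tame.
exact: tame_cst.
Qed.

Lemma smears_bndlip zs F : bndlip F -> bndlip (smears zs F).
Proof. by move=> bF; elim: zs => //= z zs IH; exact: smear_bndlip. Qed.

Lemma smears_cat zs1 zs2 F : smears (zs1 ++ zs2) F = smears zs1 (smears zs2 F).
Proof. exact: foldr_cat. Qed.

Lemma smear_le z F G w : bndlip F -> bndlip G -> (forall w, F w <= G w) ->
  smear z F w <= smear z G w.
Proof. by move=> bF bG FG; apply: gexp_le => //; exact: bndlip_tame. Qed.

Lemma smears_le zs F G w : bndlip F -> bndlip G -> (forall w, F w <= G w) ->
  smears zs F w <= smears zs G w.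
Proof.
move=> bF bG FG; elim: zs w => //= z zs IH w.
by apply: smear_le => //; exact: smears_bndlip.
Qed.

Lemma bndlip_cst c : bndlip (fun=> c).
Proof. by exists 0, `|c|; split=> // w w'; rewrite subrr normr0 mul0r. Qed.

Lemma bndlipD F G : bndlip F -> bndlip G -> bndlip (fun w => F w + G w).
Proof.
move=> [L [M [lF FM]]] [L' [M' [lG GM]]]; exists (L + L'), (M + M'); split.
  move=> w w'; rewrite (_ : _ - _ = (F w - F w') + (G w - G w')); last by rewrite opprD addrACA.
  by rewrite (le_trans (ler_normD _ _))// mulrDl lerD.
by move=> w; rewrite (le_trans (ler_normD _ _))// lerD.
Qed.

Lemma bndlipM F G : bndlip F -> bndlip G -> bndlip (fun w => F w * G w).
Proof.
move=> [L [M [lF FM]]] [L' [M' [lG GM]]]; exists (M' * L + M * L'), (M * M'); split.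
  move=> w w'; rewrite (_ : _ - _ = (F w - F w') * G w + F w' * (G w - G w')); last by ring.
  rewrite (le_trans (ler_normD _ _))// !normrM mulrDl lerD//.
    by rewrite mulrC -mulrA ler_pM.
  by rewrite -mulrA ler_pM.
by move=> w; rewrite normrM ler_pM.
Qed.

Lemma bndlipZ c F : bndlip F -> bndlip (fun w => c * F w).
Proof. by move=> bF; apply: bndlipM => //; exact: bndlip_cst. Qed.

Lemma smearsD zs F G w : bndlip F -> bndlip G ->
  smears zs (fun w => F w + G w) w = smears zs F w + smears zs G w.
Proof.
move=> bF bG; elim: zs w => //= z zs IH w.
rewrite /smear; under eq_fun do rewrite IH.
by rewrite gexpD//; apply: bndlip_tame; exact: smears_bndlip.
Qed.

Lemma smearsZ zs c F w : bndlip F ->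
  smears zs (fun w => c * F w) w = c * smears zs F w.
Proof.
move=> bF; elim: zs w => //= z zs IH w.
rewrite /smear; under eq_fun do rewrite IH.
by rewrite gexpZ//; apply: bndlip_tame; exact: smears_bndlip.
Qed.

Lemma smears_cst zs c w : smears zs (fun=> c) w = c.
Proof.
elim: zs w => //= z zs IH w.
by rewrite /smear; under eq_fun do rewrite IH; rewrite gexp_cst.
Qed.

(** Coefficients are listed rather than indexed so that the recursion follows that
of [smears]. *)
Fixpoint comb (zs : seq E) (cs : seq R) : E :=
  match zs, cs with
  | z :: zs', c :: cs' => c *: z + comb zs' cs'
  | _, _ => 0
  end.

Lemma combZ zs cs (t : R) : comb zs [seq t * c | c <- cs] = t *: comb zs cs.
Proof.
elim: zs cs => [|z zs IH] [|c cs] //=; rewrite ?scaler0//.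
by rewrite IH scalerDr scalerA.
Qed.

Lemma smears_span_eq zs F w c : 
  (forall cs, size cs = size zs -> F (w + comb zs cs) = c) -> smears zs F w = c.
Proof.
elim: zs w => [|z zs IH] w h /=; first by have := h [::] erefl; rewrite /= addr0.
rewrite /smear -[RHS](gexp_cst c); congr gexp; apply/funext => x.
by apply: IH => cs hcs; rewrite -addrA; apply: (h (x :: cs)); rewrite /= hcs.
Qed.

Lemma smears_ge0 zs F w : bndlip F -> (forall w, 0 <= F w) -> 0 <= smears zs F w.
Proof.
move=> bF F0; rewrite -(smears_cst zs 0 w).
by apply: smears_le => //; exact: bndlip_cst.
Qed.

(** A continuous nonnegative function with zero average vanishes on the support,
one vector at a time by [gexp_gt0]. *)
Lemma smears_eq0_span zs F w : bndlip F -> (forall w, 0 <= F w) ->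
  smears zs F w = 0 -> forall cs, size cs = size zs -> F (w + comb zs cs) = 0.
Proof.
move=> bF F0; elim: zs w => [|z zs IH] w /= h [|x cs] //=; first by rewrite addr0.
move=> [hcs]; rewrite addrA; apply: IH => //.
apply/eqP; rewrite eq_le smears_ge0// andbT leNgt; apply/negP => pos.
have := @gexp_gt0 R (fun x => smears zs F (w + x *: z)) x.
rewrite -[gexp _]/(smear z (smears zs F) w) h ltxx => H; apply/notF/H => //.
- by apply: bndlip_tame; exact: smears_bndlip.
- by move=> y; exact: smears_ge0.
Qed.

(** Functions [Phi o v] with [v] midpoint concave.  The uniform bound [c < 1] and
the Lipschitz constant are the hypotheses of [functional_ehrhard], and both are
inherited by averages. *)
Definition ehrhard F := exists L c (v : E -> R),
  [/\ vlip L F, 0 < c < 1, (forall w, F w <= c), (forall w, F w = Phi (v w)) &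
      forall w w', (v w + v w') / 2 <= v (2^-1 *: (w + w'))].

Lemma ehrhard_bndlip F : ehrhard F -> bndlip F.
Proof.
move=> [L [c [v [lF _ _ FE _]]]]; exists L, 1; split => // w.
by rewrite FE /= ger0_norm ltW ?Phi_gt0 ?Phi_lt1.
Qed.

Lemma ehrhard_unitf F w z : ehrhard F -> unitf (fun x => F (w + x *: z)).
Proof.
move=> [L [c [v [lF _ _ FE _]]]]; split.
  exact: lip_continuous (vlip_line w z lF).
by move=> x; rewrite FE /= Phi_gt0 Phi_lt1.
Qed.

(** [functional_ehrhard] along the three parallel lines through [w], [w'] and their
midpoint. *)
Lemma smear_ehrhard z F : ehrhard F -> ehrhard (smear z F).
Proof.
move=> eF; have [L [c [v [lF hc Fc FE mid]]]] := eF.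
exists L, c, (fun w => Phinv (smear z F w)); split => //.
- move=> w w'; rewrite /smear -[leRHS]gexp_cst.
  have bF := ehrhard_bndlip eF.
  apply: gexp_dist; [exact: bndlip_tame|exact: bndlip_tame|exact: tame_cst|].
  move=> x; apply: (le_trans (lF _ _)).
  by rewrite opprD addrACA subrr addr0.
- by move=> w; apply: gexp_ub; [exact: ehrhard_unitf|].
- by move=> w /=; rewrite PhinvK//; apply: unitf_gexp; exact: ehrhard_unitf.
move=> w w'; apply: (@functional_ehrhard R (L * `|z|) c).
- exact: ehrhard_unitf.
- exact: ehrhard_unitf.
- exact: ehrhard_unitf.
- exact: vlip_line.
- exact: vlip_line.
- exact: vlip_line.
- by [].
- by [].
- by [].
move=> x y; rewrite !FE /= !PhiK.
rewrite (_ : 2^-1 *: (w + w') + _ = 2^-1 *: ((w + x *: z) + (w' + y *: z))).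
  exact: mid.
by rewrite addrACA -scalerDl scalerDr [in RHS]scalerDr scalerA [2^-1 * _]mulrC -!scalerDr.
Qed.

Lemma smears_ehrhard zs F : ehrhard F -> ehrhard (smears zs F).
Proof. by move=> eF; elim: zs => //= z zs IH; exact: smear_ehrhard. Qed.

(** The average is symmetric, so it is half the average of
[F (w + x z) + F (w - x z)], which [Phi_add_le] bounds by [2 F w] when
[v w >= 0]; otherwise [Phi_add_lt1] makes the average smaller than 1/2. *)
Lemma smear_contract z F w : ehrhard F -> 2^-1 <= smear z F w -> smear z F w <= F w.
Proof.
move=> eF half; have [L [c [v [lF hc Fc FE mid]]]] := eF.
pose f x := F (w + x *: z).
have uf : unitf f by exact: ehrhard_unitf.
have [cf _] := uf.
have ufN : unitf (fun x => f (- x)).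
  by have := unitf_affine 0 (-1) uf; under eq_fun do rewrite add0r mulN1r.
have e2 : 2 * smear z F w = gexp (fun x => f x + f (- x)).
  rewrite gexpD; [|exact: unitf_tame|exact: unitf_tame].
  by rewrite (@gexpN _ f 1)// /smear -/f; [lra|move=> x; exact: unitf_norm].
have tff : tame (fun x => f x + f (- x)) by apply: tameD; exact: unitf_tame.
have midw x : v (w + x *: z) + v (w + (- x) *: z) <= 2 * v w.
  have := mid (w + x *: z) (w + (- x) *: z).
  have -> : 2^-1 *: (w + x *: z + (w + - x *: z)) = w.
    rewrite addrACA -scalerDl subrr scale0r addr0 -[w in w + _]scale1r.
    by rewrite -[X in _ + X]scale1r -scalerDl scalerA (_ : 2^-1 * (1 + 1) = 1) ?scale1r//; field.
  lra.
have [v0|v0] := leP 0 (v w).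
  suff : 2 * smear z F w <= 2 * F w by lra.
  rewrite e2 -[leRHS]gexp_cst; apply: gexp_le => //; first exact: tame_cst.
  by move=> x; rewrite /f !FE /=; apply: Phi_add_le.
have : 0 < gexp (fun x => 1 - (f x + f (- x))).
  have lt1 x : 0 < 1 - (f x + f (- x)).
    rewrite subr_gt0 /f !FE /=; apply: Phi_add_lt1; apply: (le_lt_trans (midw x)); lra.
  apply: (@gexp_gt0 _ _ 0) => //; first by apply: tameB => //; exact: tame_cst.
  by move=> x; exact: ltW.
rewrite gexpB//; last exact: tame_cst.
by rewrite gexp_cst -e2; lra.
Qed.

Lemma smears_contract zs F w : ehrhard F -> 2^-1 <= smears zs F w -> smears zs F w <= F w.
Proof.
move=> eF; elim: zs w => //= z zs IH w half.
have h := smear_contract (smears_ehrhard zs eF) half.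
by apply: (le_trans h); apply: IH; exact: le_trans h.
Qed.

End smear.

(** * The Gaussian characteristic function *)

Section charfun.
Context (R : realType).
Implicit Types (a b c m r s x y z K : R) (f g : R -> R).

(** A quadratic remainder suffices for differentiability; this is how an
expectation is differentiated under the integral. *)
Lemma has_deriv_quad f x a K : (forall r, `|f (x + r) - f x - r * a| <= K * r ^+ 2) ->
  has_deriv f x a.
Proof.
move=> h.
have H : (fun r : R => r^-1 *: (f (r *: (1 : R) + x) - f x)) @ 0^' --> a.
  apply/cvgrPdist_le => e e0; near=> r.
  have r0 : r != 0 by near: r; exact: nbhs_dnbhs_neq.
  have K1 : 0 < `|K| + 1 by have := normr_ge0 K; lra.
  have rs : `|r| <= e / (`|K| + 1).
    near: r; apply: (cvgr0_norm_le); last by rewrite divr_gt0.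
    exact: (cvg_within_filter _ cvg_id).
  rewrite -(ler_pM2l (_ : 0 < `|r|)) ?normr_gt0// -normrM.
  rewrite [r *: (1 : R)]mulr1 [r + x]addrC.
  rewrite (_ : r * _ = - (f (x + r) - f x - r * a)); last first.
    rewrite /GRing.scale/= mulrBr mulrA divff// mul1r; ring.
  rewrite normrN; apply: (le_trans (h r)).
  rewrite ler_pdivlMr// in rs; have := ler_norm K.
  rewrite -[r ^+ 2]real_normK ?num_real// expr2 mulrCA => hK.
  rewrite ler_wpM2l//; have := normr_ge0 r; nra.
split; first by apply/cvg_ex; exists a.
by apply: cvg_lim => //; exact: Rhausdorff.
Unshelve. all: by end_near. Qed.

Lemma has_deriv_sin x : has_deriv sin x (cos x).
Proof. exact: is_derive_sin. Qed.

Lemma has_deriv_cos x : has_deriv cos x (- sin x).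
Proof. exact: is_derive_cos. Qed.

Lemma norm_cos_le1 x : `|cos x| <= 1.
Proof. by rewrite ler_norml cos_geN1 cos_le1. Qed.

Lemma norm_sin_le1 x : `|sin x| <= 1.
Proof. by rewrite ler_norml sin_geN1 sin_le1. Qed.

Lemma sin_lip x y : `|sin x - sin y| <= `|x - y|.
Proof.
have d b : has_deriv (fun b => sin (y + b) - sin y) b (cos (y + b)).
  apply: has_deriv_eq.
    apply: has_derivD; last exact: has_deriv_cst.
    apply: has_deriv_comp; first exact: has_deriv_sin.
    by apply: has_derivD; [exact: has_deriv_cst|exact: has_deriv_id].
  by ring.
have := @deriv_bound R _ _ 1 (x - y) d; rewrite addr0 subrr (_ : y + (x - y) = x) ?mul1r; last by ring.
by apply => // z _; exact: norm_cos_le1.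
Qed.

Lemma cos_lip x y : `|cos x - cos y| <= `|x - y|.
Proof.
have e z : cos z = sin (pi / 2 - z) by rewrite sinB sin_pihalf cos_pihalf mul1r mul0r subr0.
rewrite !e (le_trans (sin_lip _ _))// opprB addrC addrA subrK.
by rewrite distrC.
Qed.

Lemma sin_quad x : `|sin x - x| <= x ^+ 2.
Proof.
have d b : has_deriv (fun b => sin b - b) b (cos b - 1).
  by apply: has_derivD; [exact: has_deriv_sin|apply: has_derivN; exact: has_deriv_id].
rewrite -[x ^+ 2]real_normK ?num_real// expr2; apply: (deriv_bound d).
  by rewrite sin0 subrr.
move=> y yx; rewrite -cos0; apply: (le_trans (cos_lip _ _)).
by rewrite subr0.
Qed.

Lemma cos_quad a b : `|cos (a + b) - cos a - b * - sin a| <= b ^+ 2.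
Proof.
have d t : has_deriv (fun t => cos (a + t) - cos a - t * - sin a) t (- sin (a + t) - - sin a).
  apply: has_deriv_eq.
    apply: has_derivD.
      apply: has_derivD; last exact: has_deriv_cst.
      apply: has_deriv_comp; first exact: has_deriv_cos.
      by apply: has_derivD; [exact: has_deriv_cst|exact: has_deriv_id].
    by apply: has_derivN; apply: has_derivM; [exact: has_deriv_id|exact: has_deriv_cst].
  by rewrite /=; ring.
rewrite -[b ^+ 2]real_normK ?num_real// expr2; apply: (deriv_bound d).
  by rewrite addr0; ring.
move=> y yb; rewrite -opprD normrN; apply: (le_trans (sin_lip _ _)).
by rewrite addrAC subrr add0r.
Qed.

Lemma continuous_sinM s : continuous (fun z : R => sin (s * z)).
Proof.
by have := @continuous_comp_affine R sin 0 s (@continuous_sin R); under eq_fun do rewrite add0r.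
Qed.

Lemma continuous_cosM s : continuous (fun z : R => cos (s * z)).
Proof.
by have := @continuous_comp_affine R cos 0 s (@continuous_cos R); under eq_fun do rewrite add0r.
Qed.

Lemma gexp_sin s : gexp (fun z => sin (s * z)) = 0.
Proof.
have := gexpN (@continuous_sinM s) (fun z => norm_sin_le1 _).
under eq_fun do rewrite mulrN sinN -mulN1r.
rewrite gexpZ; first by lra.
by apply: (@tame_bounded _ _ 1) => [|z]; [exact: continuous_sinM|exact: norm_sin_le1].
Qed.

Definition gcos s := gexp (fun z => cos (s * z)).

Let tcos s : tame (fun z => cos (s * z)).
Proof. by apply: (@tame_bounded _ _ 1) => [|z]; [exact: continuous_cosM|exact: norm_cos_le1]. Qed.

Let tsin s : tame (fun z => sin (s * z)).
Proof. by apply: (@tame_bounded _ _ 1) => [|z]; [exact: continuous_sinM|exact: norm_sin_le1]. Qed.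

Let tzsin s : tame (fun z => z * sin (s * z)).
Proof. exact: tameM (@tame_id R) (@continuous_sinM s) (fun z => norm_sin_le1 _). Qed.

Let gsin s := gexp (fun z => z * sin (s * z)).

Lemma gexp_cos_shift c s : gexp (fun z => cos (c + s * z)) = cos c * gcos s.
Proof.
under eq_fun do rewrite cosD.
rewrite gexpB; [|exact: tameZ|exact: tameZ].
by rewrite !gexpZ// gexp_sin mulr0 subr0.
Qed.

Lemma gexp_sin_shift c s : gexp (fun z => sin (c + s * z)) = sin c * gcos s.
Proof.
under eq_fun do rewrite sinD.
rewrite gexpD; [|exact: tameZ|exact: tameZ].
by rewrite !gexpZ// gexp_sin mulr0 addr0.
Qed.

Lemma has_deriv_gcos s : has_deriv gcos s (- gsin s).
Proof.
apply: (@has_deriv_quad _ _ _ 1) => r.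
rewrite mulrN opprK /gsin -gexpZ// -gexpB// -gexpD//; last 2 first.
- exact: tameB.
- exact: tameZ.
rewrite mul1r -[leRHS]mulr1 -gexp_sqr1 -gexpZ; last exact: (@tame_exprn R 2).
apply: gexp_norm.
- by apply: tameD; [exact: tameB|exact: tameZ].
- by apply: tameZ; exact: (@tame_exprn R 2).
move=> z; have := cos_quad (s * z) (r * z).
by rewrite -mulrDl exprMn mulrN opprK mulrA.
Qed.

Lemma gcos_le1 s : `|gcos s| <= 1.
Proof.
rewrite -[leRHS]gexp_cst; apply: gexp_norm => //; first exact: tame_cst.
by move=> z; exact: norm_cos_le1.
Qed.

(** Stein's identity [E (z sin (s z)) = s E (cos (s z))], read off from the linear
coefficient in [gexp_curve] for the sine. *)
Lemma gsinE s : gsin s = s * gcos s.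
Proof.
apply/eqP; rewrite -subr_eq0; apply/eqP.
have [K K0 hK] : exists2 K, 0 <= K & forall r, `|r| <= 1 ->
    `|gexp (fun z => sin (s * (r / (1 + r ^+ 2) + (Num.sqrt (1 + r ^+ 2))^-1 * z))) - r * gsin s| <= K * `|r| ^+ 3.
  exists (1 * (6 * gexp (fun z : R => 1 + z ^+ 4))).
    rewrite mul1r mulr_ge0// -(gexp_cst 0); apply: gexp_le; first exact: tame_cst.
      by apply: tameD; [exact: tame_cst|exact: tame_exprn4].
    by move=> z; have := exprn4_ge0 z; lra.
  move=> r r1; have := gexp_curve r1 (@continuous_sinM s) (fun z => norm_sin_le1 _).
  by rewrite gexp_sin add0r.
have [K' K'0 hK'] : exists2 K, 0 <= K & forall r,
    `|gexp (fun z => cos (s * ((Num.sqrt (1 + r ^+ 2))^-1 * z))) - gcos s| <= K * r ^+ 2.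
  exists (1 * gexp (fun z : R => 1 + z ^+ 2)).
    rewrite mul1r -(gexp_cst 0); apply: gexp_le; first exact: tame_cst.
      by apply: tameD; [exact: tame_cst|exact: (@tame_exprn R 2)].
    by move=> z; have := sqr_ge0 z; lra.
  by move=> r; exact: (gexp_curve0 _ (@continuous_cosM s) (fun z => norm_cos_le1 _)).
apply: (@small_eq0 R _ (K + s ^+ 2 + `|s| + `|s| * K')) => r /andP[r0 r1].
have rn : `|r| <= 1 by rewrite gtr0_norm.
have := hK r rn; have := hK' r; rewrite (gtr0_norm r0).
set t := (Num.sqrt _)^-1; pose m := r / (1 + r ^+ 2); rewrite -/m.
have -> : (fun z => cos (s * (t * z))) = (fun z => cos (s * t * z)).
  by apply/funext => z; rewrite mulrA.
have -> : (fun z => sin (s * (m + t * z))) = (fun z => sin (s * m + s * t * z)).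
  by apply/funext => z; congr sin; ring.
rewrite gexp_sin_shift -/(gcos (s * t)).
have r20 := sqr_ge0 r.
have m0 : 0 <= m <= r.
  by rewrite /m divr_ge0 ?(ltW r0)//=; [rewrite ler_pdivrMr ?ler_peMr ?(ltW r0)//; lra|lra].
have mr : r - m <= r ^+ 2.
  rewrite (_ : r - m = r ^+ 2 * m); last by rewrite /m; field; rewrite gt_eqF//; lra.
  by rewrite ler_piMr//; case/andP: m0; lra.
have r3 : r ^+ 3 <= r ^+ 2 by rewrite exprS ler_piMl.
move=> h1 h2.
have q := sin_quad (s * m).
have m2 : (s * m) ^+ 2 <= s ^+ 2 * r ^+ 2.
  by rewrite exprMn ler_wpM2l ?sqr_ge0// lerXn2r// ?nnegrE ?(ltW r0)//; case/andP: m0.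
have -> : `|gsin s - s * gcos s| * r = `|r * gsin s - r * s * gcos s|.
  by rewrite -mulrA -mulrBr normrM (gtr0_norm r0) mulrC.
rewrite (_ : r * gsin s - _ = - (sin (s * m) * gcos (s * t) - r * gsin s)
   + (sin (s * m) - s * m) * gcos (s * t) + s * (m - r) * gcos (s * t) + s * r * (gcos (s * t) - gcos s)); last by ring.
have n1 : `|(sin (s * m) - s * m) * gcos (s * t)| <= s ^+ 2 * r ^+ 2.
  by rewrite normrM (le_trans _ m2)// (le_trans _ q)// ler_piMr// gcos_le1.
have n2 : `|s * (m - r) * gcos (s * t)| <= `|s| * r ^+ 2.
  rewrite !normrM -mulrA ler_wpM2l// (distrC m) (le_trans _ mr)// (le_trans _ (_ : `|r - m| <= _))//.
    by rewrite ler_piMr// gcos_le1.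
  by rewrite ger0_norm//; case/andP: m0; lra.
have n3 : `|s * r * (gcos (s * t) - gcos s)| <= `|s| * K' * r ^+ 2.
  rewrite !normrM (gtr0_norm r0) -!mulrA ler_wpM2l//.
  exact: le_trans (ler_piMl (normr_ge0 _) r1) h1.
apply: (le_trans (ler_normD _ _)).
have := ler_normD (- (sin (s * m) * gcos (s * t) - r * gsin s) + (sin (s * m) - s * m) * gcos (s * t)) (s * (m - r) * gcos (s * t)).
have := ler_normD (- (sin (s * m) * gcos (s * t) - r * gsin s)) ((sin (s * m) - s * m) * gcos (s * t)).
rewrite normrN; have := ler_wpM2l K0 r3; lra.
Qed.

(** By [gsinE] the function [gcos] solves [y' = - s y] with [y 0 = 1]. *)
Lemma gcosE s : gcos s = expR (- (s ^+ 2 / 2)).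
Proof.
pose k s := gcos s * expR (s * s * 2^-1).
have dk x : is_derive x (1 : R) k 0.
  apply: (@has_deriv_eq _ k).
    apply: has_derivM; first exact: has_deriv_gcos.
    apply: has_deriv_exp; apply: has_derivM; last exact: has_deriv_cst.
    by apply: has_derivM; exact: has_deriv_id.
  by rewrite /= gsinE; field.
have := is_derive_0_is_cst s 0 dk; rewrite /k !mul0r expR0 mulr1.
rewrite {2}/gcos; under [X in _ = gexp X]eq_fun do rewrite mul0r cos0.
rewrite gexp_cst => e.
rewrite -[LHS]mulr1 -[X in _ * X](expRxMexpNx_1 (s ^+ 2 / 2)) mulrA.
by rewrite (expr2 s) e mul1r.
Qed.

End charfun.

(** * One-dimensional Gaussian random variables *)

Section gaussian_law.
Context (R : realType) (dT : measure_display) (T : measurableType dT)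
  (P : probability T R).
Implicit Types (g : R -> R) (m s : R).

Lemma tame_affine g m s : tame g -> tame (fun x => g (m + s * x)).
Proof.
move=> [cg [C hC]]; split; first exact: continuous_comp_affine.
have C0 : 0 <= C by have := le_trans (normr_ge0 _) (hC 0); rewrite expr0n/= addr0 mulr1.
exists (C * (1 + 8 * m ^+ 4 + 8 * s ^+ 4)) => x; apply: (le_trans (hC _)).
rewrite -mulrA ler_wpM2l//.
have e1 : (m + s * x) ^+ 4 <= 8 * (m ^+ 4 + (s * x) ^+ 4).
  move: (s * x) => y.
  have h (u : R) : u ^+ 4 = (u ^+ 2) ^+ 2 by ring.
  rewrite !h; have := sqr_ge0 (m - y) => k.
  have l1 : (m + y) ^+ 2 <= 2 * (m ^+ 2 + y ^+ 2) by lra.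
  have l2 : ((m + y) ^+ 2) ^+ 2 <= (2 * (m ^+ 2 + y ^+ 2)) ^+ 2.
    by rewrite lerXn2r ?nnegrE ?sqr_ge0// mulr_ge0// addr_ge0 ?sqr_ge0.
  by apply: (le_trans l2); have := sqr_ge0 (m ^+ 2 - y ^+ 2); lra.
rewrite exprMn in e1; have m4 := exprn4_ge0 m; have s4 := exprn4_ge0 s; have x4 := exprn4_ge0 x.
by have := mulr_ge0 m4 x4; have := mulr_ge0 s4 x4; lra.
Qed.

(** The law N(m, s^2) depends on [|s|] only, and the Dirac mass at [m] is the case
[s = 0] of the law of [m + s * x], so no case distinction survives. *)
Lemma gaussian_var_law (Z : T -> R) : gaussian_var P Z -> exists m s,
  forall g, tame g -> P.-integrable setT (EFin \o (g \o Z)) /\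
    \int[P]_w g (Z w) = gexp (fun x => g (m + s * x)).
Proof.
move=> [mZ [m [s hZ]]]; exists m, `|s|.
have key g : continuous g -> (forall x, 0 <= g x) ->
    (\int[P]_w (g (Z w))%:E = \int[gauss R]_x (g (m + `|s| * x))%:E)%E.
  move=> cg g0.
  have mg : measurable_fun setT (EFin \o g).
    by apply/measurable_EFinP; exact: continuous_measurable_fun.
  have mZ' : @measurable_fun _ _ T (measurableTypeR R) setT Z := mZ.
  pose Zm := isMeasurableFun.Build _ _ T (measurableTypeR R) Z mZ'.
  pose Zf : {mfun T >-> measurableTypeR R} := HB.pack (Z : T -> measurableTypeR R) Zm.
  have -> : (\int[P]_w (g (Z w))%:E = \int[distribution P Zf]_y (g y)%:E)%E.
    by rewrite ge0_integral_distribution.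
  have [s0|s0] := eqVneq s 0.
    transitivity (\int[dirac (m : measurableTypeR R)]_y (g y)%:E)%E.
      apply: eq_measure_integral => A mA _.
      by have := hZ A mA; rewrite s0 eqxx.
    rewrite integral_dirac// diracT mul1e s0 normr0.
    under eq_integral do rewrite mul0r addr0.
    by rewrite integral_cst//; have /= -> := @probability_setT _ _ _ (gauss R); rewrite mule1.
  rewrite ge0_integral_gauss_affine ?normr_gt0//.
  apply: eq_measure_integral => A mA _.
  apply: (etrans (hZ A mA)); rewrite (negbTE s0).
  rewrite /normal_prob; apply: eq_integral => x _; congr EFin.
  by rewrite !normal_pdfE ?normr_eq0// /normal_peak /normal_fun real_normK ?num_real.
have intg g : tame g -> P.-integrable setT (EFin \o (g \o Z)).
  move=> tg; have [cg _] := tg; apply/integrableP; split.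
    by apply/measurable_EFinP/measurableT_comp => //; exact: continuous_measurable_fun.
  under eq_integral do rewrite /=.
  rewrite (key (fun x => `|g x|))//; last by move=> x; apply: cvg_norm; exact: cg.
  have /integrableP[_] := tame_int (tame_affine m `|s| tg).
  by under eq_integral do rewrite /=.
move=> g tg; split; first exact: intg.
have [cg _] := tg.
have tn : tame (fun x => `|g x|) by exact: tame_norm.
have tp : tame (fun x => g x + `|g x|) by exact: tameD.
have e (h : R -> R) : continuous h -> (forall x, 0 <= h x) ->
    \int[P]_w h (Z w) = gexp (fun x => h (m + `|s| * x)).
  by move=> ch h0; rewrite /gexp /Rintegral key.
transitivity (\int[P]_w ((g (Z w) + `|g (Z w)|) - `|g (Z w)|)).
  by apply: eq_Rintegral => w _; rewrite addrK.
rewrite RintegralB//; [|exact: (intg _ tp)|exact: (intg _ tn)].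
rewrite (e (fun x => g x + `|g x|)) ?(e (fun x => `|g x|))//.
- rewrite -gexpB; [|exact: (tame_affine _ _ tp)|exact: (tame_affine _ _ tn)].
  by congr gexp; apply/funext => x; rewrite addrK.
- by move=> x; apply: cvg_norm; exact: cg.
- by case: tp.
- by move=> x; rewrite -lerBlDr sub0r lerNl -normrN ler_norm.
Qed.

End gaussian_law.

(** * Factorization of positive semidefinite matrices *)

Section psd.
Context (R : realType) (d : nat).
Implicit Types (A : 'M[R]_d) (u v z : 'rV[R]_d).

Definition bform A u v : R := (u *m A *m v^T) 0 0.

Lemma bformDl A u u' v : bform A (u + u') v = bform A u v + bform A u' v.
Proof. by rewrite /bform !mulmxDl mxE. Qed.

Lemma bformZl A (t : R) u v : bform A (t *: u) v = t * bform A u v.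
Proof. by rewrite /bform -!scalemxAl mxE. Qed.

Lemma bformDr A u v v' : bform A u (v + v') = bform A u v + bform A u v'.
Proof. by rewrite /bform linearD /= mulmxDr mxE. Qed.

Lemma bformZr A (t : R) u v : bform A u (t *: v) = t * bform A u v.
Proof. by rewrite /bform linearZ /= -scalemxAr mxE. Qed.

Lemma bform_sym A u v : A^T = A -> bform A u v = bform A v u.
Proof.
move=> As; rewrite /bform -[in RHS](trmxK (v *m A *m u^T)) [in RHS]mxE.
by rewrite !trmx_mul trmxK As mulmxA.
Qed.

Lemma bform_deltar A u j : bform A u (delta_mx 0 j) = (u *m A) 0 j.
Proof. by rewrite /bform trmx_delta -colE mxE. Qed.

Lemma bform_delta A i j : bform A (delta_mx 0 i) (delta_mx 0 j) = A i j.
Proof. by rewrite bform_deltar -rowE mxE. Qed.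

(** Otherwise the form would be negative at a suitable multiple of the [i]-th basis
vector plus the [j]-th. *)
Lemma psd_diag0 A i j : psdmx A -> A i i = 0 -> A i j = 0.
Proof.
move=> [As Ap] Aii; apply/eqP/negP => /negP Aij.
(* The form at [t e_i + e_j] is [2 t A_ij + A_jj = -1]. *)
pose t := - (A j j + 1) / (2 * A i j).
have := Ap (t *: delta_mx 0 i + delta_mx 0 j).
rewrite -/(bform A _ _) !(bformDl, bformDr, bformZl, bformZr) !bform_delta Aii.
have -> : A j i = A i j by rewrite -[in LHS]As mxE.
rewrite !mulr0 add0r (_ : t * A i j + (t * A i j + A j j) = -1); last first.
  by rewrite /t; field.
by lra.
Qed.

(** One step of the Cholesky algorithm: subtracting [z^T *m z], for [z] the
normalized [i]-th row, keeps the matrix positive semidefinite (completing the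
square in the direction [i]) and kills the [i]-th diagonal entry without
reviving a zero one.  The induction is on the number of nonzero diagonal
entries, and [psd_diag0] ends it. *)
Lemma psd_factor A : psdmx A -> exists zs : seq 'rV[R]_d,
  A = \sum_(z <- zs) z^T *m z.
Proof.
have [n] := ubnP #|[pred i | A i i != 0]|.
elim: n A => // n IH A hn psdA; have [As Ap] := psdA.
have [i Ai|A0] := pickP (fun i => A i i != 0); last first.
  exists [::]; rewrite big_nil; apply/matrixP => i j; rewrite mxE.
  by apply: psd_diag0 => //; apply/eqP; have := A0 i => /= /negbFE.
have a0 : 0 < A i i.
  by rewrite lt0r Ai /= -bform_delta; exact: Ap.
pose s := Num.sqrt (A i i).
have s0 : 0 < s by rewrite sqrtr_gt0.
have s2 : s ^+ 2 = A i i by rewrite sqr_sqrtr// ltW.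
pose z := s^-1 *: row i A.
pose A' := A - z^T *m z.
have zE k : z 0 k = s^-1 * A i k by rewrite !mxE.
have A'E k l : A' k l = A k l - A i k * A i l / A i i.
  rewrite /A' !mxE big_ord1 mxE !zE -s2; congr (_ - _).
  by field; rewrite gt_eqF.
have A's : A'^T = A'.
  apply/matrixP => k l; rewrite mxE !A'E; congr (_ - _); last by rewrite [A i l * _]mulrC.
  by rewrite -[in LHS]As mxE.
have A'b u : bform A' u u = bform A u u - (bform A u (delta_mx 0 i)) ^+ 2 / A i i.
  rewrite /bform mulmxBr mulmxBl mxE; congr (_ + _); rewrite mxE; congr (- _).
  rewrite mulmxA -mulmxA mxE big_ord1.
  have -> : (z *m u^T) 0 0 = (u *m z^T) 0 0.
    by rewrite -[in LHS](trmxK (z *m u^T)) mxE trmx_mul trmxK.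
  have -> : (u *m z^T) 0 0 = s^-1 * bform A u (delta_mx 0 i).
    rewrite bform_deltar /z linearZ /= -scalemxAr mxE; congr (_ * _).
    rewrite -[in RHS]As !mxE; apply: eq_bigr => k _; by rewrite !mxE.
  by rewrite -/(bform _ _ _) -s2; field; rewrite gt_eqF.
have psdA' : psdmx A'.
  split => // u; rewrite -/(bform A' u u) A'b.
  pose c := bform A u (delta_mx 0 i).
  have := Ap (u + (- (c / A i i)) *: delta_mx 0 i).
  rewrite -/(bform A _ _) !(bformDl, bformDr, bformZl, bformZr) bform_delta.
  rewrite (bform_sym (delta_mx 0 i) u As) -/c.
  by congr (0 <= _); field; rewrite gt_eqF.
have lt : (#|[pred k | A' k k != 0%R]| < n)%N.
  rewrite ltnS in hn; apply: leq_trans hn; apply/proper_card/fintype.properP; split.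
    apply/fintype.subsetP => k; rewrite !inE; apply: contra => /eqP Ak.
    rewrite A'E Ak (_ : A i k = 0) ?mulr0 ?mul0r ?subrr//.
    by rewrite -As mxE; exact: psd_diag0.
  by exists i; rewrite !inE// A'E mulfK ?subrr ?eqxx.
have [zs zsE] := IH A' lt psdA'.
by exists (z :: zs); rewrite big_cons -zsE /A' addrC subrK.
Qed.

End psd.

(** * Measurability of vectors with measurable coordinates *)

Section measurability.
Context (R : realType) (dT : measure_display) (T : measurableType dT) (d : nat)
  (X : T -> 'rV[R]_d).
Hypothesis mX : forall i, measurable_fun setT (fun w => X w 0 i).

Lemma measurable_ball_preimage (q : 'rV[R]_d) (r : R) : 0 < r ->
  measurable [set w | `|X w - q| < r].
Proof.
move=> r0.
have -> : [set w | `|X w - q| < r] =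
    \bigcap_(i in [set: 'I_d]) [set w | `|X w 0 i - q 0 i| < r].
  apply/seteqP; split => w /=.
    move=> h i _ /=; apply: le_lt_trans h; rewrite [leRHS]mx_normrE.
    have := @le_bigmax _ R _ 0 (fun ij : 'I_1 * 'I_d => `|(X w - q) ij.1 ij.2|) (0, i).
    by rewrite /= !mxE.
  move=> h; rewrite [ltLHS]mx_normrE bigmax_lt//= => -[i j] _ /=.
  by have := h j I; rewrite /= !mxE ord1.
apply: fin_bigcap_measurable => // i _.
have := mX i => mXi.
have mf : measurable_fun setT (fun w => `|X w 0 i - q 0 i|).
  by apply: measurableT_comp => //; apply: measurable_funB.
rewrite (_ : [set w | _] = (fun w => `|X w 0 i - q 0 i|) @^-1` [set` `]-oo, r[]); last first.
  by apply/seteqP; split => w /=; rewrite in_itv.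
by rewrite -[X in measurable X]setTI; apply: mf => //; exact: measurable_itv.
Qed.

(** An open set is a countable union of balls with rational centre and radius
[1 / n]. *)
Lemma measurable_open_preimage (U : set 'rV[R]_d) : open U ->
  measurable (X @^-1` U).
Proof.
move=> oU.
pose qv (p : 'rV[rat]_d) : 'rV[R]_d := map_mx ratr p.
pose F (pn : 'rV[rat]_d * nat) : set T :=
  if pselect (ball (qv pn.1) (pn.2.+1%:R^-1 : R) `<=` U)
  then [set w | `|X w - qv pn.1| < pn.2.+1%:R^-1] else set0.
have -> : X @^-1` U = \bigcup_pn F pn.
  apply/seteqP; split => w /=; last first.
    move=> [[p n] _]; rewrite /F /=; case: pselect => //= hU h; apply: hU.
    by rewrite -ball_normE /= distrC.
  move=> Uw; have [e /= e0 he] := (nbhs_ballP _ _).1 (open_nbhs_nbhs (conj oU Uw)).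
  have [n ne] : exists n : nat, n.+1%:R^-1 < e / 2.
    have e20 : 0 < e / 2 by rewrite divr_gt0.
    have [n _ hn] := near_infty_natSinv_lt (PosNum e20).
    by exists n; apply: hn => /=.
  have n0 : 0 < n.+1%:R^-1 :> R by rewrite invr_gt0.
  have rp i : {p : rat | `|X w 0 i - ratr p| < n.+1%:R^-1}.
    apply: cid.
    have h : X w 0 i - n.+1%:R^-1 < X w 0 i + n.+1%:R^-1.
      by rewrite ltrD2l (@lt_trans _ _ 0)// oppr_lt0.
    have [p] := rat_in_itvoo h; rewrite in_itv/= => hp.
    by exists p; rewrite ltr_distlC.
  pose p : 'rV[rat]_d := \row_i sval (rp i).
  have near_p : `|X w - qv p| < n.+1%:R^-1.
    rewrite [ltLHS]mx_normrE bigmax_lt//= => -[i j] _ /=.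
    by rewrite !mxE ord1; exact: (svalP (rp j)).
  exists (p, n) => //; rewrite /F /=; case: pselect => //; apply.
  move=> y; rewrite -ball_normE /= => yb; apply: he.
  rewrite -ball_normE /= (_ : X w - y = (X w - qv p) + (qv p - y)); last by rewrite addrA subrK.
  apply: (le_lt_trans (ler_normD _ _)); rewrite [e]splitr ltrD//.
    exact: lt_trans near_p ne.
  exact: lt_trans yb ne.
apply: countable_bigcupT_measurable => [|[p n]]; first exact: countableP.
rewrite /F; case: pselect => h /=; last exact: measurable0.
by apply: measurable_ball_preimage; rewrite invr_gt0.
Qed.

Lemma measurable_continuous_comp (F : 'rV[R]_d -> R) : continuous F ->
  measurable_fun setT (fun w => F (X w)).
Proof.
move=> cF _; apply: (measurability _ (RGenOInfty.measurableE R)) => //.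
move=> _ [_ [a ->] <-]; rewrite setTI.
rewrite (_ : _ @^-1` _ = X @^-1` (F @^-1` [set x | a < x])); last first.
  by apply/seteqP; split => w /=; rewrite in_itv/= andbT.
apply: measurable_open_preimage; apply: open_comp => [x _|]; first exact: cF.
exact: open_gt.
Qed.

End measurability.

(** * Trigonometric and Bernstein approximation *)

Section integral_sum.
Context (R : realType) (dT : measure_display) (T : measurableType dT)
  (P : probability T R).

Lemma Rintegral_sum (I : Type) (r : seq I) (f : I -> T -> R) :
  (forall i, P.-integrable setT (EFin \o f i)) ->
  P.-integrable setT (EFin \o (fun w => \sum_(i <- r) f i w)) /\
  \int[P]_w (\sum_(i <- r) f i w) = \sum_(i <- r) \int[P]_w f i w.
Proof.
move=> fi; elim: r => [|i r [IH1 IH2]].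
  under eq_Rintegral do rewrite big_nil.
  rewrite big_nil; split; last exact: Rintegral_cst1.
  apply: (@bounded_integrable _ _ _ _ _ 0).
    by under eq_fun do rewrite big_nil; exact: measurable_cst.
  by move=> w; rewrite big_nil normr0.
split.
  have := integrableD measurableT (fi i) IH1.
  by apply: eq_integrable => // w _; rewrite /= big_cons EFinD.
under eq_Rintegral do rewrite big_cons.
by rewrite RintegralD// IH2 big_cons.
Qed.

Lemma Rintegral_dist (f g : T -> R) (h : T -> R) :
  P.-integrable setT (EFin \o f) -> P.-integrable setT (EFin \o g) ->
  P.-integrable setT (EFin \o h) -> (forall w, `|f w - g w| <= h w) ->
  `|\int[P]_w f w - \int[P]_w g w| <= \int[P]_w h w.
Proof.
move=> fi gi hi fgh; rewrite -RintegralB//.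
have fgi : P.-integrable setT (EFin \o (fun w => f w - g w)).
  have := integrableB measurableT fi gi.
  by apply: eq_integrable => // w _; rewrite /= EFinB.
apply: (le_trans (le_normr_Rintegral _ _)) => //.
apply: le_Rintegral => //.
have := integrable_abse fgi.
by apply: eq_integrable.
Qed.

Lemma integrableZr_EFin (f : T -> R) (c : R) : P.-integrable setT (EFin \o f) ->
  P.-integrable setT (EFin \o (fun w => c * f w)).
Proof.
move=> fi; have := integrableZl measurableT c fi.
by apply: eq_integrable => // w _; rewrite /= EFinM.
Qed.

End integral_sum.

Section dot.
Context (R : realType) (d : nat).
Notation E := 'rV[R]_d.
Implicit Types (u v w z : E).

Definition dot u w : R := \sum_(i < d) u 0 i * w 0 i.

Lemma dotDr u v w : dot u (v + w) = dot u v + dot u w.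
Proof. by rewrite /dot -big_split; apply: eq_bigr => i _; rewrite mxE mulrDr. Qed.

Lemma dotDl u v w : dot (u + v) w = dot u w + dot v w.
Proof. by rewrite /dot -big_split; apply: eq_bigr => i _; rewrite mxE mulrDl. Qed.

Lemma dotZr u (c : R) w : dot u (c *: w) = c * dot u w.
Proof. by rewrite /dot mulr_sumr; apply: eq_bigr => i _; rewrite mxE mulrCA. Qed.

Lemma dotZl (c : R) u w : dot (c *: u) w = c * dot u w.
Proof. by rewrite /dot mulr_sumr; apply: eq_bigr => i _; rewrite mxE mulrA. Qed.

Lemma dot0r u : dot u 0 = 0.
Proof. by rewrite /dot big1// => i _; rewrite mxE mulr0. Qed.

Lemma dot0l w : dot 0 w = 0.
Proof. by rewrite /dot big1// => i _; rewrite mxE mul0r. Qed.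

Lemma dot_delta i w : dot (delta_mx 0 i) w = w 0 i.
Proof.
rewrite /dot (bigD1 i)//= mxE !eqxx mul1r big1 ?addr0// => j ji.
by rewrite mxE (negbTE ji) andbF mul0r.
Qed.

(** Links the covariance of a Gaussian vector to the exponent in
[smears_cos]. *)
Lemma dot_bform (zs : seq E) u :
  bform (\sum_(z <- zs) z^T *m z) u u = \sum_(z <- zs) dot u z ^+ 2.
Proof.
rewrite /bform mulmx_sumr mulmx_suml summxE; apply: eq_bigr => z _.
rewrite mulmxA -mulmxA mxE big_ord1.
have -> : (u *m z^T) 0 0 = dot u z by rewrite mxE; apply: eq_bigr => i _; rewrite mxE.
have -> : (z *m u^T) 0 0 = dot u z by rewrite mxE; apply: eq_bigr => i _; rewrite mxE mulrC.
by [].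
Qed.

Lemma bform_sum (A : 'M[R]_d) u :
  bform A u u = \sum_(i < d) \sum_(j < d) u 0 i * u 0 j * A i j.
Proof.
rewrite /bform mxE exchange_big /=; apply: eq_bigr => j _.
by rewrite !mxE mulr_suml; apply: eq_bigr => i _; rewrite mulrAC.
Qed.

Lemma coord_le_norm w i : `|w 0 i| <= `|w|.
Proof.
rewrite [leRHS]mx_normrE.
exact: (@le_bigmax _ R _ 0 (fun ij : 'I_1 * 'I_d => `|w ij.1 ij.2|) (0, i)).
Qed.

Lemma norm_le_coord w (c : R) : 0 <= c -> (forall i, `|w 0 i| <= c) -> `|w| <= c.
Proof.
move=> c0 h; rewrite [leLHS]mx_normrE bigmax_le//= => -[i j] _ /=.
by rewrite ord1.
Qed.

Lemma dot_lip u v w : `|dot u v - dot u w| <= (\sum_(i < d) `|u 0 i|) * `|v - w|.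
Proof.
rewrite /dot -sumrB mulr_suml (le_trans (ler_norm_sum _ _ _))// ler_sum// => i _.
rewrite -mulrBr normrM ler_wpM2l//.
by have := coord_le_norm (v - w) i; rewrite !mxE.
Qed.

Lemma bndlip_continuous (F : E -> R) : bndlip F -> continuous F.
Proof. by move=> [L [M [lF _]]]; exact: (lip_continuous_normed lF). Qed.

Lemma bndlip_cos (c : R) u : bndlip (fun w => cos (c + dot u w)).
Proof.
exists (\sum_(i < d) `|u 0 i|), 1; split; last by move=> w; exact: norm_cos_le1.
move=> v w; apply: (le_trans (cos_lip _ _)).
by rewrite opprD addrACA subrr add0r dot_lip.
Qed.

Lemma smears_cos zs (c : R) u w : smears zs (fun w => cos (c + dot u w)) w =
  cos (c + dot u w) * expR (- ((\sum_(z <- zs) dot u z ^+ 2) / 2)).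
Proof.
elim: zs w => [|z zs IH] w /=; first by rewrite big_nil mul0r oppr0 expR0 mulr1.
rewrite /smear; under eq_fun do rewrite IH mulrC dotDr dotZr [_ * dot u z]mulrC addrA.
rewrite gexpZ; last first.
  apply: (@tame_bounded _ _ 1) => [|x]; last exact: norm_cos_le1.
  exact: (@continuous_comp_affine R (@cos R) (c + dot u w) (dot u z) (@continuous_cos R)).
rewrite gexp_cos_shift gcosE big_cons mulrCA -expRD; congr (_ * expR _).
by rewrite mulrDl opprD addrC.
Qed.

(** Second moments of the coordinates control the unbounded part of an
approximation error. *)
Lemma smears_quad zs (G : E -> R) (i : 'I_d) (a b : R) w : bndlip G -> 0 <= b ->
  (forall w, `|G w| <= a + b * w 0 i ^+ 2) ->
  `|smears zs G w| <= a + b * (\sum_(z <- zs) z 0 i ^+ 2) + b * w 0 i ^+ 2.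
Proof.
move=> bG b0 hG; elim: zs w => [|z zs IH] w /=; first by rewrite big_nil mulr0 addr0.
set S := \sum_(z <- zs) _ in IH.
have t1 := tameZ (2 * b * w 0 i * z 0 i) (@tame_id R).
have t2 := tameZ (b * z 0 i ^+ 2) (@tame_exprn R 2 isT).
have tq := tameD t1 t2.
have ta := tameD (tame_cst (a + b * S + b * w 0 i ^+ 2)) tq.
apply: (@le_trans _ _ (gexp (fun x => (a + b * S + b * w 0 i ^+ 2) + (2 * b * w 0 i * z 0 i * x + b * z 0 i ^+ 2 * x ^+ 2)))).
  apply: gexp_norm => //; first by apply: bndlip_tame; exact: smears_bndlip.
  move=> x; apply: (le_trans (IH _)); rewrite !mxE.
  by apply: eqW; ring.
rewrite (gexpD (tame_cst _) tq) (gexpD t1 t2).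
rewrite (gexpZ _ (@tame_id R)) (gexpZ _ (@tame_exprn R 2 isT)) gexp_cst gexp_odd1 gexp_sqr1 big_cons -/S.
by apply: eqW; ring.
Qed.

Definition set_coord w (k : 'I_d) (y : R) : E := \row_i (if i == k then y else w 0 i).

Lemma set_coord_lip w w' k y y' :
  `|set_coord w k y - set_coord w' k y'| <= Num.max `|w - w'| `|y - y'|.
Proof.
apply: norm_le_coord => [|i]; first by rewrite le_max normr_ge0.
rewrite !mxE; case: ifP => _; rewrite le_max ?lexx ?orbT//.
by have := coord_le_norm (w - w') i; rewrite !mxE => ->.
Qed.

Lemma set_coord_id w k : set_coord w k (w 0 k) = w.
Proof. by apply/rowP => i; rewrite mxE; case: eqP => // ->. Qed.

Definition depends (k : nat) (a : E -> R) :=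
  forall w w', (forall i : 'I_d, (i < k)%N -> w 0 i = w' 0 i) -> a w = a w'.

End dot.

Section bernstein.
Context (R : realType) (d : nat) (a : 'rV[R]_d -> R) (k : 'I_d) (B h : R).
Notation E := 'rV[R]_d.

Definition sinfrac (w : E) : R := (1 + sin (w 0 k / B)) / 2.

(** The average of [a], with its [k]-th coordinate replaced by [y + h S], over a
binomial variable [S] with parameters [n] and [sinfrac w].  As a function of
the [k]-th coordinate it is a polynomial in a sine, with coefficients that do
not depend on that coordinate. *)
Fixpoint bern (n : nat) (y : R) (w : E) : R :=
  if n is m.+1 then sinfrac w * bern m (y + h) w + (1 - sinfrac w) * bern m y w
  else a (set_coord w k y).

Lemma sinfrac01 w : 0 <= sinfrac w <= 1.
Proof.
have := norm_sin_le1 (w 0 k / B); rewrite ler_norml => /andP[h1 h2].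
by rewrite /sinfrac; apply/andP; split; lra.
Qed.

Lemma bndlip_sinfrac : bndlip sinfrac.
Proof.
exists (`|B^-1| / 2), 1; split; last first.
  by move=> w; have /andP[h0 h1] := sinfrac01 w; rewrite ger0_norm.
move=> w w'; rewrite /sinfrac (_ : _ - _ = (sin (w 0 k / B) - sin (w' 0 k / B)) / 2); last by ring.
rewrite normrM normfV (ger0_norm (ler0n _ 2)) mulrAC ler_wpM2r ?invr_ge0//.
rewrite (le_trans (sin_lip _ _))// -mulrBl normrM mulrC ler_wpM2l//.
by have := coord_le_norm (w - w') k; rewrite !mxE.
Qed.

Lemma bndlip_sinfracC : bndlip (fun w => 1 - sinfrac w).
Proof.
have := bndlipD (bndlip_cst d 1) (bndlipZ (-1) bndlip_sinfrac).
by under eq_fun do rewrite mulN1r.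
Qed.

Hypothesis ba : bndlip a.

Lemma bndlip_set_coord y : bndlip (fun w => a (set_coord w k y)).
Proof.
have [L [M [lF FM]]] := ba; exists `|L|, M; split => // w w'.
apply: (le_trans (lF _ _)); rewrite (le_trans (ler_wpM2r _ (ler_norm L)))// ler_wpM2l//.
apply: (le_trans (set_coord_lip _ _ _ _ _)).
by rewrite subrr normr0 ge_max lexx normr_ge0.
Qed.

Lemma bndlip_bern n y : bndlip (bern n y).
Proof.
elim: n y => [|n IH] y /=; first exact: bndlip_set_coord.
by apply: bndlipD; apply: bndlipM => //; [exact: bndlip_sinfrac|exact: bndlip_sinfracC].
Qed.

(** Chebyshev's argument for Bernstein polynomials: [|t| <= dl + t^2 / dl], and the
mean square of [y + h S - ys] is its squared mean plus its variance. *)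
Lemma bern_err L w n y ys dl : 0 <= L -> 0 < dl ->
  (forall y, `|a (set_coord w k y) - a (set_coord w k ys)| <= L * `|y - ys|) ->
  `|bern n y w - a (set_coord w k ys)| <=
   L * (dl + ((y + n%:R * sinfrac w * h - ys) ^+ 2
     + n%:R * sinfrac w * (1 - sinfrac w) * h ^+ 2) / dl).
Proof.
move=> L0 dl0 hL; set q := sinfrac w; have /andP[q0 q1] := sinfrac01 w.
rewrite -/q in q0 q1.
elim: n y => [|n IH] y /=.
  apply: (le_trans (hL y)); rewrite !mul0r !addr0 ler_wpM2l//.
  rewrite -[(y - ys) ^+ 2]real_normK ?num_real//.
  have n0 := normr_ge0 (y - ys).
  rewrite -(ler_pM2r dl0) mulrDl divfK ?gt_eqF//.
  by have := sqr_ge0 (dl - `|y - ys|); have := sqr_ge0 dl; nra.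
rewrite -/q; set b1 := bern n (y + h) w; set b0 := bern n y w; set c := a _.
have e1 := IH (y + h); have e0 := IH y; rewrite -/b1 -/c in e1; rewrite -/b0 -/c in e0.
rewrite (_ : q * b1 + (1 - q) * b0 - c = q * (b1 - c) + (1 - q) * (b0 - c)); last by ring.
have q1' : 0 <= 1 - q by lra.
have n1 : `|q * (b1 - c)| = q * `|b1 - c| by rewrite normrM (ger0_norm q0).
have n0 : `|(1 - q) * (b0 - c)| = (1 - q) * `|b0 - c| by rewrite normrM (ger0_norm q1').
apply: (le_trans (ler_normD _ _)); rewrite n1 n0.
apply: (le_trans (lerD (ler_wpM2l q0 e1) (ler_wpM2l q1' e0))).
apply: eqW; rewrite -natr1; field; rewrite gt_eqF//.
Qed.

End bernstein.

(** * Expectations of Gaussian vectors as iterated averages *)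

Section gaussian_vector_law.
Context (R : realType) (dT : measure_display) (T : measurableType dT)
  (P : probability T R) (d : nat) (X : T -> 'rV[R]_d) (Sigma : 'M[R]_d).
Hypothesis gX : gaussian_vector P X.
Hypothesis mX : mean_zero P X.
Hypothesis cX : has_covariance_matrix P X Sigma.
Notation E := 'rV[R]_d.
Implicit Types (u z : E) (zs : seq E) (H F : E -> R).

Let law u : exists m s, forall g, tame g ->
  P.-integrable setT (EFin \o (fun w => g (dot u (X w)))) /\
  \int[P]_w g (dot u (X w)) = gexp (fun x => g (m + s * x)).
Proof. exact: gaussian_var_law (gX u). Qed.

Lemma gaussian_coord_measurable i : measurable_fun setT (fun w => X w 0 i).
Proof.
have [+ _] := gX (delta_mx 0 i).
by under eq_fun do rewrite -/(dot _ _) dot_delta.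
Qed.

Let int_coord i : P.-integrable setT (EFin \o (fun w => X w 0 i)).
Proof.
have [m [s /(_ _ (@tame_id R))[+ _]]] := law (delta_mx 0 i).
by under eq_fun do rewrite dot_delta.
Qed.

Let int_coord2 i : P.-integrable setT (EFin \o (fun w => X w 0 i ^+ 2)).
Proof.
have [m [s /(_ _ (@tame_exprn R 2 isT))[+ _]]] := law (delta_mx 0 i).
by under eq_fun do rewrite dot_delta.
Qed.

Let int_coordM i j : P.-integrable setT (EFin \o (fun w => X w 0 i * X w 0 j)).
Proof.
have := integrableD measurableT (int_coord2 i) (int_coord2 j).
apply: le_integrable => //.
  apply/measurable_EFinP; apply: measurable_funM; exact: gaussian_coord_measurable.
move=> w _ /=; rewrite lee_fin; move: (X w 0 i) (X w 0 j) => x y.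
rewrite normrM [leRHS]ger0_norm ?addr_ge0 ?sqr_ge0//.
rewrite -(real_normK (num_real x)) -(real_normK (num_real y)).
have := sqr_ge0 (`|x| - `|y|); have := sqr_ge0 (`|x|); have := sqr_ge0 (`|y|).
by move: (`|x|) (`|y|) => p q; lra.
Qed.

Let mean_coord i : \int[P]_w X w 0 i = 0.
Proof. by have := mX i; rewrite unlock /Rintegral => ->. Qed.

Let cov_coord i j : \int[P]_w (X w 0 i * X w 0 j) = Sigma i j.
Proof.
have := cX i j; rewrite covariance.unlock unlock.
have e k : fine ('E_P[fun w => X w 0%R k])%E = 0 by rewrite mX.
rewrite unlock in e; rewrite !e /Rintegral => h.
suff -> : (\int[P]_w (X w 0 i * X w 0 j)%:E = (Sigma i j)%:E)%E by [].
rewrite -h; apply: eq_integral => w _; congr EFin.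
by rewrite !fctE /= !subr0.
Qed.

Lemma bndlip_integrable F : bndlip F -> P.-integrable setT (EFin \o (fun w => F (X w))).
Proof.
move=> bF; have [L [M [lF FM]]] := bF.
apply: (@bounded_integrable _ _ _ _ _ M) => [|w]; last exact: FM.
apply: measurable_continuous_comp; first exact: gaussian_coord_measurable.
exact: bndlip_continuous.
Qed.

(** The linear functional [u] has mean zero and variance [bform Sigma u u], so its
characteristic function is that of the standard normal law, rescaled. *)
Lemma gaussian_cos (c : R) u :
  \int[P]_w cos (c + dot u (X w)) = cos c * expR (- (bform Sigma u u / 2)).
Proof.
have [m [s h]] := law u.
have m0 : m = 0.
  have [_ e] := h _ (@tame_id R).
  have -> : m = gexp (fun x => m + s * x).
    rewrite gexpD; [|exact: tame_cst|exact: tameZ (@tame_id R)].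
    by rewrite gexp_cst gexpZ ?gexp_odd1 ?mulr0 ?addr0//; exact: tame_id.
  rewrite -e; have [_ ->] := Rintegral_sum (index_enum 'I_d)
    (fun i => integrableZr_EFin (u 0 i) (int_coord i)).
  by rewrite big1// => i _; rewrite RintegralZl// mean_coord mulr0.
have s2 : s ^+ 2 = bform Sigma u u.
  have [_ e] := h _ (@tame_exprn R 2 isT).
  have -> : s ^+ 2 = gexp (fun x => (m + s * x) ^+ 2).
    rewrite m0; under eq_fun do rewrite add0r exprMn.
    by rewrite gexpZ ?gexp_sqr1 ?mulr1//; exact: (@tame_exprn R 2).
  rewrite -e bform_sum.
  have ee w : dot u (X w) ^+ 2 = \sum_(i < d) \sum_(j < d) u 0 i * u 0 j * (X w 0 i * X w 0 j).
    rewrite expr2 /dot big_distrlr; apply: eq_bigr => i _; apply: eq_bigr => j _.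
    by rewrite /= mulrACA.
  under eq_Rintegral do rewrite ee.
  have ii i j := integrableZr_EFin (u 0 i * u 0 j) (int_coordM i j).
  have [_ ->] := Rintegral_sum (index_enum 'I_d)
    (fun i => (Rintegral_sum (index_enum 'I_d) (ii i)).1).
  apply: eq_bigr => i _; have [_ ->] := Rintegral_sum (index_enum 'I_d) (ii i).
  by apply: eq_bigr => j _; rewrite RintegralZl// cov_coord.
have tc : tame (fun x => cos (c + 1 * x)).
  apply: (@tame_bounded _ _ 1) => [|x]; last exact: norm_cos_le1.
  exact: (@continuous_comp_affine R (@cos R) c 1 (@continuous_cos R)).
have [_ e] := h _ tc.
transitivity (\int[P]_w cos (c + 1 * dot u (X w))).
  by apply: eq_Rintegral => w _; rewrite mul1r.
rewrite e m0; under eq_fun do rewrite add0r mul1r.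
by rewrite gexp_cos_shift gcosE s2.
Qed.

(** Follows from [gaussian_cos], as an expectation of a cosine is at most 1. *)
Lemma covariance_psd : psdmx Sigma.
Proof.
split.
  by apply/matrixP => i j; rewrite mxE -!cov_coord; apply: eq_Rintegral => w _; rewrite mulrC.
move=> u; rewrite -/(bform Sigma u u).
have := gaussian_cos 0 u; rewrite cos0 mul1r => e.
have : expR (- (bform Sigma u u / 2)) <= 1.
  rewrite -e -[leRHS](Rintegral_cst1 P 1); apply: le_Rintegral => //.
  - exact: bndlip_integrable (bndlip_cos 0 u).
  - by apply: (@bounded_integrable _ _ _ _ _ 1) => // x; rewrite normr1.
move=> h; have : - (bform Sigma u u / 2) <= 0 by rewrite -ler_expR expR0.
by lra.
Qed.

Variable zs : seq E.
Hypothesis SigmaE : Sigma = \sum_(z <- zs) z^T *m z.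

Definition same_exp H := \int[P]_w H (X w) = smears zs H 0.

Lemma same_expD H H' : bndlip H -> bndlip H' -> same_exp H -> same_exp H' ->
  same_exp (fun w => H w + H' w).
Proof.
move=> bH bH' e e'; rewrite /same_exp smearsD// RintegralD ?e ?e'//;
  exact: bndlip_integrable.
Qed.

Lemma same_expZ (c : R) H : bndlip H -> same_exp H -> same_exp (fun w => c * H w).
Proof.
by move=> bH e; rewrite /same_exp smearsZ// RintegralZl ?e//; exact: bndlip_integrable.
Qed.

Lemma same_exp_cos (c : R) u : same_exp (fun w => cos (c + dot u w)).
Proof.
by rewrite /same_exp gaussian_cos smears_cos dot0r addr0 SigmaE dot_bform.
Qed.

Section step.
Context (a : E -> R) (k : 'I_d).
Hypothesis ba : bndlip a.
Hypothesis da : depends k.+1 a.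
Hypothesis IH : forall b, bndlip b -> depends k b -> forall (c : R) u,
  same_exp (fun w => b w * cos (c + dot u w)).

(** Multipliers that may be moved into the cosine, that is, trigonometric
polynomials in the [k]-th coordinate. *)
Let trig (t : E -> R) := bndlip t /\ forall b, bndlip b -> depends k b ->
  forall (c : R) u, same_exp (fun w => t w * b w * cos (c + dot u w)).

(** The product of a sine and a cosine is a sum of cosines with the frequency [u]
moved along the [k]-th axis. *)
Let trig_step B t : B != 0 -> trig t -> trig (fun w => t w * sinfrac k B w).
Proof.
move=> B0 [bt ht]; have bs := @bndlip_sinfrac R d k B.
split; first exact: bndlipM.
move=> b bb db c u.
pose up := u + B^-1 *: delta_mx 0 k; pose um := u + - B^-1 *: delta_mx 0 k.
have -> : (fun w => t w * sinfrac k B w * b w * cos (c + dot u w)) =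
  (fun w => (2^-1 * (t w * b w * cos (c + dot u w)) +
    4^-1 * (t w * b w * cos (c - pi / 2 + dot up w))) +
    - 4^-1 * (t w * b w * cos (c - pi / 2 + dot um w))).
  apply/funext => w; rewrite /sinfrac /up /um !dotDl !dotZl dot_delta.
  have e (x : R) : cos (x - pi / 2) = sin x by rewrite cosB cos_pihalf sin_pihalf mulr0 add0r mulr1.
  rewrite (_ : c - pi / 2 + (dot u w + B^-1 * w 0 k) = (c + dot u w) + B^-1 * w 0 k - pi / 2); last by ring.
  rewrite (_ : c - pi / 2 + (dot u w + - B^-1 * w 0 k) = (c + dot u w) + - (B^-1 * w 0 k) - pi / 2); last by ring.
  rewrite !e !sinD sinN cosN [w 0 k / B]mulrC.
  by move: (c + dot u w) (B^-1 * w 0 k) => x y; field.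
have bc c' u' : bndlip (fun w => t w * b w * cos (c' + dot u' w)).
  by apply: bndlipM; [exact: bndlipM|exact: bndlip_cos].
apply: same_expD; [by apply: bndlipD; exact: bndlipZ|exact: bndlipZ| |].
  by apply: same_expD; [exact: bndlipZ|exact: bndlipZ| |]; apply: same_expZ => //; exact: ht.
by apply: same_expZ => //; exact: ht.
Qed.

Let trig_stepC B t : B != 0 -> trig t -> trig (fun w => t w * (1 - sinfrac k B w)).
Proof.
move=> B0 ht; have [bst hst] := trig_step B0 ht; have [bt ht'] := ht.
split; first by apply: bndlipM => //; exact: bndlip_sinfracC.
move=> b bb db c u.
have -> : (fun w => t w * (1 - sinfrac k B w) * b w * cos (c + dot u w)) =
  (fun w => t w * b w * cos (c + dot u w) +
     -1 * (t w * sinfrac k B w * b w * cos (c + dot u w))).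
  by apply/funext => w; ring.
have bc1 : bndlip (fun w => t w * b w * cos (c + dot u w)).
  by apply: bndlipM; [exact: bndlipM|exact: bndlip_cos].
have bc2 : bndlip (fun w => t w * sinfrac k B w * b w * cos (c + dot u w)).
  by apply: bndlipM; [exact: bndlipM|exact: bndlip_cos].
apply: same_expD => //; [exact: bndlipZ|exact: ht'|].
by apply: same_expZ => //; exact: hst.
Qed.

Let same_exp_bern B h n y t c u : B != 0 -> trig t ->
  same_exp (fun w => t w * bern a k B h n y w * cos (c + dot u w)).
Proof.
move=> B0; elim: n y t => [|n IHn] y t ht /=.
  have [bt ht'] := ht; apply: ht'; first exact: bndlip_set_coord.
  move=> w w' ww'; apply: da => i; rewrite ltnS leq_eqVlt !mxE => /orP[/eqP ik|ik].
    by rewrite (_ : i = k) ?eqxx//; exact: val_inj.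
  by case: ifP => // _; exact: ww'.
have -> : (fun w => t w * (sinfrac k B w * bern a k B h n (y + h) w +
      (1 - sinfrac k B w) * bern a k B h n y w) * cos (c + dot u w)) =
  (fun w => t w * sinfrac k B w * bern a k B h n (y + h) w * cos (c + dot u w) +
     t w * (1 - sinfrac k B w) * bern a k B h n y w * cos (c + dot u w)).
  by apply/funext => w; ring.
have bb m y' := @bndlip_bern R d a k B h ba m y'.
have [b1 _] := trig_step B0 ht; have [b2 _] := trig_stepC B0 ht.
apply: same_expD.
- by apply: bndlipM; [exact: bndlipM|exact: bndlip_cos].
- by apply: bndlipM; [exact: bndlipM|exact: bndlip_cos].
- exact: (IHn _ _ (trig_step B0 ht)).
- exact: (IHn _ _ (trig_stepC B0 ht)).
Qed.

(** The function [a] is replaced by [bern], at an error of at most a constant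
multiple of [t (1 + w_k^2)]; second moments being finite, [t] can tend to 0. *)
Lemma same_exp_step (c : R) u : same_exp (fun w => a w * cos (c + dot u w)).
Proof.
have [L0 [M [lL aM]]] := ba.
pose L := `|L0|.
have lL' : vlip L a by move=> w w'; rewrite (le_trans (lL w w'))// ler_wpM2r// ler_norm.
have Lp : 0 <= L by exact: normr_ge0.
pose K1 := \int[P]_w (X w 0 k ^+ 2); pose K2 := \sum_(z <- zs) z 0 k ^+ 2.
have bH : bndlip (fun w => a w * cos (c + dot u w)).
  by apply: bndlipM => //; exact: bndlip_cos.
apply/eqP; rewrite -subr_eq0; apply/eqP.
apply: (@small_eq0 R _ (L * (4 + K1 + K2))) => t /andP[t0 t1].
(* [B] is the scale at which [B sin (x / B)] approximates [x]; [N] makes the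
   variance term of [bern_err] at most [t^2], and the step [h] makes the
   binomial mean exactly [B sin (x / B)]. *)
pose B := t^-1.
have B0 : 0 < B by rewrite invr_gt0.
have Bn0 : B != 0 by rewrite gt_eqF.
have tn0 : t != 0 by rewrite gt_eqF.
have tB : t * B = 1 by rewrite /B divff// gt_eqF.
have [N hN] : exists N : nat, 4 * B ^+ 4 < N%:R.
  by exists (Num.bound (4 * B ^+ 4)); apply: archi_boundP; rewrite mulr_ge0// exprn_ge0// ltW.
have N0 : 0 < N%:R :> R by apply: le_lt_trans hN; rewrite mulr_ge0// exprn_ge0// ltW.
have Nn0 : N%:R != 0 :> R by rewrite gt_eqF.
pose h := 2 * B / N%:R.
pose G w := bern a k B h N (- B) w * cos (c + dot u w).
have bG : bndlip G by apply: bndlipM; [exact: bndlip_bern|exact: bndlip_cos].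
have t_one : trig (fun=> 1).
  split; first exact: bndlip_cst.
  move=> b bb db c' u'; under eq_fun do rewrite mul1r; exact: IH.
have sG : same_exp G.
  have := same_exp_bern h N (- B) c u Bn0 t_one.
  by under eq_fun do rewrite mul1r.
have err w : `|a w * cos (c + dot u w) - G w| <= 2 * L * t + L * t * w 0 k ^+ 2.
  rewrite /G -mulrBl normrM (le_trans (ler_piMr _ (norm_cos_le1 _)))//.
  pose ys := B * sin (w 0 k / B).
  have hy y : `|a (set_coord w k y) - a (set_coord w k ys)| <= L * `|y - ys|.
    rewrite (le_trans (lL' _ _))// ler_wpM2l// (le_trans (set_coord_lip _ _ _ _ _))//.
    by rewrite subrr normr0 ge_max lexx normr_ge0.
  have e1 := bern_err B h N (- B) Lp t0 hy.
  have qE : - B + N%:R * sinfrac k B w * h - ys = 0.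
    by rewrite /sinfrac /h /ys; move: (sin _) => sn; field; rewrite ?Bn0 ?Nn0 ?tn0.
  rewrite qE expr0n/= add0r in e1.
  have /andP[q0 q1] := @sinfrac01 R d k B w.
  have V : N%:R * sinfrac k B w * (1 - sinfrac k B w) * h ^+ 2 / t <= t.
    rewrite ler_pdivrMr// -expr2.
    have hh : N%:R * h ^+ 2 <= t ^+ 2.
      rewrite (_ : N%:R * h ^+ 2 = 4 * B ^+ 2 / N%:R); last by rewrite /h; field.
      rewrite ler_pdivrMr//.
      have -> : 4 * B ^+ 2 = t ^+ 2 * (4 * B ^+ 4).
        have -> : t ^+ 2 * (4 * B ^+ 4) = 4 * (t * B) ^+ 2 * B ^+ 2 by ring.
        by rewrite tB expr1n mulr1.
      by rewrite ler_wpM2l ?sqr_ge0// ltW.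
    apply: le_trans hh.
    rewrite (_ : _ * _ = sinfrac k B w * (1 - sinfrac k B w) * (N%:R * h ^+ 2)); last by ring.
    apply: ler_piMl; first exact: mulr_ge0 (ler0n _ _) (sqr_ge0 _).
    by apply: mulr_ile1; lra.
  have e2 : `|a (set_coord w k ys) - a w| <= L * t * w 0 k ^+ 2.
    rewrite -[X in _ - a X](set_coord_id w k) -mulrA (le_trans (lL' _ _))// ler_wpM2l//.
    apply: (le_trans (set_coord_lip _ _ _ _ _)); rewrite subrr normr0 ge_max.
    rewrite (mulr_ge0 (ltW t0) (sqr_ge0 _))/=.
    rewrite (_ : ys - w 0 k = B * (sin (w 0 k / B) - w 0 k / B)); last by rewrite /ys mulrBr mulrCA divff// mulr1.
    rewrite normrM (gtr0_norm B0) (le_trans (ler_wpM2l (ltW B0) (sin_quad _)))//.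
    by apply: eqW; rewrite /B; field; rewrite ?tn0.
  have e3 : `|bern a k B h N (- B) w - a (set_coord w k ys)| <= 2 * L * t.
    apply: (le_trans e1); apply: (@le_trans _ _ (L * (2 * t))); last by apply: eqW; ring.
    by rewrite ler_wpM2l//; lra.
  rewrite (_ : a w - _ = - (a (set_coord w k ys) - a w) - (bern a k B h N (- B) w - a (set_coord w k ys))); last by ring.
  by rewrite (le_trans (ler_normB _ _))// normrN; lra.
have iH := bndlip_integrable bH; have iG := bndlip_integrable bG.
have ie : P.-integrable setT (EFin \o (fun w => 2 * L * t + L * t * X w 0 k ^+ 2)).
  have h1 : P.-integrable setT (EFin \o (fun=> 2 * L * t)).
    by apply: (@bounded_integrable _ _ _ _ _ `|2 * L * t|).
  have h2 := integrableZr_EFin (L * t) (int_coord2 k).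
  have := integrableD measurableT h1 h2.
  by apply: eq_integrable => // w _; rewrite /= EFinD.
have d1 := Rintegral_dist iH iG ie (fun w => err (X w)).
rewrite RintegralD// in d1; last 2 first.
- by apply: (@bounded_integrable _ _ _ _ _ `|2 * L * t|).
- exact: integrableZr_EFin.
rewrite Rintegral_cst1 RintegralZl// -/K1 in d1.
have bD : bndlip (fun w => a w * cos (c + dot u w) + -1 * G w).
  by apply: bndlipD => //; exact: bndlipZ.
have d2 : `|smears zs (fun w => a w * cos (c + dot u w)) 0 - smears zs G 0| <= 2 * L * t + L * t * K2.
  have := @smears_quad R d zs _ k (2 * L * t) (L * t) 0 bD (mulr_ge0 Lp (ltW t0)) _.
  rewrite mxE expr0n/= mulr0 addr0 smearsD//; last exact: bndlipZ.
  rewrite smearsZ// mulN1r; apply => w; rewrite mulN1r; exact: err.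
rewrite sG in d1.
have := ler_distD (smears zs G 0) (\int[P]_w (a (X w) * cos (c + dot u (X w)))) (smears zs (fun w => a w * cos (c + dot u w)) 0).
rewrite (distrC (smears zs G 0)) => d3.
have d4 : `|\int[P]_w (a (X w) * cos (c + dot u (X w))) - smears zs (fun w => a w * cos (c + dot u w)) 0| <= L * (4 + K1 + K2) * t by lra.
by rewrite expr2 mulrA ler_wpM2r// ltW.
Qed.

End step.

Lemma same_exp_depends (k : nat) : (k <= d)%N -> forall a, bndlip a ->
  depends k a -> forall (c : R) u, same_exp (fun w => a w * cos (c + dot u w)).
Proof.
elim: k => [|k IH] kd a ba da c u.
  have -> : (fun w => a w * cos (c + dot u w)) = (fun w => a 0 * cos (c + dot u w)).
    by apply/funext => w; congr (_ * _); exact: da.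
  by apply: same_expZ; [exact: bndlip_cos|exact: same_exp_cos].
apply: (@same_exp_step a (Ordinal kd)) => // b bb db c' u'.
exact: (IH (ltnW kd)).
Qed.

(** All coordinates have been traded for trigonometric polynomials, on which the two
sides agree by [gaussian_cos] and [smears_cos]. *)
Theorem gaussian_smears F : bndlip F -> \int[P]_w F (X w) = smears zs F 0.
Proof.
move=> bF; have dF : depends d F.
  by move=> w w' ww'; congr F; apply/rowP => i; exact: ww'.
have := same_exp_depends (leqnn d) bF dF 0 0.
by rewrite /same_exp; under eq_fun do rewrite dot0l addr0 cos0 mulr1;
   under [X in _ = smears zs X _]eq_fun do rewrite dot0l addr0 cos0 mulr1.
Qed.

End gaussian_vector_law.

(** * Distance to a midpoint-convex set *)

Section distance.
Context (R : realType) (d : nat) (K : set 'rV[R]_d).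
Notation E := 'rV[R]_d.
Hypothesis K0 : K !=set0.

Definition dist (x : E) : R := inf [set `|x - k| | k in K].

Let has_inf_dist x : has_inf [set `|x - k| | k in K].
Proof.
have [k Kk] := K0; split; first by exists `|x - k|, k.
by exists 0 => _ [k' _ <-].
Qed.

Lemma dist_le x k : K k -> dist x <= `|x - k|.
Proof. by move=> Kk; apply: ge_inf; [exact: (has_inf_dist x).2|exists k]. Qed.

Lemma dist_ge0 x : 0 <= dist x.
Proof.
by apply: lb_le_inf; [exact: (has_inf_dist x).1|move=> _ [k _ <-]].
Qed.

Lemma dist_approx x e : 0 < e -> exists2 k, K k & `|x - k| < dist x + e.
Proof.
move=> e0; have [_ [k Kk <-] h] := inf_adherent e0 (has_inf_dist x).
by exists k.
Qed.

Lemma dist0 x : K x -> dist x = 0.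
Proof.
by move=> Kx; apply/eqP; rewrite eq_le dist_ge0 andbT; have := dist_le x Kx; rewrite subrr normr0.
Qed.

Lemma dist_eq0 x : closed K -> dist x = 0 -> K x.
Proof.
move=> cK dx; apply: contrapT => nKx.
have oK : open (~` K) by rewrite openC.
have [e /= e0 he] := (nbhs_ballP _ _).1 (open_nbhs_nbhs (conj oK nKx)).
have [k Kk xk] := dist_approx x e0; apply: (he k) => //.
by rewrite -ball_normE /=; rewrite dx add0r in xk.
Qed.

Lemma dist_lip x y : `|dist x - dist y| <= `|x - y|.
Proof.
have h a b : dist a <= dist b + `|a - b|.
  apply/ler_addgt0Pr => e e0; have [k Kk bk] := dist_approx b e0.
  apply: (le_trans (dist_le a Kk)).
  rewrite (_ : a - k = (a - b) + (b - k)); last by rewrite addrA subrK.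
  by apply: (le_trans (ler_normD _ _)); lra.
rewrite ler_norml; have := h x y; have := h y x; rewrite (distrC y).
by move=> ? ?; apply/andP; split; lra.
Qed.

(** Average the near-optimal points for [x] and [y]. *)
Lemma dist_midpoint x y : (forall a b, K a -> K b -> K (2^-1 *: (a + b))) ->
  dist (2^-1 *: (x + y)) <= (dist x + dist y) / 2.
Proof.
move=> mK; apply/ler_addgt0Pr => e e0.
have [k Kk xk] := dist_approx x e0; have [k' Kk' yk'] := dist_approx y e0.
apply: (le_trans (dist_le _ (mK _ _ Kk Kk'))).
rewrite -scalerBr opprD addrACA normrZ ger0_norm ?invr_ge0//.
by have := ler_normD (x - k) (y - k'); lra.
Qed.

End distance.

(** * Probabilities as real numbers *)

Section indicator.
Context (R : realType) (dT : measure_display) (T : measurableType dT)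
  (P : probability T R).

Definition pr (A : set T) : R := fine (P A).

Lemma prE A : measurable A -> (pr A)%:E = P A.
Proof. by move=> mA; rewrite fineK// fin_num_measure. Qed.

Lemma pr_le A B : measurable A -> measurable B -> A `<=` B -> pr A <= pr B.
Proof. by move=> mA mB AB; rewrite -lee_fin !prE// le_measure ?inE. Qed.

Lemma pr_setC A : measurable A -> pr (~` A) = 1 - pr A.
Proof.
move=> mA; apply/EFin_inj; rewrite EFinB !prE//; last exact: measurableC.
exact: probability_setC.
Qed.

Lemma indic_integrable A (c : R) : measurable A ->
  P.-integrable setT (EFin \o (fun w => c * \1_A w)).
Proof.
move=> mA; apply: (@bounded_integrable _ _ _ _ _ `|c|) => [|w].
  by apply: measurable_funM => //; exact: measurable_indic.
by rewrite normrM indicE ler_piMr//; case: (_ \in _); rewrite ?normr1 ?normr0.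
Qed.

Lemma Rintegral_indic A (c : R) : measurable A -> \int[P]_w (c * \1_A w) = c * pr A.
Proof.
move=> mA; rewrite RintegralZl//; last first.
  by have := indic_integrable 1 mA; under eq_fun do rewrite mul1r.
by rewrite /Rintegral integral_indic// setIT.
Qed.

Lemma pr_setT : pr setT = 1.
Proof. by rewrite /pr; have /= -> := @probability_setT _ _ _ P. Qed.

Lemma pr_le1 A : measurable A -> pr A <= 1.
Proof. by move=> mA; rewrite -pr_setT; exact: pr_le. Qed.

Lemma pr_bigcap (D : nat -> set T) c : (forall n, measurable (D n)) ->
  nonincreasing_seq D -> (forall n, c <= pr (D n)) -> c <= pr (\bigcap_n D n).
Proof.
move=> mD niD h; have mDD : measurable (\bigcap_n D n) by exact: bigcap_measurable.
have fin : (P (D 0%N) < +oo)%E by rewrite -(prE (mD 0%N)) ltry.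
rewrite -lee_fin (prE mDD); apply: cvge_ge (nonincreasing_cvg_mu fin mD mDD niD).
by near=> n; rewrite /= -(prE (mD n)) lee_fin.
Unshelve. all: by end_near.
Qed.

Lemma pr_bigcup (D : nat -> set T) c : (forall n, measurable (D n)) ->
  nondecreasing_seq D -> (forall n, pr (D n) <= c) -> pr (\bigcup_n D n) <= c.
Proof.
move=> mD niD h; have mDD : measurable (\bigcup_n D n) by exact: bigcup_measurable.
rewrite -lee_fin (prE mDD); apply: cvge_le (nondecreasing_cvg_mu mD mDD niD).
by near=> n; rewrite /= -(prE (mD n)) lee_fin.
Unshelve. all: by end_near.
Qed.

Lemma pr_markov_le (F : T -> R) A (c : R) : measurable A ->
  P.-integrable setT (EFin \o F) -> (forall w, 0 <= F w) ->
  (forall w, A w -> c <= F w) -> c * pr A <= \int[P]_w F w.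
Proof.
move=> mA iF F0 FA; rewrite -Rintegral_indic//; apply: le_Rintegral => //.
  exact: indic_integrable.
move=> w _; rewrite indicE; have [/set_mem wA|_] := boolP (w \in A).
  by rewrite mulr1; exact: FA.
by rewrite mulr0.
Qed.

Lemma Rintegral_le_pr (F : T -> R) A (c e : R) : measurable A ->
  P.-integrable setT (EFin \o F) -> (forall w, F w <= c + e) ->
  (forall w, ~ A w -> F w <= e) -> \int[P]_w F w <= c * pr A + e.
Proof.
move=> mA iF F0 FA; rewrite -Rintegral_indic// -[X in _ <= _ + X](Rintegral_cst1 P e).
have ie : P.-integrable setT (EFin \o (fun=> e)).
  by apply: (@bounded_integrable _ _ _ _ _ `|e|).
have ii := indic_integrable c mA.
rewrite -RintegralD//; apply: le_Rintegral => //.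
  have := integrableD measurableT ii ie.
  by apply: eq_integrable => // w _; rewrite /= EFinD.
move=> w _; rewrite indicE; have [/set_mem wA|/negP wA] := boolP (w \in A).
  by rewrite mulr1.
by rewrite mulr0 add0r; apply: FA => Aw; apply: wA; exact/mem_set.
Qed.

End indicator.

(** * Comparison of closed convex sets *)

Section comparison.
Context (R : realType) (d : nat) (dX dY : measure_display)
  (TX : measurableType dX) (TY : measurableType dY)
  (PX : probability TX R) (PY : probability TY R)
  (X : TX -> 'rV[R]_d) (Y : TY -> 'rV[R]_d) (SigmaX SigmaY : 'M[R]_d).
Hypothesis gaussX : gaussian_vector PX X.
Hypothesis meanX : mean_zero PX X.
Hypothesis covX : has_covariance_matrix PX X SigmaX.
Hypothesis gaussY : gaussian_vector PY Y.
Hypothesis meanY : mean_zero PY Y.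
Hypothesis covY : has_covariance_matrix PY Y SigmaY.
Hypothesis psd : psdmx (SigmaY - SigmaX).
Notation E := 'rV[R]_d.

(** Factor [SigmaX] by [xs] and [SigmaY - SigmaX] by [zs]: the average for [Y] is
the average along [zs] of the average for [X], which [smears_contract]
bounds by its value at 0. *)
Lemma ehrhard_comparison (F : E -> R) : ehrhard F ->
  2^-1 <= \int[PY]_w F (Y w) -> \int[PY]_w F (Y w) <= \int[PX]_w F (X w).
Proof.
move=> eF; have [xs xsE] := psd_factor (covariance_psd gaussX meanX covX).
have [zs zsE] := psd_factor psd.
have YE : SigmaY = \sum_(z <- zs ++ xs) z^T *m z.
  by rewrite big_cat /= -zsE -xsE subrK.
have bF := ehrhard_bndlip eF.
rewrite (gaussian_smears gaussX meanX covX xsE bF).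
rewrite (gaussian_smears gaussY meanY covY YE bF) smears_cat => half.
by apply: smears_contract => //; exact: smears_ehrhard.
Qed.

Lemma closed_preimage_measurable (dT : measure_display) (T : measurableType dT)
  (P : probability T R) (Z : T -> E) (K : set E) : gaussian_vector P Z ->
  closed K -> measurable (Z @^-1` K).
Proof.
move=> gZ cK; rewrite -[K]setCK preimage_setC; apply: measurableC.
have := measurable_open_preimage (gaussian_coord_measurable gZ) (_ : open (~` K)).
by apply; rewrite openC.
Qed.

Section set.
Context (K : set E).
Hypothesis cK : closed K.
Hypothesis mK : forall a b, K a -> K b -> K (2^-1 *: (a + b)).
Hypothesis halfK : 2^-1 <= pr PY (Y @^-1` K).

Let K0 : K !=set0.
Proof.
apply/set0P/negP => /eqP K0.
move: halfK; rewrite K0 preimage_set0 /pr measure0 /= leNgt => /negP; apply.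
by rewrite invr_gt0.
Qed.

Let dK := dist K.

Let continuous_dK : continuous dK.
Proof. by apply: (@lip_continuous_normed _ _ _ 1) => x y; rewrite mul1r; exact: dist_lip. Qed.

Let measurable_dK (dT : measure_display) (T : measurableType dT)
  (P : probability T R) (Z : T -> E) (t : R) : gaussian_vector P Z ->
  measurable [set w | dK (Z w) <= t].
Proof.
move=> gZ; have := measurable_continuous_comp (gaussian_coord_measurable gZ) continuous_dK.
move=> /(_ measurableT [set` `]-oo, t]] (measurable_itv _)); rewrite setTI.
by congr measurable; apply/seteqP; split => w /=; rewrite in_itv.
Qed.

Let bndlip_lip1 (g : R -> R) (M : R) : (forall a b, `|g a - g b| <= `|a - b|) ->
  (forall a, 0 <= a -> `|g a| <= M) -> bndlip (fun w => g (dK w)).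
Proof.
move=> lg gM; exists 1, M; split.
  by move=> x y; rewrite mul1r (le_trans (lg _ _))//; exact: dist_lip.
by move=> w; apply: gM; exact: dist_ge0.
Qed.

(** Otherwise [K] has probability exactly 1/2 and the set of points at positive
distance at most [e] has probability 0.  The distance function restricted to the span of
[ys], the support of [Y], then takes no value strictly between 0 and [e]; by the intermediate value theorem
along segments from 0 it is either 0 on the whole span or at least [e] there.
So [Y] is near [K] with probability 1 or 0, against the value 1/2. *)
Let near_half (e : R) : 0 < e -> 2^-1 < pr PY [set w | dK (Y w) <= e].
Proof.
move=> e0; rewrite ltNge; apply/negP => le_half.
have mK' : measurable (Y @^-1` K) by exact: closed_preimage_measurable gaussY cK.
have me t := measurable_dK t gaussY.
have [ys ysE] := psd_factor (covariance_psd gaussY meanY covY).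
have sub : Y @^-1` K `<=` [set w | dK (Y w) <= e].
  by move=> w /= Kw; rewrite /dK dist0// ltW.
have eqh : pr PY (Y @^-1` K) = pr PY [set w | dK (Y w) <= e].
  apply/eqP; rewrite eq_le (le_trans le_half)// andbT; exact: pr_le.
have h2 : pr PY (Y @^-1` K) = 2^-1 by apply/eqP; rewrite eq_le halfK eqh le_half.
(* A bump, positive strictly between 0 and [e]. *)
pose psi (a : R) := Num.max 0 (Num.min a (e - a)).
have lpsi a b : `|psi a - psi b| <= `|a - b|.
  rewrite /psi ler_norml; have := ler_norm (a - b); have := ler_norm (b - a).
  rewrite distrC => h1 h3.
  case: (leP 0 (Num.min a (e - a))); case: (leP 0 (Num.min b (e - b)));
    case: (leP a (e - a)); case: (leP b (e - b)) => *; apply/andP; split; lra.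
have psi0 a : 0 <= psi a by rewrite /psi le_max lexx.
have bpsi : bndlip (fun w => psi (dK w)).
  apply: (@bndlip_lip1 _ e lpsi) => a a0; rewrite ger0_norm// /psi ge_max (ltW e0)/= ge_min.
  by apply/orP; right; lra.
have psi_int : smears ys (fun w => psi (dK w)) 0 = 0.
  rewrite -(gaussian_smears gaussY meanY covY ysE bpsi).
  apply/eqP; rewrite eq_le; apply/andP; split; last by apply: Rintegral_ge0.
  pose A := [set w | dK (Y w) <= e] `\` Y @^-1` K.
  have mA : measurable A by exact: measurableD.
  have A0 : pr PY A = 0.
    have fin : (PY [set w | (dK (Y w) <= e)%R] < +oo)%E by rewrite -(prE PY (me e)) ltry.
    apply/EFin_inj; rewrite (prE PY mA) (measureD (me e) mK' fin).
    rewrite (_ : _ `&` _ = Y @^-1` K); last by rewrite setIC; exact/setIidPl.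
    rewrite -[X in (X - _)%E](prE PY (me e)) -[X in (_ - X)%E](prE PY mK').
    by rewrite eqh -EFinB subrr.
  have := @Rintegral_le_pr _ _ _ PY (fun w => psi (dK (Y w))) A e 0 mA
     (bndlip_integrable gaussY bpsi).
  rewrite A0 mulr0 !addr0; apply.
    move=> w; rewrite /psi ge_max (ltW e0)/= ge_min; apply/orP; right.
    by have := dist_ge0 K0 (Y w); rewrite -/dK; lra.
  move=> w nA; rewrite /psi ge_max lexx /= ge_min.
  have [Kw|nK] := pselect (K (Y w)); first by rewrite /dK dist0// lexx.
  apply/orP; right; rewrite leNgt; apply/negP => h; apply: nA; split => //=; lra.
have psi_span := smears_eq0_span bpsi (fun w => psi0 _) psi_int.
have dich cs : size cs = size ys -> dK (comb ys cs) = 0 \/ e <= dK (comb ys cs).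
  move=> /psi_span; rewrite add0r /psi => h.
  have := dist_ge0 K0 (comb ys cs); rewrite -/dK le_eqVlt => /predU1P[<-|p0]; first by left.
  right; rewrite leNgt; apply/negP => p1.
  have : 0 < Num.max 0 (Num.min (dK (comb ys cs)) (e - dK (comb ys cs))).
    by rewrite lt_max lt_min p0 subr_gt0 p1 orbT.
  by rewrite h ltxx.
have same cs : size cs = size ys -> dK (comb ys cs) < e -> dK 0 < e.
  move=> hcs h; have [//|h0] := ltP (dK 0) e; exfalso.
  pose g (t : R) := dK (t *: comb ys cs).
  have cg : continuous g.
    apply: (@lip_continuous R `|comb ys cs| g) => s t; apply: (le_trans (dist_lip K0 _ _)).
    by rewrite -scalerBl normrZ mulrC.
  have mM : Num.min (g 0) (g 1) <= e / 2 <= Num.max (g 0) (g 1).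
    have g1 : g 1 = 0 by rewrite /g scale1r; have [//|] := dich cs hcs; rewrite leNgt h.
    have g0 : e <= g 0 by rewrite /g scale0r.
    by rewrite ge_min le_max g1; apply/andP; split; apply/orP; [right|left]; lra.
  have [t _ gt] := IVT ler01 (continuous_subspaceT cg) mM.
  have := dich [seq t * c | c <- cs]; rewrite size_map combZ => /(_ hcs).
  by rewrite -[dK _]/(g t) gt => -[]; lra.
have same' cs : size cs = size ys -> dK 0 < e -> dK (comb ys cs) < e.
  move=> hcs h; have [h0|h0] := ltP (dK (comb ys cs)) e; [by []|exfalso].
  pose g (t : R) := dK (t *: comb ys cs).
  have cg : continuous g.
    apply: (@lip_continuous R `|comb ys cs| g) => s t; apply: (le_trans (dist_lip K0 _ _)).
    by rewrite -scalerBl normrZ mulrC.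
  have dz : dK 0 = 0.
    have := dich [seq 0 * c | c <- cs]; rewrite size_map combZ scale0r => /(_ hcs).
    by move=> [//|]; rewrite leNgt h.
  have mM : Num.min (g 0) (g 1) <= e / 2 <= Num.max (g 0) (g 1).
    have g1 : e <= g 1 by rewrite /g scale1r.
    have g0 : g 0 = 0 by rewrite /g scale0r.
    by rewrite ge_min le_max g0; apply/andP; split; apply/orP; [left|right]; lra.
  have [t _ gt] := IVT ler01 (continuous_subspaceT cg) mM.
  have := dich [seq t * c | c <- cs]; rewrite size_map combZ => /(_ hcs).
  by rewrite -[dK _]/(g t) gt => -[]; lra.
(* On the span, this truncation is constant, equal to 0 or to [e]. *)
pose chi (a : R) := Num.min a e.
have lchi a b : `|chi a - chi b| <= `|a - b|.
  rewrite /chi ler_norml; have := ler_norm (a - b); have := ler_norm (b - a).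
  rewrite distrC => h1 h3.
  by case: (leP a e) => ?; case: (leP b e) => ?; apply/andP; split; lra.
have chi0 w : 0 <= chi (dK w) by rewrite /chi le_min dist_ge0 ?(ltW e0).
have bchi : bndlip (fun w => chi (dK w)).
  apply: (@bndlip_lip1 _ e lchi) => a a0.
  by rewrite ger0_norm /chi ?ge_min ?lexx ?orbT// le_min a0 ltW.
have chiE := gaussian_smears gaussY meanY covY ysE bchi.
have ichi := bndlip_integrable gaussY bchi.
have [d0|d0] := ltP (dK 0) e.
  have z : smears ys (fun w => chi (dK w)) 0 = 0.
    apply: smears_span_eq => cs hcs; rewrite add0r.
    have [->|] := dich cs hcs; first by rewrite /chi; case: leP => //; rewrite ltNge ltW.
    by rewrite leNgt same'.
  rewrite z in chiE.
  have := @pr_markov_le _ _ _ PY (fun w => chi (dK (Y w))) (~` [set w | dK (Y w) <= e]) e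
     (measurableC (me e)) ichi (fun w => chi0 _).
  rewrite chiE pr_setC// => H; have h : e * (1 - pr PY [set w | dK (Y w) <= e]) <= 0.
    by apply: H => w /= /negP; rewrite -ltNge /chi => h; rewrite le_min lexx andbT ltW.
  have : e * 2^-1 <= 0.
    apply: le_trans h; apply: ler_wpM2l; [exact: ltW|lra].
  by rewrite leNgt mulr_gt0// invr_gt0.
have z : smears ys (fun w => chi (dK w)) 0 = e.
  apply: smears_span_eq => cs hcs; rewrite add0r.
  have : e <= dK (comb ys cs).
    rewrite leNgt; apply/negP => /(same cs hcs); rewrite ltNge d0//.
  by rewrite /chi => h; apply/min_idPr.
rewrite z in chiE.
have := @Rintegral_le_pr _ _ _ PY (fun w => chi (dK (Y w))) (~` (Y @^-1` K)) e 0
     (measurableC mK') ichi.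
rewrite chiE pr_setC// !addr0 h2 => H.
have : e <= e * (1 - 2^-1).
  apply: H; first by move=> w; rewrite /chi ge_min lexx orbT.
  by move=> w /contrapT Kw; rewrite /dK dist0// /chi ge_min lexx.
by lra.
Qed.

(** The argument of [Phi] is concave, as the distance to [K] is convex.  It is at
least [N / 2] at distance up to [dl / 4] and at most [- N] at distance [dl] or
more. *)
Let ramp_ehrhard (dl N : R) : 0 < dl -> 0 < N ->
  ehrhard (fun w => Phi (N - (2 * N / dl) * dK w)).
Proof.
move=> dl0 N0; have L0 : 0 < 2 * N / dl by rewrite divr_gt0// mulr_gt0.
exists (2 * N / dl), (Phi N), (fun w => N - (2 * N / dl) * dK w); split => //.
- move=> w w'; apply: (le_trans (Phi_lip _ _)).
  rewrite opprB addrACA addrA addrC !addrA addNr add0r -mulrBr normrM (gtr0_norm L0).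
  by rewrite distrC; apply: (ler_wpM2l (ltW L0)); exact: dist_lip.
- by rewrite Phi_gt0 Phi_lt1.
- move=> w; rewrite Phi_le; have := mulr_ge0 (ltW L0) (dist_ge0 K0 w); rewrite -/dK; lra.
- move=> w w'; have := ler_wpM2l (ltW L0) (dist_midpoint K0 w w' mK).
  by rewrite -/dK; lra.
Qed.

(** As [N] grows, the ramp tends to 1 near [K] and to 0 away from it; the strict
inequality of [near_half] keeps its average for [Y] at least 1/2. *)
Let near_comparison (dl : R) : 0 < dl ->
  pr PY [set w | dK (Y w) <= dl / 4] <= pr PX [set w | dK (X w) <= dl].
Proof.
move=> dl0; have dl4 : 0 < dl / 4 by rewrite divr_gt0.
have q12 := near_half dl4; set q := pr PY _ in q12 *.
have mY := measurable_dK (dl / 4) gaussY; have mX := measurable_dK dl gaussX.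
have q1 : q <= 1 by exact: pr_le1.
apply/ler_addgt0Pr => e e0.
(* [eta] bounds the losses at both ends of the ramp. *)
pose eta := Num.min (e / 2) (q - 2^-1).
have eta0 : 0 < eta by rewrite lt_min divr_gt0//= subr_gt0.
have [eta1 eta2] : eta <= e / 2 /\ eta <= q - 2^-1.
  by split; rewrite ge_min lexx ?orbT.
have [x x0 hx] : exists2 x, 0 < x & 1 - eta < Phi x by apply: Phi_large; lra.
have x20 : 0 < 2 * x by rewrite mulr_gt0.
have eF := ramp_ehrhard dl0 x20; have bF := ehrhard_bndlip eF.
have lowY : Phi x * q <= \int[PY]_w Phi (2 * x - 2 * (2 * x) / dl * dK (Y w)).
  apply: (pr_markov_le mY (bndlip_integrable gaussY bF)).
    by move=> w; exact/ltW/Phi_gt0.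
  move=> w /= h; rewrite Phi_le.
  have := ler_wpM2l (ltW (divr_gt0 (mulr_gt0 (ltr0n _ 2) x20) dl0)) h.
  rewrite (_ : 2 * (2 * x) / dl * (dl / 4) = x); first by lra.
  by field; rewrite gt_eqF.
have upX : \int[PX]_w Phi (2 * x - 2 * (2 * x) / dl * dK (X w)) <=
    1 * pr PX [set w | dK (X w) <= dl] + Phi (- (2 * x)).
  apply: (Rintegral_le_pr mX (bndlip_integrable gaussX bF)).
    by move=> w; have := Phi_lt1 (2 * x - 2 * (2 * x) / dl * dK (X w));
      have := Phi_gt0 (- (2 * x)); lra.
  move=> w /= /negP; rewrite -ltNge => /ltW h; rewrite Phi_le.
  have := ler_wpM2l (ltW (divr_gt0 (mulr_gt0 (ltr0n _ 2) x20) dl0)) h.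
  rewrite (_ : 2 * (2 * x) / dl * dl = 4 * x); first by lra.
  by field; rewrite gt_eqF.
have xx : Phi x <= Phi (2 * x) by rewrite Phi_le; lra.
have : q - eta <= Phi x * q by nra.
move=> h; have := ehrhard_comparison eF (le_trans (le_trans _ h) lowY).
rewrite PhiN in upX; lra.
Qed.

Lemma set_comparison : pr PY (Y @^-1` K) <= pr PX (X @^-1` K).
Proof.
have mY := closed_preimage_measurable gaussY cK.
have mX := closed_preimage_measurable gaussX cK.
pose D n := [set w | dK (X w) <= n.+1%:R^-1].
have mD n : measurable (D n) by exact: measurable_dK gaussX.
have DE : \bigcap_n D n = X @^-1` K.
  apply/seteqP; split => w /= h; last by move=> n _; rewrite /D /= /dK dist0.
  apply: (dist_eq0 K0) => //; apply/eqP; rewrite eq_le dist_ge0// andbT.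
  apply/ler_addgt0Pr => e e0; rewrite add0r.
  have [n hn] := ltr_add_invr e0; rewrite add0r in hn.
  by apply: le_trans (ltW hn); exact: h.
have step n : pr PY (Y @^-1` K) <= pr PX (D n).
  have n0 : (0 : R) < n.+1%:R^-1 by rewrite invr_gt0.
  apply: le_trans (near_comparison n0); apply: pr_le => //.
    exact: measurable_dK gaussY.
  by move=> w /= Kw; rewrite /dK dist0// divr_ge0// ltW.
have niD : nonincreasing_seq D.
  move=> m n mn; apply/subsetPset => w /= h; apply: (le_trans h).
  by rewrite lef_pV2 ?posrE// ler_nat ltnS.
by rewrite -DE; exact: pr_bigcap.
Qed.

End set.

End comparison.

(** * The lower median *)

Section median.
Context (R : realType) (dT : measure_display) (T : measurableType dT)
  (P : probability T R) (W : T -> R).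
Hypothesis mW : forall t, measurable [set w | W w <= t].

Let medians := [set t : R | ((2^-1)%:E <= P [set w | (W w <= t)%R])%E].

Let mediansE t : medians t <-> 2^-1 <= pr P [set w | W w <= t].
Proof. by rewrite -lee_fin prE. Qed.

Let medians_has_inf : has_inf medians.
Proof.
split.
  apply: contrapT => h.
  have : pr P (\bigcup_n [set w | W w <= n%:R]) <= 2^-1.
    apply: pr_bigcup => // [m n mn|n]; first apply/subsetPset => w /= wm.
      by apply: (le_trans wm); rewrite ler_nat.
    by rewrite leNgt; apply/negP => /ltW/mediansE hn; apply: h; exists n%:R.
  rewrite (_ : \bigcup_n _ = setT) ?pr_setT; first by lra.
  apply/seteqP; split => // w _; exists (Num.truncn `|W w|).+1 => //=.
  by apply: (le_trans (ler_norm _)); apply/ltW; exact: truncnS_gt.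
apply: contrapT => h.
have : 2^-1 <= pr P (\bigcap_n [set w | W w <= - n%:R]).
  apply: pr_bigcap => // [m n mn|n]; first apply/subsetPset => w /= wm.
    by apply: (le_trans wm); rewrite lerN2 ler_nat.
  rewrite leNgt; apply/negP => hn; apply: h; exists (- n%:R) => t /mediansE ht.
  rewrite leNgt; apply/negP => tn; have := pr_le P (mW t) (mW (- n%:R)).
  by move=> /(_ (fun w wt => le_trans wt (ltW tn))); lra.
rewrite (_ : \bigcap_n _ = set0).
  by rewrite /pr measure0 /= leNgt invr_gt0 ltr0n.
apply/seteqP; split => // w /(_ (Num.truncn `|W w|).+1 I) /=; rewrite leNgt => /negP; apply.
by rewrite ltrNl; apply: le_lt_trans (truncnS_gt _); rewrite -normrN; exact: ler_norm.
Qed.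

(** The infimum is attained because the distribution function is continuous from
the right. *)
Lemma half_le_lower_median t : lower_median P W <= t -> 2^-1 <= pr P [set w | W w <= t].
Proof.
move=> mt; rewrite (_ : [set w | _] = \bigcap_n [set w | W w <= t + n.+1%:R^-1]).
  apply: pr_bigcap => // [m n mn|n].
    apply/subsetPset => w /= wm; apply: (le_trans wm).
    by rewrite lerD2l lef_pV2 ?posrE// ler_nat ltnS.
  have n0 : (0 : R) < n.+1%:R^-1 by rewrite invr_gt0.
  have [s /mediansE hs st] := inf_adherent n0 medians_has_inf.
  apply: (le_trans hs); apply: pr_le => // w /= ws; apply: (le_trans ws).
  by apply: (le_trans (ltW st)); rewrite lerD2r.
apply/seteqP; split => w /= h.
  by move=> n _ /=; apply: (le_trans h); rewrite lerDl invr_ge0.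
apply/ler_addgt0Pr => e e0; have [n hn] := ltr_add_invr e0; rewrite add0r in hn.
by apply: (le_trans (h n I)); rewrite lerD2l ltW.
Qed.

End median.

Theorem corollary2p3 (R : realType) (d : nat) (hd : (1 <= d)%N)
  (dX dY : measure_display) (TX : measurableType dX) (TY : measurableType dY)
  (PX : probability TX R) (PY : probability TY R)
  (X : TX -> 'rV[R]_d) (Y : TY -> 'rV[R]_d) (SigmaX SigmaY : 'M[R]_d)
  (gaussX : gaussian_vector PX X) (meanX : mean_zero PX X)
  (covX : has_covariance_matrix PX X SigmaX)
  (gaussY : gaussian_vector PY Y) (meanY : mean_zero PY Y)
  (covY : has_covariance_matrix PY Y SigmaY)
  (psd : psdmx (SigmaY - SigmaX))
  (f : 'rV[R]_d -> R)
  (lscf : lower_semicontinuous (fun w => (f w)%:E)) (qcf : quasiconvex f) :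
  let m := lower_median PY (fun w => f (Y w)) in
  [/\ forall a : R, m < a ->
        (PX [set w | (a <= f (X w))%R] <= PY [set w | (a <= f (Y w))%R])%E,
      (PX [set w | (m < f (X w))%R] <= PY [set w | (m < f (Y w))%R])%E
    & PX [set w | f (X w) = m] = 0%E ->
        (PX [set w | (m <= f (X w))%R] <= PY [set w | (m <= f (Y w))%R])%E].
Proof.
move=> m.
have closedf a : closed [set w | f w <= a].
  rewrite (_ : [set w | _] = ~` [set w | ((f w)%:E > a%:E)%E]).
    by rewrite closedC; exact: (lower_semicontinuousP _).1 lscf a.
  by apply/seteqP; split => w /=; rewrite lte_fin leNgt => /negP.
have midf a x y : f x <= a -> f y <= a -> f (2^-1 *: (x + y)) <= a.
  move=> fx fy; have h0 : (0 : R) <= 2^-1 by rewrite invr_ge0.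
  have h1 : (2^-1 : R) <= 1 by rewrite invf_le1// ler1n.
  pose half : {i01 R} := Itv01 h0 h1.
  have h := qcf a x y half (mem_set fx) (mem_set fy).
  rewrite (_ : 2^-1 *: (x + y) = 2^-1 *: x + (1 - 2^-1) *: y); first exact: (set_mem h).
  by rewrite scalerDr; congr (_ + _ *: _); lra.
have mX a : measurable [set w | f (X w) <= a].
  exact: (closed_preimage_measurable gaussX (closedf a)).
have mY a : measurable [set w | f (Y w) <= a].
  exact: (closed_preimage_measurable gaussY (closedf a)).
have sublevel a : m <= a -> pr PY [set w | f (Y w) <= a] <= pr PX [set w | f (X w) <= a].
  move=> ma; apply: (set_comparison gaussX meanX covX gaussY meanY covY psd) (closedf a) _ _.
    exact: midf.
  exact: half_le_lower_median.
have gtE (dT : measure_display) (T : measurableType dT) (W : T -> R) a :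
    [set w | a < W w] = ~` [set w | W w <= a].
  by apply/seteqP; split => w /=; rewrite ltNge => /negP.
have geE (dT : measure_display) (T : measurableType dT) (W : T -> R) a :
    [set w | a <= W w] = ~` [set w | W w < a].
  by apply/seteqP; split => w /=; rewrite leNgt => /negP.
have ltE (dT : measure_display) (T : measurableType dT) (W : T -> R) a c : 0 < c ->
    [set w | W w < a] = \bigcup_n [set w | W w <= a - c / n.+1%:R].
  move=> c0; apply/seteqP; split => w /= => [Wa|[n _ /= h]].
    have [n] : exists n, 0 + n.+1%:R^-1 < (a - W w) / c.
      by apply: ltr_add_invr; rewrite divr_gt0// subr_gt0.
    rewrite add0r ltr_pdivlMr// => hn; exists n => //=; by rewrite (mulrC c) lerBrDl -lerBrDr ltW.
  by apply: (le_lt_trans h); rewrite ltrBlDr ltrDl divr_gt0.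
have mlt (dT : measure_display) (T : measurableType dT) (W : T -> R) a :
    (forall t, measurable [set w | W w <= t]) -> measurable [set w | W w < a].
  by move=> mW; rewrite (ltE _ _ _ _ 1)//; exact: bigcup_measurable.
have part2 : (PX [set w | (m < f (X w))%R] <= PY [set w | (m < f (Y w))%R])%E.
  rewrite !gtE -!prE ?pr_setC//; try exact: measurableC.
  by rewrite lee_fin lerD2l lerN2 sublevel.
split => // [a ma|null].
  have msub n : m <= a - (a - m) / n.+1%:R.
    rewrite lerBrDr -lerBrDl.
    by apply: ler_piMr; [lra|rewrite invf_le1// ler1n].
  have nd : nondecreasing_seq (fun n => a - (a - m) / n.+1%:R).
    move=> i j ij; apply: lerB => //; apply: ler_wpM2l; first by lra.
    by rewrite lef_pV2 ?posrE// ler_nat ltnS.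
  have am : 0 < a - m by rewrite subr_gt0.
  have mXa := mlt _ _ _ a mX; have mYa := mlt _ _ _ a mY.
  rewrite !geE -!prE ?pr_setC//; try exact: measurableC.
  rewrite lee_fin lerD2l lerN2 [X in pr PY X](ltE _ _ _ _ _ am).
  apply: pr_bigcup => // [i j ij|n].
    by apply/subsetPset => w /= h; apply: (le_trans h); exact: nd.
  apply: (le_trans (sublevel _ (msub n))); apply: pr_le => // w /= h.
  by apply: (le_lt_trans h); rewrite ltrBlDr ltrDl divr_gt0.
have mgt : measurable [set w | m < f (X w)] by rewrite gtE; exact: measurableC.
have mgtY : measurable [set w | m < f (Y w)] by rewrite gtE; exact: measurableC.
have mgeY : measurable [set w | m <= f (Y w)].
  by rewrite geE; apply: measurableC; exact: mlt.
have meq : measurable [set w | f (X w) = m].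
  rewrite (_ : [set w | _] = [set w | f (X w) <= m] `\` [set w | f (X w) < m]).
    by apply: measurableD => //; exact: mlt.
  apply/seteqP; split => w /= => [->|[h /negP]]; first by rewrite lexx ltxx.
  by rewrite -leNgt => h'; apply/eqP; rewrite eq_le h h'.
rewrite (_ : [set w | m <= f (X w)] = [set w | f (X w) = m] `|` [set w | m < f (X w)]).
  apply: le_trans (measureU2 PX meq mgt) _; rewrite [X in (X + _)%E]null add0e.
  apply: (le_trans part2); apply: le_measure; rewrite ?inE// => w /=; exact: ltW.
apply/seteqP; split => w /=; rewrite le_eqVlt.
  by move=> /predU1P[->|]; [left|right].
by case=> [->|->]; rewrite ?eqxx ?orbT.
Qed.
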